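(* (1) For all $w,v\in W$, $$Y^{m}_\Pi\bullet\Big((\gamma_w^-\odot \mathrm{pt}_e)\cdot(\gamma^+_{v^{-1}w_0}\bullet \mathrm{pt}_{w_0})\Big)=\delta_{w,v}\prod_{\alpha>0}(t-t^{-1}e^{-\alpha})\,\mathbb{1}.$$ (2) Let $J\subset\Pi$. For all $w,u\in W^J$, $$Y^{m}_{\Pi/J}\bullet\Big(\big(Y^{m}_J\bullet(\gamma_w^-\odot \mathrm{pt}_e)\big)\cdot(\gamma^+_{u^{-1}w_0}\bullet \mathrm{pt}_{w_0})\Big)=\delta_{w,u}\prod_{\alpha>0}(t-t^{-1}e^{-\alpha})\,\mathbb{1}.$$
   Context: Let $G$ be a split reductive group with maximal torus $T$, character lattice $\Lambda$, root system $\Sigma$ with positive roots $\alpha>0$, simple roots $\Pi$, Weyl group $W$ acting on $\Lambda$, length $\ell$, Bruhat order $\le$, longest element $w_0$. For $J\subset \Pi$, $\Sigma_J$ is the root subsystem spanned by $J$, $W_J$ the parabolic subgroup, $W^J$ the set of minimal length representatives of $W/W_J$. Let $R=\mathbb{Z}[t,t^{-1}]$, $S^m=R[\Lambda]$ (basis $e^\lambda$), $Q^m$ its fraction field, $W$ acting by $w(e^\lambda)=e^{w\lambda}$. $Q^m_W$ is the left $Q^m$-module with basis $\delta^m_w$ and product $(a\delta^m_w)(b\delta^m_v)=a\,w(b)\delta^m_{wv}$. For a simple root $\alpha$, $\tau_\alpha=\frac{t^{-1}-t}{1-e^{-\alpha}}+\frac{t-t^{-1}e^{-\alpha}}{1-e^{-\alpha}}\delta^m_{s_\alpha}$,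 $\tau_w$ the product along any reduced word. With $t_w=t^{\ell(w)}$, $\epsilon_w=(-1)^{\ell(w)}$ and Kazhdan–Lusztig polynomials $P_{w,v}$: $\gamma_v^+=\sum_{w\le v}t_vt_w^{-1}P_{w,v}(t^{-2})\tau_w$, $\gamma_v^-=\sum_{w\le v}\epsilon_w\epsilon_vt_v^{-1}t_wP_{w,v}(t^2)\tau_w$. Let $(Q^m_W)^*=\mathrm{Hom}_{Q^m}(Q^m_W,Q^m)$ with $Q^m$-basis $f_w$ dual to $\delta^m_w$, with the product $(\sum_w a_wf_w)(\sum_w b_wf_w)=\sum_w a_wb_wf_w$ and unit $\mathbb 1=\sum_{w}f_w$. Two actions of $Q^m_W$ on $(Q^m_W)^*$ are given by $a\delta^m_w\bullet bf_v=b\,(vw^{-1})(a)\,f_{vw^{-1}}$ and $a\delta^m_w\odot bf_v=a\,w(b)\,f_{wv}$ ($a,b\in Q^m$), extended additively. Put $x_\alpha=1-e^{-\alpha}$, $x^m_J=\prod_{\alpha\in\Sigma_J,\alpha<0}x_\alpha$, $x^m_\Pi=\prod_{\alpha<0}x_\alpha$, $x^m_{\Pi/J}=x^m_\Pi/x^m_J$; $\mathrm{pt}_e=x^m_\Pi f_e$ and $\mathrm{pt}_w=\delta^m_w\bullet\mathrm{pt}_e=w(x^m_\Pi)f_w$. Set $Y^m_J=\sum_{w\in W_J}\delta^m_w\frac{1}{x^m_J}$, $Y^m_\Pi=\sum_{w\in W}\delta^m_w\frac{1}{x^m_\Pi}$, and, for a fixed set $A$ of representatives of the left cosets $W/W_J$,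 $Y^m_{\Pi/J}=\sum_{w\in A}\delta^m_w\frac{1}{x^m_{\Pi/J}}$.
   Formalization: The context's two expressions for pt_w disagree: with the given • one has δ_w • pt_e = x_Π f_{w^{-1}}, for which (1) fails already in type A1 (w=v=e). The formal statement takes the explicit formula pt_w = w(x_Π) f_w. *)

(* Defs.v *)
From HB Require Import structures.
From mathcomp Require Import all_boot all_algebra fraction.
From mathcomp Require Import mpoly.
From Stdlib Require Import ClassicalEpsilon Relations.

Set Implicit Arguments.
Unset Strict Implicit.
Unset Printing Implicit Defensive.

Import GRing.Theory.
Local Open Scope ring_scope.

Definition pb (P : Prop) : bool :=
  if excluded_middle_informative P then true else false.

Section RootDatum.

(* Lambda = Z^n (column vectors); the dual lattice is also Z^n, with pairing
   <l, c> = c^T l. *)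
Variable n : nat.

Definition pairing (l c : 'cV[int]_n) : int := (c^T *m l) 0 0.

(* s_alpha (l) = l - <l,alpha^v> alpha ;  s_{alpha^v}(u) = u - <alpha,u> alpha^v *)
Definition refl_root (a c : 'cV[int]_n) : 'M[int]_n := 1%:M - a *m c^T.
Definition refl_coroot (a c : 'cV[int]_n) : 'M[int]_n := 1%:M - c *m a^T.

(* A reduced root datum: R is the list of pairs (alpha, alpha^v); the
   bijection alpha <-> alpha^v is encoded by the pairing in the list. *)
Definition is_root_datum (R : seq ('cV[int]_n * 'cV[int]_n)) : Prop :=
  uniq (unzip1 R) /\ uniq (unzip2 R) /\
  (forall a c, (a, c) \in R -> pairing a c = 2) /\
  (forall a c b, (a, c) \in R -> b \in unzip1 R ->
                 refl_root a c *m b \in unzip1 R) /\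
  (forall a c d, (a, c) \in R -> d \in unzip2 R ->
                 refl_coroot a c *m d \in unzip2 R) /\
  (forall a, a \in unzip1 R -> (2%:Z *: a) \notin unzip1 R).

Variable R : seq ('cV[int]_n * 'cV[int]_n).
Variable Pi : seq 'cV[int]_n.

Definition roots : seq 'cV[int]_n := unzip1 R.
Definition coroot (a : 'cV[int]_n) : 'cV[int]_n := nth 0 (unzip2 R) (index a roots).
Definition refl (a : 'cV[int]_n) : 'M[int]_n := refl_root a (coroot a).

Definition int_comb (S : seq 'cV[int]_n) (b : 'cV[int]_n) : Prop :=
  exists c : nat -> int, b = \sum_(i < size S) c i *: S`_i.
Definition nonneg_comb (S : seq 'cV[int]_n) (b : 'cV[int]_n) : Prop :=
  exists c : nat -> int, (forall i, 0 <= c i) /\ b = \sum_(i < size S) c i *: S`_i.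

Definition is_base : Prop :=
  uniq Pi /\ {subset Pi <= roots} /\
  (forall c : nat -> int, \sum_(i < size Pi) c i *: Pi`_i = 0 ->
      forall i, (i < size Pi)%N -> c i = 0) /\
  (forall b, b \in roots -> nonneg_comb Pi b \/ nonneg_comb Pi (- b)).

Definition pos_root (b : 'cV[int]_n) : bool := pb (b \in roots /\ nonneg_comb Pi b).
Definition neg_root (b : 'cV[int]_n) : bool := pb (b \in roots /\ nonneg_comb Pi (- b)).

Definition word_prod (ws : seq 'cV[int]_n) : 'M[int]_n :=
  foldr (fun a M => refl a *m M) 1%:M ws.
Definition in_W (w : 'M[int]_n) : Prop :=
  exists ws, {subset ws <= roots} /\ w = word_prod ws.
Definition W_list : seq 'M[int]_n :=
  epsilon (inhabits [::]) (fun s => uniq s /\ forall w, w \in s <-> in_W w).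

Definition is_length (w : 'M[int]_n) (k : nat) : Prop :=
  (exists ws, {subset ws <= Pi} /\ w = word_prod ws /\ size ws = k) /\
  (forall ws, {subset ws <= Pi} -> w = word_prod ws -> (k <= size ws)%N).
Definition len (w : 'M[int]_n) : nat := epsilon (inhabits 0%N) (is_length w).
Definition red_word (w : 'M[int]_n) : seq 'cV[int]_n :=
  epsilon (inhabits [::])
    (fun ws => {subset ws <= Pi} /\ w = word_prod ws /\ size ws = len w).

Definition bruhat_step (u u' : 'M[int]_n) : Prop :=
  exists a, a \in roots /\ u' = u *m refl a /\ (len u < len u')%N.
Definition bruhat : 'M[int]_n -> 'M[int]_n -> Prop := clos_refl_trans _ bruhat_step.

Definition w0 : 'M[int]_n :=
  epsilon (inhabits 1%:M)
    (fun w => in_W w /\ forall u, in_W u -> (len u <= len w)%N).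

Definition in_WJ (J : seq 'cV[int]_n) (w : 'M[int]_n) : Prop :=
  exists ws, {subset ws <= J} /\ w = word_prod ws.
Definition in_WJmin (J : seq 'cV[int]_n) (w : 'M[int]_n) : Prop :=
  in_W w /\ forall x, in_WJ J x -> (len w <= len (w *m x))%N.
Definition is_coset_reps (J : seq 'cV[int]_n) (A : seq 'M[int]_n) : Prop :=
  uniq A /\ (forall a, a \in A -> in_W a) /\
  (forall w, in_W w -> exists a, a \in A /\ exists x, in_WJ J x /\ w = a *m x) /\
  (forall a b, a \in A -> b \in A ->
     (exists x, in_WJ J x /\ b = a *m x) -> a = b).

(* Kazhdan-Lusztig polynomials, characterised by P_{x,e} = delta_{x,e} and the
   Kazhdan-Lusztig recursion (valid for every simple s with sv < v). *)
Definition mu (P : 'M[int]_n -> 'M[int]_n -> {poly int}) (z y : 'M[int]_n) : int :=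
  if odd (len y - len z) then (P z y)`_((len y - len z).-1./2) else 0.
Definition KL_rec (P : 'M[int]_n -> 'M[int]_n -> {poly int}) : Prop :=
  (forall x, in_W x -> P x 1%:M = (x == 1%:M)%:R) /\
  (forall v a x, in_W v -> a \in Pi -> (len (refl a *m v) < len v)%N -> in_W x ->
     let s := refl a in
     let c : nat := (len (s *m x) < len x)%N in
     P x v = 'X^(1 - c) * P (s *m x) (s *m v) + 'X^c * P x (s *m v)
       - \sum_(z <- W_list | pb (bruhat z (s *m v)) && (z != s *m v)
                             && (len (s *m z) < len z)%N)
            (mu P z (s *m v))%:P * 'X^((len v - len z)./2) * P x z).
Definition KL : 'M[int]_n -> 'M[int]_n -> {poly int} :=
  epsilon (inhabits (fun _ _ => 0)) KL_rec.

(* Q^m = fraction field of Z[t,t^-1][Lambda]; variable 0 is t, variables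
   1..n are e^{eps_i} for the standard basis eps_i of Lambda = Z^n. *)
Definition Qm : fieldType := {fraction {mpoly int[n.+1]}}.
Definition tt : Qm := FracField.tofrac ('X_ord0 : {mpoly int[n.+1]}).
Definition ex (l : 'cV[int]_n) : Qm :=
  \prod_(i < n) (FracField.tofrac ('X_(lift ord0 i) : {mpoly int[n.+1]})) ^ (l i ord0).
Definition evalQ (p : {poly int}) (x : Qm) : Qm := (map_poly (fun z : int => z%:~R) p).[x].

Definition is_W_act (w : 'M[int]_n) (f : Qm -> Qm) : Prop :=
  (forall x y, f (x + y) = f x + f y) /\ (forall x y, f (x * y) = f x * f y) /\
  f 1 = 1 /\ f tt = tt /\ (forall l, f (ex l) = ex (w *m l)).
Definition act (w : 'M[int]_n) : Qm -> Qm := epsilon (inhabits id) (is_W_act w).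

(* Elements of Q^m_W (coefficients of delta_w) and of (Q^m_W)^*
   (coefficients of f_w) are both represented by coefficient functions
   W -> Q^m (only values at elements of W matter). *)
Definition dlt (w : 'M[int]_n) : 'M[int]_n -> Qm := fun u => (u == w)%:R.
Definition scal (a : Qm) : 'M[int]_n -> Qm := fun u => a * dlt 1%:M u.
Definition QWmul (x y : 'M[int]_n -> Qm) : 'M[int]_n -> Qm :=
  fun u => \sum_(w <- W_list) \sum_(v <- W_list | w *m v == u) x w * act w (y v).
(* a delta_w . b f_v = b (v w^-1)(a) f_{v w^-1} *)
Definition bullet (x f : 'M[int]_n -> Qm) : 'M[int]_n -> Qm :=
  fun u => \sum_(w <- W_list) \sum_(v <- W_list | u *m w == v) f v * act u (x w).
(* a delta_w (.) b f_v = a w(b) f_{wv} *)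
Definition odot (x f : 'M[int]_n -> Qm) : 'M[int]_n -> Qm :=
  fun u => \sum_(w <- W_list) \sum_(v <- W_list | w *m v == u) x w * act w (f v).
Definition dmul (f g : 'M[int]_n -> Qm) : 'M[int]_n -> Qm := fun u => f u * g u.
Definition one_dual : 'M[int]_n -> Qm := fun _ => 1.

Definition xa (a : 'cV[int]_n) : Qm := 1 - ex (- a).
Definition tau_s (a : 'cV[int]_n) : 'M[int]_n -> Qm :=
  fun u => (tt^-1 - tt) / xa a * dlt 1%:M u
           + (tt - tt^-1 * ex (- a)) / xa a * dlt (refl a) u.
Definition tau (w : 'M[int]_n) : 'M[int]_n -> Qm :=
  foldr QWmul (dlt 1%:M) (map tau_s (red_word w)).

Definition gamma_p (v : 'M[int]_n) : 'M[int]_n -> Qm :=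
  fun u => \sum_(w <- W_list | pb (bruhat w v))
     tt ^+ len v / tt ^+ len w * evalQ (KL w v) (tt ^- 2) * tau w u.
Definition gamma_m (v : 'M[int]_n) : 'M[int]_n -> Qm :=
  fun u => \sum_(w <- W_list | pb (bruhat w v))
     (-1) ^+ len w * (-1) ^+ len v / tt ^+ len v * tt ^+ len w
       * evalQ (KL w v) (tt ^+ 2) * tau w u.

Definition in_span (J : seq 'cV[int]_n) (b : 'cV[int]_n) : bool := pb (int_comb J b).
Definition xPi : Qm := \prod_(b <- roots | neg_root b) xa b.
Definition xJ (J : seq 'cV[int]_n) : Qm :=
  \prod_(b <- roots | neg_root b && in_span J b) xa b.
Definition xPiJ (J : seq 'cV[int]_n) : Qm := xPi / xJ J.

Definition pt_e : 'M[int]_n -> Qm := fun u => xPi * dlt 1%:M u.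
Definition pt (w : 'M[int]_n) : 'M[int]_n -> Qm := fun u => act w xPi * dlt w u.

Definition YPi : 'M[int]_n -> Qm :=
  fun u => \sum_(w <- W_list) QWmul (dlt w) (scal xPi^-1) u.
Definition YJ (J : seq 'cV[int]_n) : 'M[int]_n -> Qm :=
  fun u => \sum_(w <- W_list | pb (in_WJ J w)) QWmul (dlt w) (scal (xJ J)^-1) u.
Definition YPiJ (J : seq 'cV[int]_n) (A : seq 'M[int]_n) : 'M[int]_n -> Qm :=
  fun u => \sum_(w <- A) QWmul (dlt w) (scal (xPiJ J)^-1) u.

Definition prod_pos : Qm := \prod_(b <- roots | pos_root b) (tt - tt^-1 * ex (- b)).

End RootDatum.

(* Main.v *)
(* With gamma^- expanded as sum_u a_u delta_u, the left-hand side of (1) is w0(x_Pi) times the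
   coefficient of delta_{w0} in the product gamma_w^- gamma_{v^-1 w0}^+, because
   Y_Pi sums the values f(u) / u(x_Pi) over u in W.  The tau_w are a standard basis H_w of the
   Hecke algebra inside Q_W, triangular with respect to the delta_w, and gamma^+, gamma^- are the
   two Kazhdan-Lusztig bases, fixed by the bar involution; the latter is the coefficientwise
   extension of the field automorphism t -> t^-1, e^l -> e^-l.  Up to the bar-invariant coefficient
   kappa of delta_{w0} in tau_{w0}, the functional "coefficient of delta_{w0}" makes tau_x and
   bar(tau_{x^-1 w0}) dual bases.  Expanding gamma^- in the tau_x and gamma^+ = bar(gamma^+) in
   the bar(tau_y), the coefficient is kappa times an element of [w = v] + t^-1 Z[t^-1]; being
   bar-invariant, that element is [w = v].

   That tau_w does not depend on the reduced word comes from the braid relations in rank two,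
   checked for the Cartan integers allowed by a root datum (m = 2, 3, 4, 6) as identities of
   rational functions, and from Matsumoto's exchange argument.  Kazhdan-Lusztig polynomials are
   constructed by induction on the length, independence of the chosen descent being the
   uniqueness of bar-invariant elements with prescribed leading term.

   Part (2) reduces to (1): for u in W^J and a in J, s_a is a left descent of u^-1 w0, hence
   s_a gamma^+ = gamma^+, and the second factor is invariant under W_J. *)
Require Import Defs.
From HB Require Import structures.
From mathcomp Require Import all_boot all_order all_algebra fraction generic_quotient.
From mathcomp Require Import mpoly ring zify.
From Stdlib Require Import ClassicalEpsilon FunctionalExtensionality Relations Classical.
Set Implicit Arguments.
Unset Strict Implicit.
Unset Printing Implicit Defensive.
Import Order.TTheory GRing.Theory Num.Theory.
Local Open Scope ring_scope.

(** * The field Q^m and its automorphisms *)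

(** Everything runs on one scalar, c(g) = (t^-1 - t e^-g)/(1 - e^-g). It is bar-invariant, satisfies
    c(-g) = t + t^-1 - c(g), and tau_alpha = (c(alpha) - t) + c(-alpha) delta_s for s = s_alpha.
    Right multiplication by tau_alpha thus involves, at the coefficient of delta_x, only the value
    c(x alpha). Of the root system, the Hecke algebra argument uses only these values, the length,
    the Bruhat order and the independence of reduced words, so it is made for an abstract group;
    root data enter when its hypotheses are verified. Two features of the definitions shape the
    rest. The list of W, its action on Q^m, the length, w0 and the Kazhdan-Lusztig polynomials are
    choices by [epsilon]: each needs a proof of existence, and a property such as multiplicativity
    of the action needs uniqueness as well. The axioms of a root datum only say that reflections
    preserve the set of roots and the set of coroots; that they respect the bijection between the
    two has to be derived. *)

Lemma pbP (P : Prop) : reflect P (pb P).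
Proof. by rewrite /pb; case: excluded_middle_informative => H; constructor. Qed.

Lemma frac_eq (D : idomainType) (x : {fraction D}) :
  x = FracField.tofrac (\n_(repr x)) / FracField.tofrac (\d_(repr x)).
Proof.
have dn0 : FracField.tofrac (\d_(repr x)) != 0 by rewrite tofrac_eq0 denom_ratioP.
apply: (mulIf dn0); rewrite divfK //.
rewrite -{1}[x]reprK; set r := repr x.
rewrite !piE; apply/eqmodP => /=.
rewrite FracField.equivfE /FracField.mulf !numden_Ratio ?mulf_neq0 ?oner_neq0 ?denom_ratioP //.
by rewrite !mulr1 mulrC.
Qed.

Definition is_hom (F : fieldType) (f : F -> F) : Prop :=
  (forall x y, f (x + y) = f x + f y) /\ (forall x y, f (x * y) = f x * f y) /\ f 1 = 1.

Lemma is_hom_rmorph (F : fieldType) (f : F -> F) :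
  is_hom f -> exists g : {rmorphism F -> F}, (g : F -> F) = f.
Proof.
case=> fD [fM f1].
have fB : zmod_morphism f.
  move=> x y; apply: (addIr (f y)); by rewrite -fD !subrK.
have fm : monoid_morphism f by split.
pose h := GRing.isZmodMorphism.Build F F f fB.
pose h' := GRing.isMonoidMorphism.Build F F f fm.
pose g : {rmorphism F -> F} := HB.pack f h h'.
by exists g.
Qed.

(** * Monomial substitutions on the fraction field *)

Section Monomials.
Variable n : nat.
Notation Q := (Qm n).
Notation P := {mpoly int[n.+1]}.
Notation tof := (@FracField.tofrac {mpoly int[n.+1]}).

Definition mon (k : 'cV[int]_n.+1) : Q := \prod_(i < n.+1) (tof 'X_i) ^ (k i 0).

Lemma tofX_neq0 (i : 'I_n.+1) : tof 'X_i != 0.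
Proof. rewrite tofrac_eq0; apply/negP => /eqP /mpolyP /(_ U_(i)%MM).
by rewrite mcoeff0 mcoeffX eqxx. Qed.

Lemma mon0 : mon 0 = 1.
Proof. by rewrite /mon big1 // => i _; rewrite mxE expr0z. Qed.

Lemma monD k l : mon (k + l) = mon k * mon l.
Proof.
rewrite /mon -big_split; apply: eq_bigr => i _.
by rewrite mxE expfzDr // tofX_neq0.
Qed.

Lemma mon_neq0 k : mon k != 0.
Proof. by apply/prodf_neq0 => i _; rewrite expfz_neq0 // tofX_neq0. Qed.

Lemma monN k : mon (- k) = (mon k)^-1.
Proof.
by apply: (mulIf (mon_neq0 k)); rewrite -monD addNr mon0 mulVf ?mon_neq0.
Qed.

Lemma mon_delta i : mon (delta_mx i 0) = tof 'X_i.
Proof.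
rewrite /mon (bigD1 i) //= big1 => [|j /negPf ji]; rewrite !mxE ?eqxx ?mulr1 ?expr1z //.
by rewrite ji expr0z.
Qed.

Definition mvec (m : 'X_{1..n.+1}) : 'cV[int]_n.+1 := \col_i (m i : int).

Lemma mvec_inj : injective mvec.
Proof.
move=> m1 m2 /colP E; apply/mnmP => i.
by have := E i; rewrite !mxE => - [].
Qed.

Lemma mon_mvec m : mon (mvec m) = tof 'X_[m].
Proof.
rewrite mpolyXE_id rmorph_prod; apply: eq_bigr => i _.
by rewrite mxE /= rmorphXn.
Qed.

Variable M : 'M[int]_n.+1.

Definition msubst (p : P) : Q := mmap (intmul 1) (fun i => mon (col i M)) p.

Lemma mon_mulmx (m : 'X_{1..n.+1}) :
  mmap1 (fun i => mon (col i M)) m = mon (M *m mvec m).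
Proof.
have -> : M *m mvec m = \sum_i (col i M *+ m i).
  apply/colP => j; rewrite mxE summxE; apply: eq_bigr => i _.
  by rewrite mulmxnE !mxE -mulr_natr natz.
rewrite /mmap1 (big_morph mon monD mon0); apply: eq_bigr => i _.
elim: (m i) => [|e IH]; first by rewrite mulr0n mon0.
by rewrite exprS mulrS monD IH.
Qed.

Lemma msubst_X m : msubst 'X_[m] = mon (M *m mvec m).
Proof. by rewrite /msubst mmapX mon_mulmx. Qed.

Variable M' : 'M[int]_n.+1.
Hypothesis MK : M' *m M = 1%:M.

Lemma mul_inj p : injective (fun x : 'M[int]_(n.+1, p) => M *m x).
Proof.
by move=> x y /= E; rewrite -[x]mul1mx -[y]mul1mx -MK -!mulmxA E.
Qed.

(** The left inverse of [M] makes the substitution injective on exponent vectors, so distinct terms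
    of [p] cannot cancel; one common monomial factor first clears the negative exponents. *)
Lemma msubst_neq0 p : p != 0 -> msubst p != 0.
Proof.
move=> p0.
(* A shift large enough for every exponent that occurs: each |(M m)_i| is one of the summands of
   N_i. *)
pose N : 'cV[int]_n.+1 := \col_i \sum_(m <- msupp p) `|(M *m mvec m) i 0|.
pose g (m : 'X_{1..n.+1}) : 'X_{1..n.+1} := [multinom absz ((N + M *m mvec m)%R i ord0) | i < n.+1].
have gE m : m \in msupp p -> mvec (g m) = N + M *m mvec m.
  move=> mp; apply/colP => i; rewrite [LHS]mxE mnmE gez0_abs //.
  rewrite mxE [N i _]mxE (big_rem m mp) /=.
  set s := \sum_(y <- _) _; set a := (M *m mvec m) i 0.
  have s0 : 0 <= s by apply: sumr_ge0 => j _; exact: normr_ge0.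
  have := ler_norm (- a); rewrite normrN; lia.
have Ei : mon N * msubst p = tof (\sum_(m <- msupp p) p@_m *: 'X_[g m]).
  rewrite /msubst /mmap mulr_sumr rmorph_sum /= !big_seq; apply: eq_bigr => m mp.
  rewrite mon_mulmx mulrCA -monD -gE // mon_mvec -mul_mpolyC rmorphM /=; congr (_ * _).
  by rewrite -{2}[p@_m]intz !rmorph_int.
have gI : {in msupp p &, injective g}.
  move=> m1 m2 p1 p2 E; apply: mvec_inj; apply: mul_inj.
  by apply: (addrI N) => /=; rewrite -!gE // E.
suff : mon N * msubst p != 0 by rewrite mulf_eq0 negb_or => /andP[].
rewrite Ei tofrac_eq0; apply/negP => /eqP /mpolyP /(_ (g (mlead p))).
rewrite mcoeff0 raddf_sum /= (big_rem _ (mlead_supp p0)) /= mcoeffZ mcoeffX eqxx mulr1.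
rewrite big_seq big1 ?addr0; first by move/eqP; rewrite mleadc_eq0 (negPf p0).
move=> m; rewrite mem_rem_uniq // inE => /andP[mN mp].
rewrite mcoeffZ mcoeffX; case: eqP => [E|_]; last by rewrite mulr0.
by case/eqP: mN; apply: gI => //; exact: mlead_supp.
Qed.

Definition fsubst (x : Q) : Q := msubst (\n_(repr x)) / msubst (\d_(repr x)).

HB.instance Definition _ := GRing.RMorphism.copy msubst (mmap (intmul 1) (fun i => mon (col i M))).

(** [repr] returns some fraction equal to p/q; cross-multiplication and injectivity of the
    substitution remove the dependence on this choice. *)
Lemma fsubst_frac p q : q != 0 -> fsubst (tof p / tof q) = msubst p / msubst q.
Proof.
move=> q0; set x := tof p / tof q.
have d0 : \d_(repr x) != 0 by apply: denom_ratioP.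
have E : tof p * tof \d_(repr x) = tof \n_(repr x) * tof q.
  have : tof p / tof q = tof (\n_(repr x)) / tof (\d_(repr x)) := frac_eq x.
  by move/eqP; rewrite GRing.eqr_div ?tofrac_eq0 // => /eqP.
move: E; rewrite -!tofracM => /eqP; rewrite tofrac_eq => /eqP E.
have ms x' y' : msubst (x' * y') = msubst x' * msubst y' := rmorphM _ x' y'.
by apply/eqP; rewrite GRing.eqr_div ?msubst_neq0 // -!ms E.
Qed.

Lemma fsubst_hom : is_hom fsubst.
Proof.
have fr (x : Q) : exists p q, q != 0 /\ x = tof p / tof q.
  by exists (\n_(repr x)), (\d_(repr x)); split; [apply: denom_ratioP|apply: frac_eq].
split; [|split].
- move=> x y; have [p [q [q0 ->]]] := fr x; have [p' [q' [q0' ->]]] := fr y.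
  rewrite GRing.addf_div ?tofrac_eq0 // -!tofracM -tofracD !fsubst_frac ?mulf_neq0 //.
  by rewrite GRing.addf_div ?msubst_neq0 // rmorphD !rmorphM.
- move=> x y; have [p [q [q0 ->]]] := fr x; have [p' [q' [q0' ->]]] := fr y.
  rewrite GRing.mulf_div -!tofracM !fsubst_frac ?mulf_neq0 //.
  by rewrite GRing.mulf_div !rmorphM.
- rewrite -[1 in LHS](divff (oner_neq0 _)) -tofrac1 fsubst_frac ?oner_neq0 //.
  by rewrite rmorph1 divr1.
Qed.

Lemma fsubst_mon k : fsubst (mon k) = mon (M *m k).
Proof.
have [f fE] := is_hom_rmorph fsubst_hom.
have H m : fsubst (mon (mvec m)) = mon (M *m mvec m).
  rewrite mon_mvec -[tof _]divr1 -tofrac1 fsubst_frac ?oner_neq0 // rmorph1 divr1.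
  exact: msubst_X.
pose kp : 'X_{1..n.+1} := [multinom absz (Num.max (k i 0%R) 0%R) | i < n.+1].
pose kn : 'X_{1..n.+1} := [multinom absz (Num.max (- k i 0%R)%R 0%R) | i < n.+1].
have kE : k = mvec kp - mvec kn.
  apply/colP => i; rewrite !mxE !mnmE; lia.
rewrite kE monD monN -fE rmorphM fmorphV /= fE !H.
by rewrite mulmxBr monD monN.
Qed.
End Monomials.

(** The coefficients are integers, which every homomorphism fixes, so the variables generate the
    field. *)
Lemma is_hom_ext n (f g : Qm n -> Qm n) : is_hom f -> is_hom g ->
  (forall i : 'I_n.+1, f (FracField.tofrac 'X_i) = g (FracField.tofrac 'X_i)) -> f =1 g.
Proof.
move=> /is_hom_rmorph[f' <-] /is_hom_rmorph[g' <-] {f g} H x.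
have HP (p : {mpoly int[n.+1]}) : f' (FracField.tofrac p) = g' (FracField.tofrac p).
  rewrite (mpolyE p) !rmorph_sum; apply: eq_bigr => m _.
  rewrite -mul_mpolyC !rmorphM /=; congr (_ * _).
    by rewrite -[p@_m]intz !rmorph_int.
  rewrite mpolyXE_id !rmorph_prod; apply: eq_bigr => i _.
  by rewrite !rmorphXn /= H.
by rewrite (frac_eq x) !rmorphM /= !fmorphV /= !HP.
Qed.

(** * The action of lattice automorphisms and the bar automorphism *)

Section Action.
Variable n : nat.
Notation Q := (Qm n).
Implicit Types (l : 'cV[int]_n) (w : 'M[int]_n).

(** Exponent vectors have n+1 coordinates, coordinate 0 being the exponent of t; this embeds Lambda
    as the vectors free of t. *)
Definition lat (l : 'cV[int]_n) : 'cV[int]_n.+1 :=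
  \col_i (if unlift ord0 i is Some j then l j 0 else 0).

Lemma lat_lift l (i : 'I_n) j : lat l (lift ord0 i) j = l i 0.
Proof. by rewrite mxE liftK. Qed.

Lemma lat0 l j : lat l ord0 j = 0.
Proof. by rewrite mxE unlift_none. Qed.

Lemma ex_mon l : ex l = mon (lat l).
Proof.
rewrite /mon big_ord_recl lat0 expr0z mul1r.
by apply: eq_bigr => i _; rewrite lat_lift.
Qed.

Lemma latD k l : lat k + lat l = lat (k + l).
Proof. by apply/colP => i; rewrite !mxE; case: unlift => [j|]; rewrite ?mxE ?addr0. Qed.

Lemma latN l : - lat l = lat (- l).
Proof. by apply/colP => i; rewrite !mxE; case: unlift => [j|]; rewrite ?mxE ?oppr0. Qed.

Lemma lat_0 : lat 0 = 0.
Proof. by apply/colP => i; rewrite !mxE; case: unlift => [j|]; rewrite ?mxE. Qed.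

Lemma exD k l : ex (k + l) = ex k * ex l.
Proof. by rewrite !ex_mon -monD latD. Qed.

Lemma exN l : ex (- l) = (ex l)^-1.
Proof. by rewrite !ex_mon -monN latN. Qed.

Lemma ex0 : ex (0 : 'cV[int]_n) = 1.
Proof. by rewrite ex_mon lat_0 mon0. Qed.

Lemma ex_neq0 l : ex l != 0.
Proof. by rewrite ex_mon mon_neq0. Qed.

Lemma tt_mon : tt n = mon (delta_mx ord0 0).
Proof. by rewrite mon_delta. Qed.

Lemma tt_neq0 : tt n != 0.
Proof. by rewrite tt_mon mon_neq0. Qed.

Lemma mon_eq1 (k : 'cV[int]_n.+1) : mon k = 1 -> k = 0.
Proof.
move=> E.
pose kp : 'X_{1..n.+1} := [multinom absz (Num.max (k i 0%R) 0%R) | i < n.+1].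
pose kn : 'X_{1..n.+1} := [multinom absz (Num.max (- k i 0%R)%R 0%R) | i < n.+1].
have kE : k = mvec kp - mvec kn.
  apply/colP => i; rewrite !mxE !mnmE; lia.
move: E; rewrite kE monD monN => /divr1_eq; rewrite !mon_mvec => /eqP.
rewrite tofrac_eq => /eqP /mpolyP /(_ kp); rewrite !mcoeffX eqxx.
by case: eqP => // -> _; rewrite subrr.
Qed.

Lemma ex_neq1 l : l != 0 -> ex l != 1.
Proof.
apply: contra_neq; rewrite ex_mon => /mon_eq1 /colP E.
by apply/colP => i; have := E (lift ord0 i); rewrite lat_lift !mxE.
Qed.

(** Used for the numerator t^-1 - t e^-g, which vanishes exactly when t^2 = e^g. *)
Lemma tt2_neq_ex l : tt n ^+ 2 != ex l.
Proof.
apply/eqP => E; have : mon (delta_mx ord0 0 + delta_mx ord0 0 - lat l) = 1 :> Q.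
  by rewrite !monD monN -tt_mon -ex_mon -expr2 E divff ?ex_neq0.
move/mon_eq1/colP/(_ ord0); rewrite !mxE unlift_none eqxx /=; lia.
Qed.

Lemma is_hom_lat (f g : Q -> Q) : is_hom f -> is_hom g -> f (tt n) = g (tt n) ->
  (forall l, f (ex l) = g (ex l)) -> f =1 g.
Proof.
move=> hf hg ht hl; apply: is_hom_ext => // i.
have [j ->|->] := unliftP ord0 i; last exact: ht.
rewrite -mon_delta.
have -> : delta_mx (lift ord0 j) 0 = lat (delta_mx j 0).
  apply/colP => k; have [k' ->|->] := unliftP ord0 k; last by rewrite lat0 mxE.
  by rewrite lat_lift !mxE (inj_eq lift_inj).
by rewrite -ex_mon hl.
Qed.

Definition lat_mx (w : 'M[int]_n) : 'M[int]_n.+1 :=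
  \matrix_(i, j) match unlift ord0 i, unlift ord0 j with
                 | Some i', Some j' => w i' j' | None, None => 1 | _, _ => 0 end.

Lemma lat_mxM w v : lat_mx w *m lat_mx v = lat_mx (w *m v).
Proof.
apply/matrixP => i j; rewrite !mxE big_ord_recl !mxE unlift_none.
under eq_bigr => k _ do rewrite !mxE liftK.
case: unlift => [i'|]; case: unlift => [j'|]; rewrite ?mxE ?mulr0 ?mul0r ?add0r //.
- by rewrite big1 // => k _; rewrite mulr0.
- by rewrite big1 // => k _; rewrite mul0r.
- by rewrite big1 ?mulr1 ?addr0 // => k _; rewrite mul0r.
Qed.

Lemma lat_mx1 : lat_mx 1%:M = 1%:M.
Proof.
apply/matrixP => i j; rewrite !mxE.
have [i' ->|->] := unliftP ord0 i; have [j' ->|->] := unliftP ord0 j; rewrite ?mxE //.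
Qed.

Lemma lat_mx_lat w l : lat_mx w *m lat l = lat (w *m l).
Proof.
apply/colP => i; rewrite !mxE big_ord_recl !mxE unlift_none mulr0 add0r.
under eq_bigr => k _ do rewrite !mxE liftK.
case: unlift => [i'|]; rewrite ?mxE //.
by rewrite big1 // => k _; rewrite mul0r.
Qed.

Lemma lat_mx_delta0 w : lat_mx w *m delta_mx ord0 0 = delta_mx ord0 0 :> 'cV_n.+1.
Proof.
rewrite -colE; apply/colP => i; rewrite !mxE unlift_none.
by have [i' ->|->] := unliftP ord0 i; rewrite ?eqxx.
Qed.

Lemma act_exists w : w \in unitmx -> exists f, is_W_act w f.
Proof.
move=> wU.
have MK : lat_mx (invmx w) *m lat_mx w = 1%:M by rewrite lat_mxM mulVmx // lat_mx1.
have [fD [fM f1]] := fsubst_hom MK.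
exists (fsubst (lat_mx w)); do 3!split=> //; split.
  by rewrite tt_mon (fsubst_mon MK) lat_mx_delta0.
by move=> l; rewrite !ex_mon (fsubst_mon MK) lat_mx_lat.
Qed.

Lemma actP w : w \in unitmx -> is_W_act w (act w).
Proof. by move=> wU; apply: epsilon_spec; apply: act_exists. Qed.

Lemma act_hom w : w \in unitmx -> is_hom (@act n w).
Proof. by case/actP => ? [? [? _]]. Qed.

Lemma act_rmorph w : w \in unitmx -> exists g : {rmorphism Q -> Q}, act w = g.
Proof. by move/act_hom/is_hom_rmorph => [g <-]; exists g. Qed.

Lemma act_tt w : w \in unitmx -> act w (tt n) = tt n.
Proof. by case/actP => _ [_ [_ [-> _]]]. Qed.

Lemma act_ex w l : w \in unitmx -> act w (ex l) = ex (w *m l).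
Proof. by case/actP => _ [_ [_ [_ ->]]]. Qed.

(** The automorphisms [act w] are chosen separately for each [w]; they compose because a
    homomorphism is determined by its values on t and on the e^l. *)
Lemma act_mul w v x : w \in unitmx -> v \in unitmx ->
  act (w *m v) x = act w (act v x) :> Q.
Proof.
move=> wU vU; have wvU : w *m v \in unitmx by rewrite unitmx_mul wU.
move: x; apply: is_hom_lat.
- exact: act_hom.
- have [f fE] := act_rmorph wU; have [g gE] := act_rmorph vU.
  rewrite fE gE; split; [|split].
  + by move=> x y; rewrite !rmorphD.
  + by move=> x y; rewrite !rmorphM.
  + by rewrite !rmorph1.
- by rewrite !act_tt.
- by move=> l; rewrite !act_ex // mulmxA.
Qed.

Lemma act_id x : act 1%:M x = x :> Q.
Proof.
move: x; apply: is_hom_lat; first exact/act_hom/unitmx1.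
- by split.
- by rewrite act_tt ?unitmx1.
- by move=> l; rewrite act_ex ?unitmx1 // mul1mx.
Qed.

(* Extended coefficientwise to the twisted group algebra, this automorphism restricts to the
   bar involution of the Hecke algebra. *)
Definition bar : Q -> Q := fsubst (- 1%:M).

Lemma bar_inv : (- 1%:M) *m (- 1%:M) = 1%:M :> 'M[int]_n.+1.
Proof. by rewrite mulNmx mulmxN opprK mul1mx. Qed.

Lemma bar_hom : is_hom bar.
Proof. exact: fsubst_hom bar_inv. Qed.

Lemma bar_rmorph : exists g : {rmorphism Q -> Q}, bar = g.
Proof. by have [g <-] := is_hom_rmorph bar_hom; exists g. Qed.

Lemma bar_tt : bar (tt n) = (tt n)^-1.
Proof. by rewrite tt_mon /bar (fsubst_mon bar_inv) mulNmx mul1mx monN. Qed.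

Lemma bar_ex l : bar (ex l) = ex (- l).
Proof. by rewrite !ex_mon /bar (fsubst_mon bar_inv) mulNmx mul1mx latN. Qed.

Lemma bar_act w x : w \in unitmx -> bar (act w x) = act w (bar x).
Proof.
move=> wU; have [f fE] := act_rmorph wU; have [g gE] := bar_rmorph.
move: x; apply: is_hom_lat.
- rewrite fE gE; split; [|split].
  + by move=> x y; rewrite !rmorphD.
  + by move=> x y; rewrite !rmorphM.
  + by rewrite !rmorph1.
- rewrite fE gE; split; [|split].
  + by move=> x y; rewrite !rmorphD.
  + by move=> x y; rewrite !rmorphM.
  + by rewrite !rmorph1.
- by rewrite act_tt // bar_tt fE fmorphV -fE act_tt.
- by move=> l; rewrite act_ex // !bar_ex act_ex // mulmxN.
Qed.

End Action.
(** * Braid relations in rank two *)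

(* The points of D are the chambers of a rank two arrangement, S and T cross the two walls of a
   chamber x, whose roots have values aS x and aT x; crossing the other way replaces a value a
   by t + t^-1 - a.  [rop S aS] is right multiplication by tau_s on coefficient functions.
   With X = e^-alpha and Y = e^-beta the braid relation at one chamber is an identity of
   rational functions in t, X, Y. *)
Section BraidPoint.
Variables (F : fieldType) (t : F) (D : Type) (S T : D -> D) (aS aT : D -> F).
Hypotheses (t0 : t != 0) (SK : forall x, S (S x) = x) (TK : forall x, T (T x) = x).

Definition rop (U : D -> D) (a Z : D -> F) : D -> F :=
  fun x => Z x * (a x - t) + Z (U x) * a x.

(** The a_i belong to the positive roots in convex order, here alpha, alpha + beta, beta. A word of
    length m reads values only at chambers at distance at most m - 1 from x, so the hypotheses list
    the values at 2m - 1 chambers. *)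
Lemma braid_point3 (X Y a0 a1 a2 : F) (x : D) :
  1 - X != 0 ->
  1 - X * Y != 0 ->
  1 - Y != 0 ->
  a0 = (t^-1 - t * (X)) / (1 - X) ->
  a1 = (t^-1 - t * (X * Y)) / (1 - X * Y) ->
  a2 = (t^-1 - t * (Y)) / (1 - Y) ->
  S (T (S x)) = T (S (T x)) ->
  aS (S (T x)) = (t + t^-1 - a1) ->
  aT (S (T x)) = a0 ->
  aS (T x) = a1 ->
  aT (T x) = (t + t^-1 - a2) ->
  aS x = a0 ->
  aT x = a2 ->
  aS (S x) = (t + t^-1 - a0) ->
  aT (S x) = a1 ->
  aS (T (S x)) = a2 ->
  aT (T (S x)) = (t + t^-1 - a1) ->
  forall Z, (rop S aS (rop T aT (rop S aS Z))) x = (rop T aT (rop S aS (rop T aT Z))) x.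
Proof.
move=> n0 n1 n2 e0 e1 e2 E h0 h1 h2 h3 h4 h5 h6 h7 h8 h9 Z.
rewrite /rop !(SK, TK) E !(h0, h1, h2, h3, h4, h5, h6, h7, h8, h9) e0 e1 e2.
field; rewrite t0 n0 n1 n2 //.
Qed.

Lemma braid_point4 (X Y a0 a1 a2 a3 : F) (x : D) :
  1 - X != 0 ->
  1 - X ^+ 2 * Y != 0 ->
  1 - X * Y != 0 ->
  1 - Y != 0 ->
  a0 = (t^-1 - t * (X)) / (1 - X) ->
  a1 = (t^-1 - t * (X ^+ 2 * Y)) / (1 - X ^+ 2 * Y) ->
  a2 = (t^-1 - t * (X * Y)) / (1 - X * Y) ->
  a3 = (t^-1 - t * (Y)) / (1 - Y) ->
  T (S (T (S x))) = S (T (S (T x))) ->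
  aS (T (S (T x))) = a0 ->
  aT (T (S (T x))) = (t + t^-1 - a1) ->
  aS (S (T x)) = (t + t^-1 - a2) ->
  aT (S (T x)) = a1 ->
  aS (T x) = a2 ->
  aT (T x) = (t + t^-1 - a3) ->
  aS x = a0 ->
  aT x = a3 ->
  aS (S x) = (t + t^-1 - a0) ->
  aT (S x) = a1 ->
  aS (T (S x)) = a2 ->
  aT (T (S x)) = (t + t^-1 - a1) ->
  aS (S (T (S x))) = (t + t^-1 - a2) ->
  aT (S (T (S x))) = a3 ->
  forall Z, (rop S aS (rop T aT (rop S aS (rop T aT Z)))) x = (rop T aT (rop S aS (rop T aT (rop
    S aS Z)))) x.
Proof.
move=> n0 n1 n2 n3 e0 e1 e2 e3 E h0 h1 h2 h3 h4 h5 h6 h7 h8 h9 h10 h11 h12 h13 Z.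
rewrite /rop !(SK, TK) E !(h0, h1, h2, h3, h4, h5, h6, h7, h8, h9, h10, h11, h12, h13) e0 e1 e2 e3.
field; rewrite t0 n0 n1 n2 n3 //.
Qed.

Lemma braid_point6 (X Y a0 a1 a2 a3 a4 a5 : F) (x : D) :
  1 - X != 0 ->
  1 - X ^+ 3 * Y != 0 ->
  1 - X ^+ 2 * Y != 0 ->
  1 - X ^+ 3 * Y ^+ 2 != 0 ->
  1 - X * Y != 0 ->
  1 - Y != 0 ->
  a0 = (t^-1 - t * (X)) / (1 - X) ->
  a1 = (t^-1 - t * (X ^+ 3 * Y)) / (1 - X ^+ 3 * Y) ->
  a2 = (t^-1 - t * (X ^+ 2 * Y)) / (1 - X ^+ 2 * Y) ->
  a3 = (t^-1 - t * (X ^+ 3 * Y ^+ 2)) / (1 - X ^+ 3 * Y ^+ 2) ->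
  a4 = (t^-1 - t * (X * Y)) / (1 - X * Y) ->
  a5 = (t^-1 - t * (Y)) / (1 - Y) ->
  T (S (T (S (T (S x))))) = S (T (S (T (S (T x))))) ->
  aS (T (S (T (S (T x))))) = a0 ->
  aT (T (S (T (S (T x))))) = (t + t^-1 - a1) ->
  aS (S (T (S (T x)))) = (t + t^-1 - a2) ->
  aT (S (T (S (T x)))) = a1 ->
  aS (T (S (T x))) = a2 ->
  aT (T (S (T x))) = (t + t^-1 - a3) ->
  aS (S (T x)) = (t + t^-1 - a4) ->
  aT (S (T x)) = a3 ->
  aS (T x) = a4 ->
  aT (T x) = (t + t^-1 - a5) ->
  aS x = a0 ->
  aT x = a5 ->
  aS (S x) = (t + t^-1 - a0) ->
  aT (S x) = a1 ->
  aS (T (S x)) = a2 ->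
  aT (T (S x)) = (t + t^-1 - a1) ->
  aS (S (T (S x))) = (t + t^-1 - a2) ->
  aT (S (T (S x))) = a3 ->
  aS (T (S (T (S x)))) = a4 ->
  aT (T (S (T (S x)))) = (t + t^-1 - a3) ->
  aS (S (T (S (T (S x))))) = (t + t^-1 - a4) ->
  aT (S (T (S (T (S x))))) = a5 ->
  forall Z, (rop S aS (rop T aT (rop S aS (rop T aT (rop S aS (rop T aT Z)))))) x = (rop T aT
    (rop S aS (rop T aT (rop S aS (rop T aT (rop S aS Z)))))) x.
Proof.
move=> n0 n1 n2 n3 n4 n5 e0 e1 e2 e3 e4 e5 E h0 h1 h2 h3 h4 h5 h6 h7 h8 h9 h10 h11 h12 h13 h14
  h15 h16 h17 h18 h19 h20 h21 Z.
rewrite /rop !(SK, TK) E !(h0, h1, h2, h3, h4, h5, h6, h7, h8, h9, h10, h11, h12, h13, h14, h15,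
  h16, h17, h18, h19, h20, h21) e0 e1 e2 e3 e4 e5.
field; rewrite t0 n0 n1 n2 n3 n4 n5 //.
Qed.

(** For orthogonal roots, crossing one wall leaves the value at the other wall unchanged, so no
    formula for the values enters. *)
Lemma braid_point2 (x : D) : S (T x) = T (S x) -> aS (T x) = aS x -> aT (S x) = aT x ->
  forall Z, rop S aS (rop T aT Z) x = rop T aT (rop S aS Z) x.
Proof. by move=> E h1 h2 Z; rewrite /rop E h1 h2; ring. Qed.

End BraidPoint.

Lemma av_opp_gen (F : fieldType) (t e : F) : t != 0 -> e != 0 -> 1 - e != 0 ->
  (t^-1 - t * e) / (1 - e) = t + t^-1 - (t^-1 - t * e^-1) / (1 - e^-1).
Proof.
move=> t0 e0 e1; field.
by rewrite e0 t0 e1 -oppr_eq0 opprB e1.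
Qed.

(** With operators for [U] and [V], the composite [alt] evaluated at x reads its argument along the
    walk [altp] from x: the outermost operator gives the first step. *)
Fixpoint alt (D : Type) (U V : D -> D) k z := if k is k'.+1 then U (alt V U k' z) else z.
Fixpoint altp (D : Type) (S T : D -> D) k x := if k is k'.+1 then altp T S k' (S x) else x.

(* [A x i j] is the value at the root x(i alpha + j beta), where p = - <beta, alpha^v> and
   r = - <alpha, beta^v>; [ng x i j] says that this root is negative. *)
Section Rank2Abstract.
Variables (F : fieldType) (t : F) (D : Type) (S T : D -> D) (ok : D -> Prop) (p r : int).
Hypotheses (t0 : t != 0) (SK : forall x, S (S x) = x) (TK : forall x, T (T x) = x).
Hypotheses (okS : forall x, ok x -> ok (S x)) (okT : forall x, ok x -> ok (T x)).
Variables (A : D -> int -> int -> F) (X Y : D -> F).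
Hypothesis AS : forall x i j, A (S x) i j = A x (p * j - i) j.
Hypothesis AT : forall x i j, A (T x) i j = A x i (r * i - j).
Hypothesis AN : forall x i j, ok x -> (i != 0) || (j != 0) -> A x i j = t + t^-1 - A x (- i) (- j).
Hypothesis AX : forall x (i j : nat), ok x -> (i != 0)%N || (j != 0)%N ->
  1 - X x ^+ i * Y x ^+ j != 0 /\
  A x i j = (t^-1 - t * (X x ^+ i * Y x ^+ j)) / (1 - X x ^+ i * Y x ^+ j).
Notation RS := (rop t S (fun x => A x 1 0)).
Notation RT := (rop t T (fun x => A x 0 1)).

Variables (len : D -> nat) (ng : D -> int -> int -> Prop).
Hypothesis ngS : forall x i j, ng (S x) i j <-> ng x (p * j - i) j.
Hypothesis ngT : forall x i j, ng (T x) i j <-> ng x i (r * i - j).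

(** The wall crossed at each stage of the alternating walk belongs to one of the m listed roots as
    seen from x. If all of them are negative there, every crossing is a descent. *)
Lemma rank2_peel2 x : p = 0 -> r = 0 -> ok x ->
  (forall y, ok y -> ng y 1 0 -> len y = (len (S y)).+1) -> (forall y, ok y -> ng y 0 1 ->
    len y = (len (T y)).+1) ->
  ng x 1 0 -> ng x 0 1 ->
  ok (altp S T 2 x) /\ len x = (len (altp S T 2 x) + 2)%N.
Proof.
move=> Ep Er xo dS dT h0 h1 /=.
have g0 : ng x 1 0.
  exact: h0.
have l0 := dS x xo g0.
have o1 : ok (S x) by apply: okS.
have g1 : ng (S x) 0 1.
  apply/ngS; rewrite ?Ep ?Er; exact: h1.
have l1 := dT (S x) o1 g1.
have o2 : ok (T (S x)) by apply: okT.
by split; [|rewrite l0 l1 !addnS addn0].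
Qed.

Lemma rank2_braid3 : p = 1 -> r = 1 -> (forall x, altp S T 3 x = altp T S 3 x) ->
  forall x Z, ok x -> alt RS RT 3 Z x = alt RT RS 3 Z x.
Proof.
move=> Ep Er E x Z xo /=.
have [n0 e0] := @AX x 1 0 xo isT.
have [n1 e1] := @AX x 1 1 xo isT.
have [n2 e2] := @AX x 0 1 xo isT.
apply: (@braid_point3 F t D S T (fun x => A x 1 0) (fun x =>
  A x 0 1) t0 SK TK (X x) (Y x) (A x 1 0) (A x 1 1) (A x 0 1) x).
- by move: n0; rewrite ?expr0 ?expr1 ?mulr1 ?mul1r.
- by move: n1; rewrite ?expr0 ?expr1 ?mulr1 ?mul1r.
- by move: n2; rewrite ?expr0 ?expr1 ?mulr1 ?mul1r.
- by move: e0; rewrite ?expr0 ?expr1 ?mulr1 ?mul1r.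
- by move: e1; rewrite ?expr0 ?expr1 ?mulr1 ?mul1r.
- by move: e2; rewrite ?expr0 ?expr1 ?mulr1 ?mul1r.
- exact: (E x).
all: try by rewrite ?(AS, AT) ?Ep ?Er.
all: by rewrite ?(AS, AT) ?Ep ?Er AN.
Qed.

Lemma rank2_peel3 x : p = 1 -> r = 1 -> ok x ->
  (forall y, ok y -> ng y 1 0 -> len y = (len (S y)).+1) -> (forall y, ok y -> ng y 0 1 ->
    len y = (len (T y)).+1) ->
  ng x 1 0 -> ng x 1 1 -> ng x 0 1 ->
  ok (altp S T 3 x) /\ len x = (len (altp S T 3 x) + 3)%N.
Proof.
move=> Ep Er xo dS dT h0 h1 h2 /=.
have g0 : ng x 1 0.
  exact: h0.
have l0 := dS x xo g0.
have o1 : ok (S x) by apply: okS.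
have g1 : ng (S x) 0 1.
  apply/ngS; rewrite ?Ep ?Er; exact: h1.
have l1 := dT (S x) o1 g1.
have o2 : ok (T (S x)) by apply: okT.
have g2 : ng (T (S x)) 1 0.
  apply/ngT; apply/ngS; rewrite ?Ep ?Er; exact: h2.
have l2 := dS (T (S x)) o2 g2.
have o3 : ok (S (T (S x))) by apply: okS.
by split; [|rewrite l0 l1 l2 !addnS addn0].
Qed.

Lemma rank2_braid4 : p = 2 -> r = 1 -> (forall x, altp S T 4 x = altp T S 4 x) ->
  forall x Z, ok x -> alt RS RT 4 Z x = alt RT RS 4 Z x.
Proof.
move=> Ep Er E x Z xo /=.
have [n0 e0] := @AX x 1 0 xo isT.
have [n1 e1] := @AX x 2 1 xo isT.
have [n2 e2] := @AX x 1 1 xo isT.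
have [n3 e3] := @AX x 0 1 xo isT.
apply: (@braid_point4 F t D S T (fun x => A x 1 0) (fun x =>
  A x 0 1) t0 SK TK (X x) (Y x) (A x 1 0) (A x 2 1) (A x 1 1) (A x 0 1) x).
- by move: n0; rewrite ?expr0 ?expr1 ?mulr1 ?mul1r.
- by move: n1; rewrite ?expr0 ?expr1 ?mulr1 ?mul1r.
- by move: n2; rewrite ?expr0 ?expr1 ?mulr1 ?mul1r.
- by move: n3; rewrite ?expr0 ?expr1 ?mulr1 ?mul1r.
- by move: e0; rewrite ?expr0 ?expr1 ?mulr1 ?mul1r.
- by move: e1; rewrite ?expr0 ?expr1 ?mulr1 ?mul1r.
- by move: e2; rewrite ?expr0 ?expr1 ?mulr1 ?mul1r.
- by move: e3; rewrite ?expr0 ?expr1 ?mulr1 ?mul1r.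
- exact: (E x).
all: try by rewrite ?(AS, AT) ?Ep ?Er.
all: by rewrite ?(AS, AT) ?Ep ?Er AN.
Qed.

Lemma rank2_peel4 x : p = 2 -> r = 1 -> ok x ->
  (forall y, ok y -> ng y 1 0 -> len y = (len (S y)).+1) -> (forall y, ok y -> ng y 0 1 ->
    len y = (len (T y)).+1) ->
  ng x 1 0 -> ng x 2 1 -> ng x 1 1 -> ng x 0 1 ->
  ok (altp S T 4 x) /\ len x = (len (altp S T 4 x) + 4)%N.
Proof.
move=> Ep Er xo dS dT h0 h1 h2 h3 /=.
have g0 : ng x 1 0.
  exact: h0.
have l0 := dS x xo g0.
have o1 : ok (S x) by apply: okS.
have g1 : ng (S x) 0 1.
  apply/ngS; rewrite ?Ep ?Er; exact: h1.
have l1 := dT (S x) o1 g1.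
have o2 : ok (T (S x)) by apply: okT.
have g2 : ng (T (S x)) 1 0.
  apply/ngT; apply/ngS; rewrite ?Ep ?Er; exact: h2.
have l2 := dS (T (S x)) o2 g2.
have o3 : ok (S (T (S x))) by apply: okS.
have g3 : ng (S (T (S x))) 0 1.
  apply/ngS; apply/ngT; apply/ngS; rewrite ?Ep ?Er; exact: h3.
have l3 := dT (S (T (S x))) o3 g3.
have o4 : ok (T (S (T (S x)))) by apply: okT.
by split; [|rewrite l0 l1 l2 l3 !addnS addn0].
Qed.

Lemma rank2_braid6 : p = 3 -> r = 1 -> (forall x, altp S T 6 x = altp T S 6 x) ->
  forall x Z, ok x -> alt RS RT 6 Z x = alt RT RS 6 Z x.
Proof.
move=> Ep Er E x Z xo /=.
have [n0 e0] := @AX x 1 0 xo isT.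
have [n1 e1] := @AX x 3 1 xo isT.
have [n2 e2] := @AX x 2 1 xo isT.
have [n3 e3] := @AX x 3 2 xo isT.
have [n4 e4] := @AX x 1 1 xo isT.
have [n5 e5] := @AX x 0 1 xo isT.
apply: (@braid_point6 F t D S T (fun x => A x 1 0) (fun x =>
  A x 0 1) t0 SK TK (X x) (Y x) (A x 1 0) (A x 3 1) (A x 2 1) (A x 3 2) (A x 1 1) (A x 0 1) x).
- by move: n0; rewrite ?expr0 ?expr1 ?mulr1 ?mul1r.
- by move: n1; rewrite ?expr0 ?expr1 ?mulr1 ?mul1r.
- by move: n2; rewrite ?expr0 ?expr1 ?mulr1 ?mul1r.
- by move: n3; rewrite ?expr0 ?expr1 ?mulr1 ?mul1r.
- by move: n4; rewrite ?expr0 ?expr1 ?mulr1 ?mul1r.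
- by move: n5; rewrite ?expr0 ?expr1 ?mulr1 ?mul1r.
- by move: e0; rewrite ?expr0 ?expr1 ?mulr1 ?mul1r.
- by move: e1; rewrite ?expr0 ?expr1 ?mulr1 ?mul1r.
- by move: e2; rewrite ?expr0 ?expr1 ?mulr1 ?mul1r.
- by move: e3; rewrite ?expr0 ?expr1 ?mulr1 ?mul1r.
- by move: e4; rewrite ?expr0 ?expr1 ?mulr1 ?mul1r.
- by move: e5; rewrite ?expr0 ?expr1 ?mulr1 ?mul1r.
- exact: (E x).
all: try by rewrite ?(AS, AT) ?Ep ?Er.
all: by rewrite ?(AS, AT) ?Ep ?Er AN.
Qed.

Lemma rank2_peel6 x : p = 3 -> r = 1 -> ok x ->
  (forall y, ok y -> ng y 1 0 -> len y = (len (S y)).+1) -> (forall y, ok y -> ng y 0 1 ->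
    len y = (len (T y)).+1) ->
  ng x 1 0 -> ng x 3 1 -> ng x 2 1 -> ng x 3 2 -> ng x 1 1 -> ng x 0 1 ->
  ok (altp S T 6 x) /\ len x = (len (altp S T 6 x) + 6)%N.
Proof.
move=> Ep Er xo dS dT h0 h1 h2 h3 h4 h5 /=.
have g0 : ng x 1 0.
  exact: h0.
have l0 := dS x xo g0.
have o1 : ok (S x) by apply: okS.
have g1 : ng (S x) 0 1.
  apply/ngS; rewrite ?Ep ?Er; exact: h1.
have l1 := dT (S x) o1 g1.
have o2 : ok (T (S x)) by apply: okT.
have g2 : ng (T (S x)) 1 0.
  apply/ngT; apply/ngS; rewrite ?Ep ?Er; exact: h2.
have l2 := dS (T (S x)) o2 g2.
have o3 : ok (S (T (S x))) by apply: okS.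
have g3 : ng (S (T (S x))) 0 1.
  apply/ngS; apply/ngT; apply/ngS; rewrite ?Ep ?Er; exact: h3.
have l3 := dT (S (T (S x))) o3 g3.
have o4 : ok (T (S (T (S x)))) by apply: okT.
have g4 : ng (T (S (T (S x)))) 1 0.
  apply/ngT; apply/ngS; apply/ngT; apply/ngS; rewrite ?Ep ?Er; exact: h4.
have l4 := dS (T (S (T (S x)))) o4 g4.
have o5 : ok (S (T (S (T (S x))))) by apply: okS.
have g5 : ng (S (T (S (T (S x))))) 0 1.
  apply/ngS; apply/ngT; apply/ngS; apply/ngT; apply/ngS; rewrite ?Ep ?Er; exact: h5.
have l5 := dT (S (T (S (T (S x))))) o5 g5.
have o6 : ok (T (S (T (S (T (S x)))))) by apply: okT.
by split; [|rewrite l0 l1 l2 l3 l4 l5 !addnS addn0].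
Qed.

End Rank2Abstract.

Section AltComm.
Variables (n : nat) (s r : 'M[int]_n).
Notation S := (fun x : 'M[int]_n => x *m s).
Notation T := (fun x : 'M[int]_n => x *m r).

Lemma alt_comm2 : s *m s = 1%:M -> s *m r *m s = r -> forall x, altp S T 2 x = altp T S 2 x.
Proof. by move=> ss {2}<- x /=; rewrite -!mulmxA ss mulmx1. Qed.

Lemma alt_comm3 : s *m r *m s = r *m s *m r -> forall x, altp S T 3 x = altp T S 3 x.
Proof. by move=> e x /=; rewrite -!(mulmxA x) e. Qed.

Lemma alt_comm4 : r *m r = 1%:M -> r *m (s *m r *m s) *m r = s *m r *m s ->
  forall x, altp S T 4 x = altp T S 4 x.
Proof.
move=> rr e x /=; rewrite -!(mulmxA x) -e; congr (x *m _).
by rewrite -!mulmxA rr mulmx1.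
Qed.

Lemma alt_comm6 : r *m r = 1%:M ->
  r *m (s *m (r *m s *m r) *m s) *m r = s *m (r *m s *m r) *m s ->
  forall x, altp S T 6 x = altp T S 6 x.
Proof.
move=> rr e x /=; rewrite -!(mulmxA x); congr (x *m _).
transitivity (s *m (r *m s *m r) *m s *m r); first by rewrite !mulmxA.
by rewrite -e -!mulmxA rr mulmx1.
Qed.
End AltComm.

(** * Kazhdan-Lusztig bases in a twisted group algebra *)

Section EvalPoly.
Variable F : fieldType.
Implicit Types (p q : {poly int}) (x : F).

Definition evp p x : F := (map_poly (fun z : int => z%:~R) p).[x].

Lemma evpE p x : evp p x = (map_poly intr p).[x]. Proof. by []. Qed.
Lemma evpD p q x : evp (p + q) x = evp p x + evp q x.
Proof. by rewrite !evpE rmorphD hornerD. Qed.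
Lemma evpN p x : evp (- p) x = - evp p x.
Proof. by rewrite !evpE rmorphN hornerN. Qed.
Lemma evpM p q x : evp (p * q) x = evp p x * evp q x.
Proof. by rewrite !evpE rmorphM hornerM. Qed.
Lemma evpXn k x : evp 'X^k x = x ^+ k.
Proof. by rewrite evpE map_polyXn hornerXn. Qed.
Lemma evpC (z : int) x : evp z%:P x = z%:~R.
Proof. by rewrite evpE map_polyC hornerC. Qed.
Lemma evp0 x : evp 0 x = 0.
Proof. by rewrite evpE rmorph0 horner0. Qed.
Lemma evp1 x : evp 1 x = 1.
Proof. by rewrite evpE rmorph1 hornerC. Qed.
Lemma evp_sum (I : Type) (r : seq I) (P : pred I) (f : I -> {poly int}) x :
  evp (\sum_(i <- r | P i) f i) x = \sum_(i <- r | P i) evp (f i) x.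
Proof. exact: (big_morph (evp^~ x) (fun p q => evpD p q x) (evp0 x)). Qed.

Lemma evp_rmorph (f : {rmorphism F -> F}) p x : f (evp p x) = evp p (f x).
Proof.
rewrite !evpE -horner_map -map_poly_comp; congr (_.[_]).
by apply: eq_map_poly => z /=; rewrite rmorph_int.
Qed.

Lemma evp_coef p x : evp p x = \sum_(i < size p) (p`_i)%:~R * x ^+ i.
Proof.
rewrite {1}(_ : p = \sum_(i < size p) (p`_i)%:P * 'X^i); last first.
  by rewrite -[LHS]coefK poly_def; apply: eq_bigr => i _; rewrite mul_polyC.
by rewrite evp_sum; apply: eq_bigr => i _; rewrite evpM evpC evpXn.
Qed.

(** With m = l(v) - l(x), the degree bound on a Kazhdan-Lusztig polynomial becomes the absence of a
    constant term. The coefficients of [q] are those of [p], moved from degree i to m - 2i, whence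
    [q = 0 -> p = 0]. *)
Lemma evp_shift p x m : x != 0 -> (forall i, (m <= i.*2)%N -> p`_i = 0) ->
  exists q : {poly int}, [/\ q`_0 = 0, q = 0 -> p = 0 & x ^+ m * evp p (x ^- 2) = evp q x].
Proof.
move=> x0 H; exists (\sum_(i < size p) (p`_i)%:P * 'X^(m - i.*2)); split.
- rewrite coef_sum big1 // => i _; rewrite coefCM coefXn.
  case: (leqP m i.*2) => [/H->|lt]; first by rewrite mul0r.
  by rewrite eq_sym subn_eq0 leqNgt lt /= mulr0.
- move=> /polyP E; apply/polyP => i; rewrite coef0.
  case: (ltnP i (size p)) => [ip|/(nth_default 0) //].
  case: (leqP m i.*2) => [/H //|lt].
  move: (E (m - i.*2)%N); rewrite coef0 coef_sum (bigD1 (Ordinal ip)) //=.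
  rewrite coefCM coefXn eqxx mulr1 big1 ?addr0 // => j; rewrite -val_eqE /= => ji.
  rewrite coefCM coefXn; case: (leqP m j.*2) => [/H->|lt']; first by rewrite mul0r.
  by case: eqP => [e|_]; rewrite ?mulr0 //; case/eqP: ji; lia.
rewrite evp_coef mulr_sumr evp_sum; apply: eq_bigr => i _.
rewrite evpM evpC evpXn mulrCA; case: (leqP m i.*2) => [/H->|lt]; first by rewrite !mul0r.
congr (_ * _); rewrite -exprVn -exprM mul2n exprVn.
by rewrite -[in LHS](subnK (ltnW lt)) exprD mulfK // expf_neq0.
Qed.

Lemma evp_neg p x : exists2 q : {poly int}, q`_0 = p`_0 & evp p (- x) = evp q x.
Proof.
exists (\sum_(i < size p) (p`_i * (-1) ^+ i)%:P * 'X^i).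
  rewrite coef_sum; case: (posnP (size p)) => [sz|sz].
    by rewrite nth_default ?sz // big_ord0.
  rewrite (bigD1 (Ordinal sz)) //= coefCM coefXn /= !mulr1 big1 ?addr0 // => i.
  by rewrite -val_eqE /= coefCM coefXn eq_sym => /negPf ->; rewrite mulr0.
rewrite evp_coef evp_sum; apply: eq_bigr => i _.
by rewrite evpM evpC evpXn (exprNn x) intrM mulrA rmorph_sign.
Qed.

Variable t : F.
Hypothesis t0 : t != 0.
Hypothesis evp_inj : forall p, evp p t = 0 -> p = 0.

(** If p has degree d, then t^d p(t^-1) is a polynomial in t of degree at most d, while t^d p(t) has
    degree 2d; as t is transcendental, d = 0. *)
Lemma evp_sym p : evp p t = evp p t^-1 -> p = (p`_0)%:P.
Proof.
move=> E; have [/size1_polyC //|sz] := leqP (size p) 1%N.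
pose d := (size p).-1; have d1 : (0 < d)%N by rewrite /d; lia.
have szp : size p = d.+1 by rewrite /d; lia.
pose q : {poly int} := \poly_(i < d.+1) p`_(d - i).
have Eq : p * 'X^d = q.
  apply/eqP; rewrite -subr_eq0; apply/eqP/evp_inj.
  rewrite evpD evpN evpM evpXn E evp_coef szp mulr_suml; apply/eqP; rewrite subr_eq0; apply/eqP.
  rewrite /q poly_def evp_sum (reindex_inj rev_ord_inj) /=; apply: eq_bigr => i _.
  rewrite -mul_polyC evpM evpC evpXn subSS -mulrA; congr (_ * _).
  case: i => j /=; rewrite ltnS => le.
  rewrite exprVn -[in X in _ * X](subnK le) exprD mulKf ?expf_neq0 //.
have : (size (p * 'X^d)%R <= d.+1)%N by rewrite Eq size_poly.
have p0 : p != 0 by rewrite -size_poly_gt0 szp.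
rewrite size_mulXn // szp; lia.
Qed.

End EvalPoly.

(** * The twisted group algebra of an abstract group *)

Section TwistedGroupAlgebra.
Variables (G : eqType) (mul : G -> G -> G) (one : G) (inv : G -> G).
Variables (W : seq G) (inW : G -> Prop).
Hypothesis Wuniq : uniq W.
Hypothesis Wmem : forall w, w \in W <-> inW w.
Hypothesis mulA : associative mul.
Hypothesis mul1g : left_id one mul.
Hypothesis mulg1 : right_id one mul.
Hypothesis inW1 : inW one.
Hypothesis inWM : forall u v, inW u -> inW v -> inW (mul u v).
Hypothesis inWV : forall u, inW u -> inW (inv u).
Hypothesis mulVg : forall u, inW u -> mul (inv u) u = one.
Hypothesis mulgV : forall u, inW u -> mul u (inv u) = one.

Variables (Q : fieldType) (act : G -> Q -> Q).
Hypothesis act_hom : forall w, inW w -> is_hom (act w).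
Hypothesis act_mul : forall w v x, inW w -> inW v -> act (mul w v) x = act w (act v x).
Hypothesis act_one : forall x, act one x = x.

Lemma hom0 (f : Q -> Q) : is_hom f -> f 0 = 0.
Proof. by case/is_hom_rmorph => g <-; rewrite rmorph0. Qed.
Lemma homD (f : Q -> Q) : is_hom f -> forall x y, f (x + y) = f x + f y.
Proof. by case. Qed.
Lemma homM (f : Q -> Q) : is_hom f -> forall x y, f (x * y) = f x * f y.
Proof. by case=> _ []. Qed.
Lemma hom1 (f : Q -> Q) : is_hom f -> f 1 = 1.
Proof. by case=> _ []. Qed.
Lemma homB (f : Q -> Q) : is_hom f -> forall x y, f (x - y) = f x - f y.
Proof. by case/is_hom_rmorph => g <- x y; rewrite rmorphB. Qed.
Lemma homV (f : Q -> Q) : is_hom f -> forall x, f x^-1 = (f x)^-1.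
Proof. by case/is_hom_rmorph => g <- x; rewrite fmorphV. Qed.
Lemma homX (f : Q -> Q) : is_hom f -> forall x k, f (x ^+ k) = f x ^+ k.
Proof. by case/is_hom_rmorph => g <- x k; rewrite rmorphXn. Qed.
Lemma homn (f : Q -> Q) : is_hom f -> forall k : nat, f k%:R = k%:R.
Proof. by case/is_hom_rmorph => g <- k; rewrite rmorph_nat. Qed.
Lemma homz (f : Q -> Q) : is_hom f -> forall k : int, f k%:~R = k%:~R.
Proof. by case/is_hom_rmorph => g <- k; rewrite rmorph_int. Qed.
Lemma homeq0 (f : Q -> Q) : is_hom f -> forall x, (f x == 0) = (x == 0).
Proof. by case/is_hom_rmorph => g <- x; rewrite fmorph_eq0. Qed.
Lemma hom_sum (f : Q -> Q) (I : Type) (r : seq I) (P : pred I) (F : I -> Q) : is_hom f ->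
  f (\sum_(i <- r | P i) F i) = \sum_(i <- r | P i) f (F i).
Proof. by case/is_hom_rmorph => g <-; rewrite rmorph_sum. Qed.
Lemma hom_evp (f : Q -> Q) p x : is_hom f -> f (evp p x) = evp p (f x).
Proof. by case/is_hom_rmorph => g <-; exact: evp_rmorph. Qed.

Lemma tmulKg u v : inW u -> mul (inv u) (mul u v) = v.
Proof. by move=> uW; rewrite mulA mulVg // mul1g. Qed.
Lemma tmulKVg u v : inW u -> mul u (mul (inv u) v) = v.
Proof. by move=> uW; rewrite mulA mulgV // mul1g. Qed.
Lemma tmulgK u v : inW u -> mul (mul v u) (inv u) = v.
Proof. by move=> uW; rewrite -mulA mulgV // mulg1. Qed.
Lemma tmulgKV u v : inW u -> mul (mul v (inv u)) u = v.
Proof. by move=> uW; rewrite -mulA mulVg // mulg1. Qed.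

Lemma inv_mul u v : inW u -> inW v -> inv (mul u v) = mul (inv v) (inv u).
Proof.
move=> uW vW; have uvW := inWM uW vW.
by rewrite -[RHS](tmulKg _ uvW) -mulA tmulKVg // mulgV // mulg1.
Qed.

Lemma sumW_pick (V : nmodType) g (F : G -> V) : inW g -> \sum_(w <- W | w == g) F w = F g.
Proof.
move=> gW; rewrite -big_filter (@eq_filter _ _ (pred1 g)) // filter_pred1_uniq ?big_seq1 //.
exact/Wmem.
Qed.

Lemma sumW_eq (F F' : G -> Q) : (forall w, inW w -> F w = F' w) ->
  \sum_(w <- W) F w = \sum_(w <- W) F' w.
Proof. by move=> E; rewrite !big_seq; apply: eq_bigr => w /Wmem /E. Qed.

Lemma sumW_one (V : nmodType) g (F : G -> V) : inW g -> (forall w, inW w -> w != g -> F w = 0) ->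
  \sum_(w <- W) F w = F g.
Proof.
move=> gW H; rewrite (bigID (pred1 g)) /= sumW_pick // [X in _ + X]big_seq_cond big1 ?addr0 //.
by move=> w /andP[/Wmem wW]; exact: H.
Qed.

Lemma perm_mull g : inW g -> perm_eq [seq mul g w | w <- W] W.
Proof.
move=> gW; apply: uniq_perm => //.
  by rewrite map_inj_uniq // => x y E; rewrite -(tmulKg x gW) E tmulKg.
move=> w; apply/mapP/idP => [[v /Wmem vW ->]|/Wmem wW]; first exact/Wmem/inWM.
by exists (mul (inv g) w); [apply/Wmem/inWM => //; exact: inWV|rewrite tmulKVg].
Qed.

Lemma sumW_mull g (F : G -> Q) : inW g -> \sum_(w <- W) F w = \sum_(w <- W) F (mul g w).
Proof. by move=> gW; rewrite -(perm_big _ (perm_mull gW)) big_map. Qed.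

(** Coefficient functions live on all of G, but the algebra sees only their values on W. *)
Definition eqW (f g : G -> Q) := forall u, inW u -> f u = g u.
Notation "f =W g" := (eqW f g) (at level 70).

Definition dl w : G -> Q := fun u => (u == w)%:R.
Definition qmul (x y : G -> Q) : G -> Q :=
  fun u => \sum_(w <- W) \sum_(v <- W | mul w v == u) x w * act w (y v).

Lemma qmulE x y u : inW u -> qmul x y u = \sum_(w <- W) x w * act w (y (mul (inv w) u)).
Proof.
move=> uW; apply: sumW_eq => w wW; have wiW := inWV wW.
rewrite -(sumW_pick (g := mul (inv w) u) (fun v => x w * act w (y v))); last exact: inWM.
rewrite big_seq_cond [RHS]big_seq_cond; apply: eq_bigl => v; congr (_ && _).
by apply/eqP/eqP => [<-|->]; rewrite ?tmulKg ?tmulKVg.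
Qed.

Lemma qmulE' x y u : inW u ->
  qmul x y u = \sum_(v <- W) x (mul u (inv v)) * act (mul u (inv v)) (y v).
Proof.
move=> uW; rewrite /qmul (exchange_big_dep xpredT) //=; apply: sumW_eq => v vW; have viW := inWV vW.
rewrite -(sumW_pick (g := mul u (inv v)) (fun w => x w * act w (y v))); last exact: inWM.
rewrite big_seq_cond [RHS]big_seq_cond; apply: eq_bigl => w; congr (_ && _).
by apply/eqP/eqP => [<-|->]; rewrite ?tmulgK ?tmulgKV.
Qed.

Lemma qmul_ext x x' y y' : x =W x' -> y =W y' -> qmul x y =W qmul x' y'.
Proof.
move=> ex ey u uW; rewrite !qmulE //; apply: sumW_eq => w wW.
by rewrite ex // ey //; apply: inWM => //; exact: inWV.
Qed.

Lemma qmulA x y z : qmul x (qmul y z) =W qmul (qmul x y) z.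
Proof.
move=> u uW; rewrite !qmulE //.
transitivity (\sum_(w <- W) \sum_(v <- W) x w * (act w (y v) * act (mul w v) (z (mul (inv (mul w
  v)) u)))).
  apply: sumW_eq => w wW; have wiW := inWV wW; have wuW := inWM wiW uW.
  rewrite qmulE // (hom_sum _ _ _ (act_hom wW)) mulr_sumr; apply: sumW_eq => v vW.
  rewrite (homM (act_hom wW)) act_mul //; congr (_ * (_ * act _ (act _ (z _)))).
  by rewrite inv_mul // mulA.
transitivity (\sum_(w <- W) \sum_(v <- W) x w * (act w (y (mul (inv w) v)) * act v (z (mul (inv
  v) u)))).
  apply: sumW_eq => w wW; rewrite [RHS](sumW_mull _ wW); apply: sumW_eq => v vW.
  by rewrite tmulKg.
rewrite exchange_big /=; apply: sumW_eq => v vW; rewrite qmulE // mulr_suml.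
by apply: eq_bigr => w _; rewrite mulrA.
Qed.

Lemma qmul1l y : qmul (dl one) y =W y.
Proof.
move=> u uW; rewrite qmulE // (sumW_one inW1) => [|w _ /negPf w1].
  by rewrite /dl eqxx mul1r act_one -[in LHS](mul1g u) tmulKg.
by rewrite /dl w1 mul0r.
Qed.

Lemma qmul_suml (I : Type) (r : seq I) (c : I -> Q) (f : I -> G -> Q) y u : inW u ->
  qmul (fun u => \sum_(i <- r) c i * f i u) y u = \sum_(i <- r) c i * qmul (f i) y u.
Proof.
move=> uW; rewrite qmulE //.
under eq_bigr => w _ do rewrite mulr_suml.
rewrite exchange_big /=; apply: eq_bigr => i _; rewrite qmulE // mulr_sumr.
by apply: eq_bigr => w _; rewrite mulrA.
Qed.

Lemma qmul_sumr (I : Type) (r : seq I) (c : I -> Q) (f : I -> G -> Q) y u :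
  (forall w i, inW w -> act w (c i) = c i) -> inW u ->
  qmul y (fun u => \sum_(i <- r) c i * f i u) u = \sum_(i <- r) c i * qmul y (f i) u.
Proof.
move=> cW uW; rewrite qmulE //.
transitivity (\sum_(w <- W) \sum_(i <- r) c i * (y w * act w (f i (mul (inv w) u)))).
  apply: sumW_eq => w wW; rewrite (hom_sum _ _ _ (act_hom wW)) mulr_sumr.
  by apply: eq_bigr => i _; rewrite (homM (act_hom wW)) cW // mulrCA.
rewrite exchange_big /=; apply: eq_bigr => i _; rewrite qmulE // mulr_sumr.
by apply: eq_bigr => w _.
Qed.

Lemma qmul_linr (c : Q) y f g u : (forall w, inW w -> act w c = c) -> inW u ->
  qmul y (fun u => f u + c * g u) u = qmul y f u + c * qmul y g u.
Proof.
move=> cW uW; rewrite !qmulE // mulr_sumr -big_split; apply: sumW_eq => w wW /=.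
by rewrite (homD (act_hom wW)) (homM (act_hom wW)) cW // mulrDr mulrCA.
Qed.

Lemma qmul_linl (c : Q) f g y u : inW u ->
  qmul (fun u => f u + c * g u) y u = qmul f y u + c * qmul g y u.
Proof.
move=> uW; rewrite !qmulE // mulr_sumr -big_split; apply: eq_bigr => w _ /=.
by rewrite mulrDl mulrA.
Qed.

Variable bar : Q -> Q.
Hypothesis bar_hom : is_hom bar.
Hypothesis bar_act : forall w x, inW w -> bar (act w x) = act w (bar x).

Definition bq (f : G -> Q) : G -> Q := fun u => bar (f u).

Lemma bq_qmul x y : bq (qmul x y) =W qmul (bq x) (bq y).
Proof.
move=> u uW; rewrite /bq !qmulE // (hom_sum _ _ _ bar_hom); apply: sumW_eq => w wW.
by rewrite (homM bar_hom) bar_act.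
Qed.

(** * Demazure-Lusztig elements and their quadratic relation *)

Variables (I : eqType) (Pi : seq I) (s : I -> G) (len : G -> nat) (av : G -> I -> Q) (t : Q).
Hypothesis t0 : t != 0.
Hypothesis act_t : forall w, inW w -> act w t = t.
Hypothesis bar_t : bar t = t^-1.
Hypothesis evp_inj : forall p, evp p t = 0 -> p = 0.
Hypothesis sW : forall a, a \in Pi -> inW (s a).
Hypothesis sK : forall a, a \in Pi -> mul (s a) (s a) = one.
Hypothesis av_act : forall x y a, inW x -> inW y -> a \in Pi -> act x (av y a) = av (mul x y) a.
Hypothesis av_s : forall x a, inW x -> a \in Pi -> av (mul x (s a)) a = t + t^-1 - av x a.
Hypothesis av_bar : forall x a, inW x -> a \in Pi -> bar (av x a) = av x a.
Hypothesis av_neq0 : forall x a, inW x -> a \in Pi -> av x a != 0.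

Lemma sgK a u : a \in Pi -> mul (mul u (s a)) (s a) = u.
Proof. by move=> aP; rewrite -mulA sK // mulg1. Qed.
Lemma sKg a u : a \in Pi -> mul (s a) (mul (s a) u) = u.
Proof. by move=> aP; rewrite mulA sK // mul1g. Qed.
Lemma inv_s a : a \in Pi -> inv (s a) = s a.
Proof. by move=> aP; rewrite -[LHS]mulg1 -(sK aP) tmulKg //; exact: sW. Qed.

Definition ts a : G -> Q := fun u => (av one a - t) * dl one u + av (s a) a * dl (s a) u.

Definition Rp a (Z : G -> Q) : G -> Q := rop t (fun x => mul x (s a)) (fun x => av x a) Z.

Lemma qmul_tsr Z a : a \in Pi -> qmul Z (ts a) =W Rp a Z.
Proof.
move=> aP u uW; rewrite qmulE' //.
transitivity (\sum_(v <- W) ((if v == one then Z u * (av u a - t) else 0) +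
   (if v == s a then Z (mul u (s a)) * av u a else 0))).
  apply: sumW_eq => v vW; have xW := inWM uW (inWV vW).
  rewrite /ts /dl (homD (act_hom xW)) !(homM (act_hom xW)) !(homn (act_hom xW)).
  rewrite (homB (act_hom xW)) act_t // !av_act //; last exact: sW.
  rewrite mulrDr; congr (_ + _).
    case: eqP => [->|_]; rewrite /= ?mulr0 // mulr1 !mulg1.
    by rewrite -[inv one]mulg1 mulVg // !mulg1.
  case: eqP => [->|_]; rewrite /= ?mulr0 // mulr1.
  by rewrite inv_s // sgK.
rewrite big_split /= -!big_mkcond !sumW_pick //; exact: sW.
Qed.

Lemma qmul_tsl y a u : a \in Pi -> inW u ->
  qmul (ts a) y u = (av one a - t) * y u + av (s a) a * act (s a) (y (mul (s a) u)).
Proof.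
move=> aP uW; rewrite qmulE //.
transitivity (\sum_(v <- W) ((if v == one then (av one a - t) * y u else 0) +
   (if v == s a then av (s a) a * act (s a) (y (mul (s a) u)) else 0))).
  apply: sumW_eq => v vW; rewrite /ts /dl mulrDl; congr (_ + _).
    case: eqP => [->|_]; rewrite /= ?mulr0 ?mul0r // mulr1 act_one.
    by rewrite -[inv one]mulg1 mulVg // mul1g.
  by case: eqP => [->|_]; rewrite /= ?mulr0 ?mul0r // mulr1 inv_s.
rewrite big_split /= -!big_mkcond !sumW_pick //; exact: sW.
Qed.

Lemma tsl_quad y a : a \in Pi ->
  qmul (ts a) (qmul (ts a) y) =W (fun u => y u + (t^-1 - t) * qmul (ts a) y u).
Proof.
move=> aP u uW; have aW := sW aP; have suW := inWM aW uW.
rewrite !qmul_tsl // sKg // (homD (act_hom aW)) !(homM (act_hom aW)) (homB (act_hom aW)) act_t //.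
rewrite !av_act // mulg1 sK // -act_mul // sK // act_one.
have := av_s inW1 aP; rewrite mul1g => ->.
move: (av one a) (act _ _) (y u) => A B Y.
by field.
Qed.

Lemma tsr_quad y a : a \in Pi ->
  qmul (qmul y (ts a)) (ts a) =W (fun u => y u + (t^-1 - t) * qmul y (ts a) u).
Proof.
move=> aP u uW; have aW := sW aP; have usW := inWM uW aW.
rewrite (qmul_tsr _ aP uW) /Rp /rop !(qmul_tsr _ aP) // /Rp /rop sgK // av_s //.
move: (av u a) (y u) (y _) => A Y B.
by field.
Qed.

(** By the quadratic relation the right-hand side is the inverse of [ts a]: on generators the
    coefficientwise bar does what the bar involution of the Hecke algebra does. *)
Lemma bq_ts a : a \in Pi -> bq (ts a) =W (fun u => ts a u + (t - t^-1) * dl one u).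
Proof.
move=> aP u uW; rewrite /bq /ts (homD bar_hom) !(homM bar_hom) (homB bar_hom).
rewrite !av_bar ?bar_t //; last exact: sW.
rewrite /dl !(homn bar_hom); move: (av one a) (av _ a) (_ == _)%:R (_ == _)%:R => A B C D.
by ring.
Qed.

Lemma act_tV w : inW w -> act w (t - t^-1) = t - t^-1.
Proof. by move=> wW; rewrite (homB (act_hom wW)) (homV (act_hom wW)) act_t. Qed.

Lemma qmul_bts y a : a \in Pi ->
  qmul (bq (ts a)) y =W (fun u => qmul (ts a) y u + (t - t^-1) * y u).
Proof.
move=> aP u uW; rewrite (qmul_ext (bq_ts aP) (fun u _ => erefl (y u)) uW).
by rewrite qmul_linl // (qmul1l y uW).
Qed.

Lemma qmul_btsr y a : a \in Pi ->
  qmul y (bq (ts a)) =W (fun u => qmul y (ts a) u + (t - t^-1) * y u).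
Proof.
move=> aP u uW; rewrite (qmul_ext (fun u _ => erefl (y u)) (bq_ts aP) uW).
rewrite qmul_linr //; last exact: act_tV.
congr (_ + _ * _); rewrite qmulE' // (sumW_one inW1) => [|v vW /negPf v1].
  by rewrite -[inv one]mulg1 mulVg // mulg1 /dl eqxx (hom1 (act_hom uW)) mulr1.
by rewrite /dl v1 (hom0 (act_hom _)) ?mulr0 //; apply/inWM/inWV.
Qed.

(** * Reduced words and the standard basis *)

Definition gword ws := foldr (fun a x => mul (s a) x) one ws.
Definition tw ws := foldr qmul (dl one) (map ts ws).
Definition Rw ws (Z : G -> Q) := foldl (fun Y a => Rp a Y) Z ws.
Definition gred ws := {subset ws <= Pi} /\ len (gword ws) = size ws.

Variable red : G -> seq I.
Hypothesis redP : forall w, inW w -> gred (red w) /\ gword (red w) = w.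
Hypothesis matsu : forall ws ws' : seq I, gred ws -> gred ws' -> gword ws = gword ws' ->
  forall Z x, inW x -> Rw ws Z x = Rw ws' Z x.

Lemma Rp_ext a Z Z' : a \in Pi -> Z =W Z' -> Rp a Z =W Rp a Z'.
Proof.
move=> aP E x xW; rewrite /Rp /rop E // E //; apply: inWM => //; exact: sW.
Qed.

Lemma Rw_ext ws Z Z' : {subset ws <= Pi} -> Z =W Z' -> Rw ws Z =W Rw ws Z'.
Proof.
elim: ws Z Z' => [|a ws IH] Z Z' S E //=.
apply: IH; first by move=> x xs; apply: S; rewrite inE xs orbT.
by apply: Rp_ext => //; apply: S; rewrite mem_head.
Qed.

Lemma qmul1r Z : qmul Z (dl one) =W Z.
Proof.
move=> u uW; rewrite qmulE' // (sumW_one inW1) => [|v vW /negPf v1].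
  by rewrite -[inv one]mulg1 mulVg // mulg1 /dl eqxx (hom1 (act_hom uW)) mulr1.
by rewrite /dl v1 (hom0 (act_hom _)) ?mulr0 //; apply/inWM/inWV.
Qed.

Lemma qmul_tw ws Z : {subset ws <= Pi} -> qmul Z (tw ws) =W Rw ws Z.
Proof.
elim: ws Z => [|a ws IH] Z S u uW; first exact: qmul1r.
have aP : a \in Pi by apply: S; rewrite mem_head.
have S' : {subset ws <= Pi} by move=> x xs; apply: S; rewrite inE xs orbT.
rewrite /tw /= -/(tw ws) qmulA // IH //=; apply: (Rw_ext S') => // v vW.
exact: qmul_tsr.
Qed.

Lemma tw_Rw ws : {subset ws <= Pi} -> tw ws =W Rw ws (dl one).
Proof. by move=> S u uW; rewrite -(qmul_tw _ S uW) (qmul1l _ uW). Qed.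

Definition tauG w := tw (red w).

Lemma red_sub w : inW w -> {subset red w <= Pi}. Proof. by case/redP => [[]]. Qed.
Lemma red_size w : inW w -> size (red w) = len w.
Proof. by case/redP => [[_ <-] ->]. Qed.

Lemma gred_tau ws : gred ws -> inW (gword ws) -> tw ws =W tauG (gword ws).
Proof.
move=> r wW u uW; have [r' e] := redP wW.
rewrite (tw_Rw (proj1 r)) // /tauG (tw_Rw (red_sub wW)) //.
by apply: matsu.
Qed.

Lemma gword_rcons ws a : gword (rcons ws a) = mul (gword ws) (s a).
Proof. by elim: ws => [|b ws IH] /=; rewrite ?mulg1 ?mul1g // IH mulA. Qed.

Hypothesis len1 : len one = 0%N.
Hypothesis lenr : forall w a, inW w -> a \in Pi ->
  len (mul w (s a)) = (len w).+1 \/ len w = (len (mul w (s a))).+1.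
Hypothesis lenl : forall w a, inW w -> a \in Pi ->
  len (mul (s a) w) = (len w).+1 \/ len w = (len (mul (s a) w)).+1.
Hypothesis descl : forall w, inW w -> w != one ->
  exists2 a, a \in Pi & (len (mul (s a) w) < len w)%N.
Hypothesis descr : forall w, inW w -> w != one ->
  exists2 a, a \in Pi & (len (mul w (s a)) < len w)%N.

Lemma inWs w a : inW w -> a \in Pi -> inW (mul w (s a)).
Proof. by move=> wW /sW; apply: inWM. Qed.
Lemma insW w a : inW w -> a \in Pi -> inW (mul (s a) w).
Proof. by move=> wW /sW; move/inWM; apply. Qed.

Lemma lenl_down w a : inW w -> a \in Pi -> (len (mul (s a) w) < len w)%N ->
  len w = (len (mul (s a) w)).+1.
Proof. by move=> wW aP lt; case: (lenl wW aP) => // E; move: lt; rewrite E ltnNge leqnSn. Qed.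
Lemma lenr_down w a : inW w -> a \in Pi -> (len (mul w (s a)) < len w)%N ->
  len w = (len (mul w (s a))).+1.
Proof. by move=> wW aP lt; case: (lenr wW aP) => // E; move: lt; rewrite E ltnNge leqnSn. Qed.
Lemma lenl_up w a : inW w -> a \in Pi -> (len (mul (s a) w) < len w)%N = false ->
  len (mul (s a) w) = (len w).+1.
Proof. by move=> wW aP lt; case: (lenl wW aP) => // E; move: lt;
  rewrite [X in (_ < X)%N]E ltnSn. Qed.
Lemma lenr_up w a : inW w -> a \in Pi -> (len (mul w (s a)) < len w)%N = false ->
  len (mul w (s a)) = (len w).+1.
Proof. by move=> wW aP lt; case: (lenr wW aP) => // E; move: lt;
  rewrite [X in (_ < X)%N]E ltnSn. Qed.

Lemma tau_one : tauG one =W dl one.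
Proof.
have [[_ ]] := redP inW1; move=> E e; move: E; rewrite e len1 /tauG => /esym/size0nil ->.
by move=> u uW.
Qed.

Lemma tau_r w a : inW w -> a \in Pi -> (len (mul w (s a)) < len w)%N = false ->
  tauG (mul w (s a)) =W qmul (tauG w) (ts a).
Proof.
move=> wW aP up u uW; have wsW := inWs wW aP; have [[S E] e] := redP wW.
have g : gred (rcons (red w) a).
  split; first by move=> x; rewrite mem_rcons inE => /orP[/eqP->|/S].
  by rewrite gword_rcons e size_rcons red_size // lenr_up.
have e' : gword (rcons (red w) a) = mul w (s a) by rewrite gword_rcons e.
rewrite -e' -(gred_tau g) //; last by rewrite e'.
rewrite (tw_Rw (proj1 g)) // /Rw foldl_rcons -/(Rw _ _) (qmul_tsr _ aP uW).
by apply: (Rp_ext aP) => // v vW; rewrite /tauG (tw_Rw S).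
Qed.

Lemma tau_l w a : inW w -> a \in Pi -> (len (mul (s a) w) < len w)%N = false ->
  tauG (mul (s a) w) =W qmul (ts a) (tauG w).
Proof.
move=> wW aP up u uW; have wsW := insW wW aP; have [[S E] e] := redP wW.
have g : gred (a :: red w).
  split; first by move=> x; rewrite inE => /orP[/eqP->|/S].
  by rewrite /= e red_size // lenl_up.
have e' : gword (a :: red w) = mul (s a) w by rewrite /= e.
by rewrite -e' -(gred_tau g) // e'.
Qed.

Lemma tau_l_down w a : inW w -> a \in Pi -> (len (mul (s a) w) < len w)%N ->
  qmul (ts a) (tauG w) =W (fun u => tauG (mul (s a) w) u + (t^-1 - t) * tauG w u).
Proof.
move=> wW aP dn u uW; have swW := insW wW aP.
have up : (len (mul (s a) (mul (s a) w)) < len (mul (s a) w))%N = false.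
  by rewrite sKg // ltnNge ltnW.
have E := tau_l swW aP up; rewrite sKg // in E.
rewrite (qmul_ext (fun u _ => erefl (ts a u)) E uW) (tsl_quad _ aP uW).
by rewrite -(E u uW).
Qed.

Lemma tau_r_down w a : inW w -> a \in Pi -> (len (mul w (s a)) < len w)%N ->
  qmul (tauG w) (ts a) =W (fun u => tauG (mul w (s a)) u + (t^-1 - t) * tauG w u).
Proof.
move=> wW aP dn u uW; have swW := inWs wW aP.
have up : (len (mul (mul w (s a)) (s a)) < len (mul w (s a)))%N = false.
  by rewrite sgK // ltnNge ltnW.
have E := tau_r swW aP up; rewrite sgK // in E.
rewrite (qmul_ext E (fun u _ => erefl (ts a u)) uW) (tsr_quad _ aP uW).
by rewrite -(E u uW).
Qed.

(** Triangularity by length is weaker than triangularity for the Bruhat order, but it isolates top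
    coefficients, and its induction only needs that a simple reflection changes the length by
    one. *)
Lemma tau_supp w u : inW w -> inW u -> tauG w u != 0 -> u = w \/ (len u < len w)%N.
Proof.
have [k] := ubnP (len w); elim: k w u => // k IH w u; rewrite ltnS => lk wW uW.
have [->|w1] := eqVneq w one.
  rewrite (tau_one uW) /dl; have [->|/negPf n1] := eqVneq u one; first by left.
  by rewrite eqxx.
have [a aP lt] := descr wW w1; have wsW := inWs wW aP; have ld := lenr_down wW aP lt.
have up : (len (mul (mul w (s a)) (s a)) < len (mul w (s a)))%N = false.
  by rewrite sgK // ltnNge ltnW.
have := tau_r wsW aP up uW; rewrite sgK // => ->.
rewrite (qmul_tsr _ aP uW) /Rp /rop => nz.
have lk' : (len (mul w (s a)) < k)%N by apply: leq_trans lk.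
have [z1|n1] := eqVneq (tauG (mul w (s a)) u) 0; last first.
  by right; case: (IH _ _ lk' wsW uW n1) => [->//|l]; apply: ltn_trans lt.
have [z2|n2] := eqVneq (tauG (mul w (s a)) (mul u (s a))) 0.
  by move: nz; rewrite z1 z2 !mul0r addr0 eqxx.
case: (IH _ _ lk' wsW (inWs uW aP) n2) => [E|l].
  by left; rewrite -[u](sgK _ aP) E sgK.
right; rewrite ld; case: (lenr uW aP) => E; rewrite E in l *; last by rewrite ltnS.
by apply: leq_trans (ltnW l) _.
Qed.

(** By triangularity tau_w has no coefficient at ws, so only the delta_s part of tau_s
    contributes. *)
Lemma tau_diag_step w a : inW w -> a \in Pi -> (len (mul w (s a)) < len w)%N = false ->
  tauG (mul w (s a)) (mul w (s a)) = tauG w w * av (mul w (s a)) a.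
Proof.
move=> wW aP up; have wsW := inWs wW aP; rewrite (tau_r wW aP up wsW) (qmul_tsr _ aP wsW) /Rp /rop.
rewrite sgK //.
have [->|n] := eqVneq (tauG w (mul w (s a))) 0; first by rewrite mul0r add0r.
have lu := lenr_up wW aP up.
case: (tau_supp wW wsW n) => E; first by move: lu; rewrite E => /eqP;
  rewrite -[X in X == _]addn0 -addn1 eqn_add2l.
by move: E; rewrite lu ltnNge leqnSn.
Qed.

Lemma tau_diag w : inW w -> tauG w w != 0 /\ bar (tauG w w) = tauG w w.
Proof.
have [k] := ubnP (len w); elim: k w => // k IH w; rewrite ltnS => lk wW.
have [->|w1] := eqVneq w one.
  by rewrite (tau_one inW1) /dl eqxx oner_neq0 (hom1 bar_hom).
have [a aP lt] := descr wW w1; have wsW := inWs wW aP.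
have up : (len (mul (mul w (s a)) (s a)) < len (mul w (s a)))%N = false.
  by rewrite sgK // ltnNge ltnW.
have := tau_diag_step wsW aP up; rewrite sgK // => ->.
have [n b] := IH _ (leq_trans lt lk) wsW.
by rewrite mulf_neq0 ?av_neq0 // (homM bar_hom) b av_bar.
Qed.

(* [gam r] is gamma^+ for r = t and gamma^- for r = - t^-1: the substitution t -> - t^-1 in the
   coefficients turns one basis into the other and preserves the quadratic relation. *)
Variable bru : G -> G -> Prop.
Hypothesis bru_refl : forall u, bru u u.
Hypothesis bru_trans : forall u v w, bru u v -> bru v w -> bru u w.
Hypothesis bru_len : forall u v, bru u v -> u = v \/ (len u < len v)%N.
Hypothesis bru_up : forall u a, inW u -> a \in Pi -> (len u < len (mul (s a) u))%N ->
  bru u (mul (s a) u).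
Hypothesis bru_lift : forall u v a, a \in Pi -> inW v -> bru u v ->
  (len v < len (mul (s a) v))%N -> bru (mul (s a) u) (mul (s a) v).

(** The third condition is a quadratic equation for r whose two roots are t and -t^-1. *)
Definition param r := [/\ r != 0, bar r = r^-1, r^-1 - r = t^-1 - t & forall w, inW w ->
  act w r = r].

Lemma param_t : param t.
Proof. by split=> // w; exact: act_t. Qed.

Lemma param_mtV : param (- t^-1).
Proof.
have barN x : bar (- x) = - bar x by rewrite -[- x]sub0r (homB bar_hom) (hom0 bar_hom) sub0r.
split; first by rewrite oppr_eq0 invr_eq0.
- by rewrite barN (homV bar_hom) bar_t invrN.
- by rewrite invrN invrK opprK addrC.
- by move=> w wW; rewrite -[- _]sub0r (homB (act_hom wW)) (hom0 (act_hom wW)) (homV (act_hom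
  wW)) act_t.
Qed.

(** * Kazhdan-Lusztig polynomials characterised by bar invariance *)

Definition cf r (P : G -> {poly int}) v x : Q := r ^+ len v / r ^+ len x * evp (P x) (r ^- 2).
Definition gam r P v : G -> Q := fun u => \sum_(x <- W) cf r P v x * tauG x u.

Lemma cf_act r P v w x : param r -> inW w -> act w (cf r P v x) = cf r P v x.
Proof.
case=> _ _ _ ar wW; have h := act_hom wW.
by rewrite /cf !(homM h) !(homV h) !(homX h) (hom_evp _ _ h) (homV h) (homX h) ar.
Qed.

(** The defining properties of x -> P_{x,v}. The degree bound puts every coefficient of [gam r]
    other than the one at v into r Z[r]; bar invariance is asked for all parameters r because the
    same polynomials serve both bases. *)
Definition good v (P : G -> {poly int}) :=
  [/\ P v = 1, forall x, inW x -> P x <> 0 -> bru x v,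
   forall x i, inW x -> x != v -> (len v <= i.*2 + len x)%N -> (P x)`_i = 0 &
   forall r u, param r -> inW u -> bar (gam r P v u) = gam r P v u].

Lemma gam_ext r P P' v u : (forall x, inW x -> P x = P' x) -> gam r P v u = gam r P' v u.
Proof. by move=> E; apply: sumW_eq => x xW; rewrite /cf E. Qed.

Lemma good_ext v P P' : inW v -> (forall x, inW x -> P x = P' x) -> good v P -> good v P'.
Proof.
move=> vW E [g1 g2 g3 g4]; split.
- by rewrite -E.
- by move=> x xW; rewrite -E //; apply: g2.
- by move=> x i xW; rewrite -E //; apply: g3.
- by move=> r u rP uW; rewrite -!(gam_ext _ _ _ E); apply: g4.
Qed.

Lemma cf_bound r (P : G -> {poly int}) v x : r != 0 -> P x <> 0 ->
  (forall i, (len v <= i.*2 + len x)%N -> (P x)`_i = 0) ->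
  exists q : {poly int}, [/\ q`_0 = 0, q = 0 -> P x = 0 & cf r P v x = evp q r].
Proof.
move=> r0 nz H; have lt : (len x <= len v)%N.
  rewrite leqNgt; apply/negP => lt; apply: nz; apply/polyP => i.
  by rewrite coef0 H //; lia.
have [|q [q0 q1 Eq]] := @evp_shift _ (P x) r (len v - len x) r0.
  by move=> i; rewrite leq_subLR addnC; exact: H.
by exists q; split=> //; rewrite -Eq /cf -{1}(subnK lt) exprD mulfK // expf_neq0.
Qed.

Lemma evp_bar p r : param r -> bar (evp p r) = evp p r^-1.
Proof. by case=> _ br _ _; rewrite (hom_evp _ _ bar_hom) br. Qed.

(** With agreement at longer elements, the difference of the two [gam] has at delta_x only the term
    of x. Its diagonal factor is bar-invariant and nonzero, so the coefficient is a bar-invariant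
    polynomial in t without constant term, hence zero. *)
Lemma good_uniq_step v P P' x : inW x -> good v P -> good v P' ->
  (forall y, inW y -> (len x < len y)%N -> P y = P' y) -> P x = P' x.
Proof.
move=> xW [g1 _ g3 g4] [g1' _ g3' g4'] H.
have [->|xv] := eqVneq x v; first by rewrite g1 g1'.
pose D y := P y - P' y.
have [|/eqP Dn] := eqVneq (D x) 0; first by move/eqP; rewrite subr_eq0 => /eqP.
have [|q [q0 q1 Eq]] := @cf_bound t D v x t0 Dn.
  by move=> i lt; rewrite coefB (g3 x i) // (g3' x i) // subrr.
have E : cf t D v x * tauG x x = gam t P v x - gam t P' v x.
  rewrite /gam -sumrB (sumW_one xW) => [|y yW yx].
    by rewrite -mulrBl /cf -mulrBr evpD evpN.
  have [-> |n] := eqVneq (tauG y x) 0; first by rewrite !mulr0 subrr.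
  case: (tau_supp yW xW n) => [e|lt]; first by rewrite e eqxx in yx.
  by rewrite /cf (H y yW lt) subrr.
have [dn db] := tau_diag xW.
have : bar (cf t D v x) = cf t D v x.
  apply: (mulIf dn); rewrite -{1}db -(homM bar_hom) E (homB bar_hom).
  by rewrite g4 ?g4' //; exact: param_t.
rewrite Eq (evp_bar _ param_t) => /esym /(evp_sym t0 evp_inj); rewrite q0 => /q1.
by move/eqP; rewrite subr_eq0 => /eqP.
Qed.

Lemma good_uniq v P P' : good v P -> good v P' -> forall x, inW x -> P x = P' x.
Proof.
move=> g g'; pose N := (\max_(w <- W) len w)%N.
have lN y : inW y -> (len y <= N)%N.
  by move=> yW; apply: leq_bigmax_seq => //; apply/Wmem.
suff H k x : inW x -> (N - len x < k)%N -> P x = P' x by move=> x xW; apply: (H _ x xW (ltnSn _)).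
elim: k x => // k IH x xW lt; apply: (good_uniq_step xW g g') => y yW lxy.
by apply: IH => //; have := lN _ yW; lia.
Qed.

Lemma good_one P : (forall x, inW x -> P x = (x == one)%:R) -> good one P.
Proof.
move=> E; split.
- by rewrite E // eqxx.
- move=> x xW; rewrite E //; case: eqP => [-> _|//]; exact: bru_refl.
- by move=> x i xW /negPf x1 _; rewrite E // x1 coef0.
- move=> r u rP uW; rewrite /gam (sumW_one inW1) => [|x xW /negPf x1].
    have r0 : r != 0 by case: rP.
    rewrite /cf divff ?expf_neq0 //.
    by rewrite E // eqxx evp1 !mul1r (tau_one uW) /dl (homn bar_hom).
  by rewrite /cf E // x1 evp0 mulr0 mul0r.
Qed.

(** * The Kazhdan-Lusztig recursion preserves the characterisation *)

Section Step.
Variables (P : G -> G -> {poly int}) (v : G) (a : I).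
Hypothesis vW : inW v.
Hypothesis aP : a \in Pi.
Hypothesis av_lt : (len (mul (s a) v) < len v)%N.
Hypothesis IHP : forall z, inW z -> (len z < len v)%N -> good z (P^~ z).
Let y := mul (s a) v.

Definition gmu (z x : G) : int := if odd (len x - len z) then (P z x)`_((len x - len z).-1./2)
  else 0.
Definition rhs x : {poly int} :=
  let c : nat := (len (mul (s a) x) < len x)%N in
  'X^(1 - c) * P (mul (s a) x) y + 'X^c * P x y
    - \sum_(z <- W | pb (bru z y) && (z != y) && (len (mul (s a) z) < len z)%N)
         (gmu z y)%:P * 'X^((len v - len z)./2) * P x z.

Let yW : inW y := insW vW aP.
Let lv : len v = (len y).+1 := lenl_down vW aP av_lt.
Let gy : good y (P^~ y). Proof. by apply: IHP. Qed.
Let sy : mul (s a) y = v := sKg v aP.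
Let yv : bru y v.
Proof. by have := @bru_up y a yW aP; rewrite sy; apply; rewrite lv. Qed.

Lemma zP z : inW z -> bru z y -> z != y -> (len z < len y)%N.
Proof. by move=> zW /bru_len[->|//]; rewrite eqxx. Qed.

Lemma good0 z x : inW z -> (len z < len v)%N -> inW x -> ~ bru x z -> P x z = 0.
Proof.
move=> zW lz xW nb; have [_ g2 _ _] := IHP zW lz.
by have [//|/eqP n] := eqVneq (P x z) 0; case: nb; apply: g2.
Qed.

Lemma bru_v x : inW x -> bru (mul (s a) x) y -> bru x v.
Proof.
move=> xW b; have := bru_lift aP yW b; rewrite sy sKg //; apply.
by rewrite lv.
Qed.

Lemma rhs_supp x : inW x -> rhs x <> 0 -> bru x v.
Proof.
move=> xW nz; apply: NNPP => nb; apply: nz.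
have lyv : (len y < len v)%N by rewrite lv.
rewrite /rhs (good0 yW lyv (insW xW aP)); last by move/(bru_v xW).
rewrite (good0 yW lyv xW); last by move=> b; apply: nb; apply: bru_trans yv.
rewrite !mulr0 addr0 big_seq_cond big1 ?subr0 // => z /andP[/Wmem zW /andP[/andP[/pbP bz zy] _]].
have lz := zP zW bz zy.
rewrite (good0 zW (ltn_trans lz lyv) xW) ?mulr0 // => b; apply: nb.
exact: bru_trans b (bru_trans bz yv).
Qed.

Lemma rhs_v : rhs v = 1.
Proof.
have lyv : (len y < len v)%N by rewrite lv.
have [g1 _ _ _] := gy.
have nb z : (len z <= len y)%N -> ~ bru v z.
  by move=> lz /bru_len[e|lt]; move: lz; rewrite -?e; lia.
rewrite /rhs av_lt -/y g1 (good0 yW lyv vW) ?mulr0 ?addr0; last exact: nb.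
rewrite subnn expr0 mul1r big_seq_cond big1 ?subr0 // =>
  z /andP[/Wmem zW /andP[/andP[/pbP bz zy] _]].
have lz := zP zW bz zy.
by rewrite (good0 zW (ltn_trans lz lyv) vW) ?mulr0 //; apply/nb/ltnW.
Qed.

Let zcond z := pb (bru z y) && (z != y) && (len (mul (s a) z) < len z)%N.
Let zterm x z := (gmu z y)%:P * 'X^((len v - len z)./2) * P x z.

(** In degrees from (l(v) - l(x))/2 on, the bound for P_{x,z}, shifted by half of l(v) - l(z),
    annihilates every term of the sum except possibly z = x. *)
Lemma zterm_coef x z i : inW z -> zcond z -> inW x -> z != x -> (len v <= i.*2 + len x)%N ->
  (zterm x z)`_i = 0.
Proof.
move=> zW /andP[/andP[/pbP bz zy] _] xW zx le; have lz := zP zW bz zy.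
rewrite /zterm -mulrA coefCM coefXnM /gmu; case: ifP => od; last by rewrite mul0r.
case: ltnP => [|ki]; first by rewrite mulr0.
have lzv : (len z < len v)%N by rewrite lv; apply: ltnW.
have [_ _ g3 _] := IHP zW lzv.
rewrite g3 ?mulr0 //; first by rewrite eq_sym.
move: od lv lz ki le; clear; lia.
Qed.

Lemma sum_zterm_coef x i : inW x -> (len v <= i.*2 + len x)%N ->
  (\sum_(z <- W | zcond z) zterm x z)`_i = if zcond x then (zterm x x)`_i else 0.
Proof.
move=> xW le; rewrite coef_sum big_mkcond /= (sumW_one xW) // => z zW zx.
by case: ifP => // zc; apply: zterm_coef.
Qed.

(** Only sx < x is critical: there X P_{x,y} may reach degree exactly (l(v) - l(x))/2, with
    coefficient mu(x,y), and the term z = x of the subtracted sum cancels it. *)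
Lemma rhs_deg x i : inW x -> x != v -> (len v <= i.*2 + len x)%N -> (rhs x)`_i = 0.
Proof.
move=> xW xv le; have [->|/eqP nz] := eqVneq (rhs x) 0; first by rewrite coef0.
have lxv : (len x < len v)%N.
  by case: (bru_len (rhs_supp xW nz)) => // e; rewrite e eqxx in xv.
have lyv : (len y < len v)%N by rewrite lv.
have sxW := insW xW aP; have [g1 _ g3 _] := gy.
have sxy : mul (s a) x != y.
  by apply: contra xv => /eqP e; rewrite -sy -e sKg.
rewrite /rhs coefB coefD sum_zterm_coef //; case sx: (len (mul (s a) x) < len x)%N => /=.
  have ls := lenl_down xW aP sx.
  have xy : x != y.
    by apply/eqP => e; move: sx; rewrite e sy lv => /ltnW; rewrite ltnn.
  rewrite subnn expr0 mul1r (g3 _ i sxW sxy) ?add0r; last by move: le ls lv; clear; lia.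
  rewrite coefXnM; case: (posnP i) => [i0|i0]; first by move: le lxv; rewrite i0; clear; lia.
  have -> : (i < 1)%N = false by move: i0; clear; lia.
  have [eq|ne] := eqVneq (len v) (i.*2 + len x)%N.
    case: ifP => [xc|xc].
      rewrite /zterm -mulrA coefCM coefXnM; have -> : ((len v - len x)./2 = i) by move: eq;
        clear; lia.
      rewrite ltnn subnn.
      have [gx _ _ _] := IHP xW lxv; rewrite gx coef1 /= mulr1 /gmu.
      have -> : odd (len y - len x) by move: eq lv i0; clear; lia.
      have -> : ((len y - len x).-1./2 = i - 1)%N by move: eq lv i0; clear; lia.
      by rewrite subrr.
    rewrite (good0 yW lyv xW) ?coef0 ?subrr // => b.
    by move/negP: xc; apply; rewrite /zcond xy sx !andbT; apply/pbP.
  rewrite (g3 x (i - 1)%N xW xy); last by move: le ne i0 lv; clear; lia.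
  case: ifP => _; rewrite ?subrr // /zterm -mulrA coefCM coefXnM.
  have [gx _ _ _] := IHP xW lxv; rewrite gx coef1.
  have -> : (i < (len v - len x)./2)%N = false by move: le ne; clear; lia.
  have -> : (i - (len v - len x)./2 == 0)%N = false by move: le ne lxv; clear; lia.
  by rewrite mulr0 subrr.
have ls := lenl_up xW aP sx.
have -> : zcond x = false by rewrite /zcond sx andbF.
rewrite subr0 subn0 coefXnM expr0 mul1r.
case: (posnP i) => [i0|i0]; first by move: le lxv; rewrite i0; clear; lia.
have -> : (i < 1)%N = false by move: i0; clear; lia.
rewrite (g3 _ (i - 1)%N sxW sxy) ?add0r; last by move: le ls lv i0; clear; lia.
(* The case x = y does occur, since sy = v > y; then the polynomial is 1 and has no coefficient in
   degree i > 0. *)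
have [->|xy] := eqVneq x y; last by apply: g3 => //; apply: leq_trans le; rewrite lv.
by rewrite g1 coef1; move: i0; case: (i).
Qed.

Lemma rhs_cf r x : param r -> inW x ->
  cf r rhs v x = cf r (P^~ y) y (mul (s a) x)
    + (if (len (mul (s a) x) < len x)%N then r^-1 else r) * cf r (P^~ y) y x
    - \sum_(z <- W | zcond z) (gmu z y)%:~R * cf r (P^~ z) z x.
Proof.
case=> r0 _ _ _ xW; rewrite /cf /rhs evpD evpN evpD !evpM !evpXn evp_sum mulrBr.
congr (_ - _); last first.
  rewrite mulr_sumr big_seq_cond [RHS]big_seq_cond; apply: eq_bigr => z /andP[/Wmem zW zc].
  rewrite !evpM evpC evpXn /gmu; case/andP: zc => /andP[/pbP bz zy] _; have lz := zP zW bz zy.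
  case: ifP => od; last by rewrite !mul0r mulr0.
  (* For odd l(y) - l(z), the only case with a nonzero mu, the difference l(v) - l(z) is even and
     halving it is exact. *)
  have -> : len v = (len z + 2 * (len v - len z)./2)%N by move: od lz lv; clear; lia.
  set k := ((len v - len z)./2); have -> : ((len z + 2 * k - len z)./2 = k)%N by clear; lia.
  rewrite exprD exprM exprVn; move: (evp _ _) (_%:~R) (r ^+ len z) => A B C.
  have k0 : r ^+ 2 ^+ k != 0 by rewrite !expf_neq0.
  have x0 : r ^+ len x != 0 by rewrite expf_neq0.
  move: (r ^+ 2 ^+ k) (r ^+ len x) k0 x0 => K X k0 x0.
  by field; rewrite k0 x0.
case sx: (len (mul (s a) x) < len x)%N => /=.
  have ls := lenl_down xW aP sx; rewrite ls lv subnn expr0 expr1 mul1r !exprS.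
  have x0 : r ^+ len (mul (s a) x) != 0 by rewrite expf_neq0.
  move: (evp _ _) (evp _ _) (r ^+ len y) (r ^+ len _) x0 => A B C D x0.
  by field; rewrite x0 r0.
have ls := lenl_up xW aP sx; rewrite ls lv subn0 expr0 expr1 mul1r !exprS.
have x0 : r ^+ len x != 0 by rewrite expf_neq0.
move: (evp _ _) (evp _ _) (r ^+ len y) (r ^+ len _) x0 => A B C D x0.
by field; rewrite x0 r0.
Qed.

(** The recursion read in the algebra: C_v is (tau_s + r) C_y minus multiples mu(z,y) C_z. As tau_s
    + r and the integers mu are bar-invariant, C_v inherits bar invariance from the shorter
    elements. *)
Lemma rhs_gam r u : param r -> inW u ->
  gam r rhs v u = qmul (ts a) (gam r (P^~ y) y) u + r * gam r (P^~ y) y u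
    - \sum_(z <- W | zcond z) (gmu z y)%:~R * gam r (P^~ z) z u.
Proof.
move=> rP uW; have [_ _ rt _] := rP.
rewrite qmul_sumr //; last by move=> w i wW; apply: cf_act.
have -> : \sum_(x <- W) cf r (P^~ y) y x * qmul (ts a) (tauG x) u =
   \sum_(x <- W) (cf r (P^~ y) y (mul (s a) x) +
     (if (len (mul (s a) x) < len x)%N then r^-1 - r else 0) * cf r (P^~ y) y x) * tauG x u.
  transitivity (\sum_(x <- W) (cf r (P^~ y) y x * tauG (mul (s a) x) u +
     (if (len (mul (s a) x) < len x)%N then r^-1 - r else 0) * cf r (P^~ y) y x * tauG x u)).
    apply: sumW_eq => x xW; case sx: (len (mul (s a) x) < len x)%N.
      by rewrite (tau_l_down xW aP sx uW) rt mulrDr mulrA [cf _ _ _ _ * (_ - _)]mulrC.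
    by rewrite (tau_l xW aP sx uW) !mul0r addr0.
  rewrite big_split /= (sumW_mull _ (sW aP)) -big_split; apply: sumW_eq => x xW /=.
  by rewrite sKg // mulrDl.
rewrite /gam mulr_sumr -big_split /=.
under [X in _ - X]eq_bigr => z _ do rewrite mulr_sumr.
rewrite [X in _ - X]exchange_big -sumrB; apply: sumW_eq => x xW /=.
rewrite (rhs_cf rP xW) mulrBl; congr (_ - _).
  rewrite !mulrDl -addrA; congr (_ + _); rewrite mulrA -mulrDl -mulrDl; congr (_ * _ * _).
  by case: ifP; rewrite ?subrK ?add0r.
by rewrite mulr_suml; apply: eq_bigr => z _; rewrite -mulrA.
Qed.

Lemma rhs_good : good v rhs.
Proof.
split; [exact: rhs_v|by move=> x; exact: rhs_supp|by move=> x i; exact: rhs_deg|].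
move=> r u rP uW; have [r0 br rt _] := rP; have [_ _ _ g4] := gy.
rewrite (rhs_gam rP uW) (homB bar_hom) (homD bar_hom) (homM bar_hom) br (g4 r u rP uW).
congr (_ - _).
  have -> : bar (qmul (ts a) (gam r (P^~ y) y) u) =
      qmul (ts a) (gam r (P^~ y) y) u + (t - t^-1) * gam r (P^~ y) y u.
    rewrite -[LHS]/(bq _ u) (bq_qmul _ _ uW) -(qmul_bts _ aP uW).
    by apply: qmul_ext => // w wW; exact: g4.
  rewrite -addrA -mulrDl; congr (_ + _ * _).
  have -> : r^-1 = (t^-1 - t) + r by rewrite -rt subrK.
  by rewrite addrA -[t^-1 - t]opprB subrr add0r.
rewrite (hom_sum _ _ _ bar_hom) big_seq_cond [RHS]big_seq_cond.
apply: eq_bigr => z /andP[/Wmem zW /andP[/andP[/pbP bz zy] _]].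
rewrite (homM bar_hom) (homz bar_hom); have lz := zP zW bz zy.
have [|_ _ _ gz] := IHP zW; first by rewrite lv; apply: ltnW.
by rewrite gz.
Qed.

End Step.

(** * Existence of the Kazhdan-Lusztig polynomials and descents of gamma *)

Definition KLrec (P : G -> G -> {poly int}) : Prop :=
  (forall x, inW x -> P x one = (x == one)%:R) /\
  (forall v a x, inW v -> a \in Pi -> (len (mul (s a) v) < len v)%N -> inW x ->
     P x v = rhs P v a x).

Lemma good_exists v : inW v -> exists P, good v P.
Proof.
have [k] := ubnP (len v); elim: k v => // k IH v; rewrite ltnS => lk vW.
have [->|v1] := eqVneq v one; first by exists (fun x => (x == one)%:R); exact: good_one.
have [a aP lt] := descl vW v1.
pose P z := epsilon (inhabits (fun _ => 0)) (good z).
exists (rhs (fun x z => P z x) v a); apply: (@rhs_good (fun x z => P z x)) => // z zW lz.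
exact: (epsilon_spec (inhabits (fun _ => 0)) (good z) (IH z (leq_trans lz lk) zW)).
Qed.

Definition KLe := epsilon (inhabits (fun _ _ => 0)) KLrec.

Lemma KLrec_exists : exists P, KLrec P.
Proof.
pose P z := epsilon (inhabits (fun _ => 0)) (good z).
have gP z (zW : inW z) : good z (P z) := epsilon_spec (inhabits (fun _ =>
  0)) (good z) (good_exists zW).
exists (fun x z => P z x); split.
  move=> x xW.
  exact: (good_uniq (gP _ inW1) (@good_one (fun x => (x == one)%:R) (fun _ _ => erefl)) xW).
move=> v a x vW aP lt xW; apply: (good_uniq (gP _ vW) _ xW).
by apply: (@rhs_good (fun x z => P z x)) => // z zW _; exact: gP.
Qed.

Lemma KLe_rec : KLrec KLe.
Proof. exact: epsilon_spec KLrec_exists. Qed.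

(** The chosen [KLe] is known only through the recursion, so the characterisation is carried along
    it by induction on the length. *)
Lemma KLe_good v : inW v -> good v (KLe^~ v).
Proof.
have [k1 k2] := KLe_rec.
have [k] := ubnP (len v); elim: k v => // k IH v; rewrite ltnS => lk vW.
have [->|v1] := eqVneq v one; first exact: good_one.
have [a aP lt] := descl vW v1.
apply: (@good_ext v (rhs KLe v a)) => //; first by move=> x xW; rewrite -(k2 v a x).
by apply: rhs_good => // z zW lz; apply: IH => //; apply: leq_trans lk.
Qed.

Notation gp v := (gam t (KLe^~ v) v).
Notation gm v := (gam (- t^-1) (KLe^~ v) v).

(** The leading term of the recursion is handled by (tau_s - t^-1)(tau_s + t) = 0; the subtracted
    terms x all satisfy sx < x and are eigenvectors by induction. *)
Lemma gam_eigen z a u : inW z -> a \in Pi -> (len (mul (s a) z) < len z)%N -> inW u ->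
  qmul (ts a) (gp z) u = t^-1 * gp z u.
Proof.
have [k1 k2] := KLe_rec.
have [k] := ubnP (len z); elim: k z u => // k IH z u; rewrite ltnS => lk zW aP lt uW.
have yW := insW zW aP; set y := mul (s a) z in lt yW.
have E w : inW w -> gp z w = (qmul (ts a) (gp y) w + t * gp y w) +
    (-1) * (\sum_(x <- W | pb (bru x y) && (x != y) && (len (mul (s a) x) < len x)%N)
       (gmu KLe x y)%:~R * gp x w).
  move=> wW; rewrite mulN1r -(@rhs_gam KLe z a zW aP lt t w param_t wW).
  by apply: gam_ext => x xW; rewrite (k2 z a x).
rewrite E // (qmul_ext (fun w _ => erefl (ts a w)) E uW) qmul_linr //; last first.
  by move=> w wW; rewrite -[- 1]sub0r (homB (act_hom wW)) (hom0 (act_hom wW)) (hom1 (act_hom wW)).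
rewrite mulrDr; congr (_ + _).
  rewrite qmul_linr // (tsl_quad _ aP uW).
  move: (qmul _ _ u) (gp y u) => A B; by field.
rewrite [RHS]mulrCA; congr (_ * _).
transitivity (qmul (ts a) (fun w =>
  \sum_(x <- [seq x <- W | pb (bru x y) && (x != y) && (len (mul (s a) x) < len x)%N])
       (gmu KLe x y)%:~R * gp x w) u).
  by apply: qmul_ext => // w wW; rewrite big_filter.
rewrite qmul_sumr //; last by move=> w x wW; rewrite (homz (act_hom wW)).
rewrite big_filter mulr_sumr big_seq_cond [RHS]big_seq_cond.
apply: eq_bigr => x /andP[/Wmem xW /andP[/andP[/pbP bx xy] lx]].
rewrite IH // 1?mulrCA //.
have lxy : (len x < len y)%N by case: (bru_len bx) => // e; rewrite e eqxx in xy.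
by apply: leq_trans (ltn_trans lxy lt) lk.
Qed.

(** Since tau_s - t^-1 equals the nonzero scalar [av (s a) a] times delta_s - 1, the eigenvector
    equation is invariance under delta_s. *)
Lemma gam_inv z a u : inW z -> a \in Pi -> (len (mul (s a) z) < len z)%N -> inW u ->
  gp z (mul (s a) u) = act (s a) (gp z u).
Proof.
move=> zW aP lt uW; have aW := sW aP.
have suW := insW uW aP; have := gam_eigen zW aP lt suW; rewrite qmul_tsl // sKg //.
have := av_s inW1 aP; rewrite mul1g => E.
have := av_neq0 aW aP; rewrite E; move: (av one a) (gp z _) (act _ _) => A B C n H.
apply: (mulfI n); apply/eqP; rewrite -subr_eq0; apply/eqP.
transitivity (- ((A - t) * B + (t + t^-1 - A) * C - t^-1 * B)); first by ring.
by rewrite H subrr oppr0.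
Qed.

(** * Duality at the longest element *)

Variable w0 : G.
Hypothesis w0W : inW w0.
Hypothesis w0_max : forall u, inW u -> (len u <= len w0)%N.
Hypothesis w0_down : forall x y a, inW x -> inW y -> a \in Pi -> mul x y = w0 ->
  (len y < len (mul (s a) y))%N -> (len (mul x (s a)) < len x)%N.

Lemma tau_w0 w : inW w -> tauG w w0 = (w == w0)%:R * tauG w0 w0.
Proof.
move=> wW; case: eqP => [->|n]; first by rewrite mul1r.
have [->|nz] := eqVneq (tauG w w0) 0; first by rewrite mul0r.
case: (tau_supp wW w0W nz) => [e|lt]; first by case: n.
by have := w0_max wW; rewrite leqNgt lt.
Qed.

(** Letters move from the left end of y to the right end of x, because bar(tau_s) inverts tau_s. If
    xs < x, the product tau_x bar(tau_s) is tau_{xs}; otherwise a multiple of tau_x is added, and it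
    contributes nothing: x y' = w0 with y' < s y' would force xs < x. *)
Lemma tau_dual x y : inW x -> inW y ->
  qmul (tauG x) (bq (tauG y)) w0 = (mul x y == w0)%:R * tauG w0 w0.
Proof.
have [k] := ubnP (len y); elim: k x y => // k IH x y; rewrite ltnS => lk xW yW.
have [y1|y1] := eqVneq y one.
  rewrite y1 mulg1 -tau_w0 // -(qmul1r (tauG x) w0W); apply: qmul_ext => // u uW.
  by rewrite /bq tau_one // /dl (homn bar_hom).
have [a aP lt] := descl yW y1; have yW' := insW yW aP; set y' := mul (s a) y in lt yW'.
have sy' : mul (s a) y' = y by rewrite sKg.
have up : (len (mul (s a) y') < len y')%N = false by rewrite sy' ltnNge ltnW.
have E : bq (tauG y) =W qmul (bq (ts a)) (bq (tauG y')).
  move=> u uW; rewrite -bq_qmul // /bq -[y in LHS]sy'; congr bar; exact: tau_l.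
rewrite (qmul_ext (fun u _ => erefl (tauG x u)) E w0W) qmulA //.
rewrite (qmul_ext (qmul_btsr (tauG x) aP) (fun u _ => erefl (bq (tauG y') u)) w0W).
have xaW := inWs xW aP; have xa : mul (mul x (s a)) y' = mul x y by rewrite -mulA sy'.
have lk' : (len y' < k)%N by apply: leq_trans lk.
case dn: (len (mul x (s a)) < len x)%N.
  transitivity (qmul (tauG (mul x (s a))) (bq (tauG y')) w0); last by rewrite IH // xa.
  apply: qmul_ext => // u uW; rewrite (tau_r_down xW aP dn uW) -addrA -mulrDl.
  by rewrite -[t - t^-1]opprB subrr mul0r addr0.
transitivity (qmul (fun u => tauG (mul x (s a)) u + (t - t^-1) * tauG x u) (bq (tauG y')) w0).
  by apply: qmul_ext => // u uW; rewrite (tau_r xW aP dn uW).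
rewrite qmul_linl // !IH // xa; suff -> : (mul x y' == w0) = false by rewrite mul0r mulr0 addr0.
apply/eqP => e; have := w0_down xW yW' aP e; rewrite sy' dn => H.
by have := H lt.
Qed.

Lemma bq_gam r v : param r -> inW v -> gam r (KLe^~ v) v =W bq (gam r (KLe^~ v) v).
Proof.
by move=> rP vW u uW; rewrite /bq; have [_ _ _ ->] := KLe_good vW.
Qed.

(* c lies in k + t^-1 Z[t^-1]. *)
Definition polyV (k : int) (c : Q) := exists2 p : {poly int}, p`_0 = k & c = evp p t^-1.

Lemma polyV0 : polyV 0 0. Proof. by exists 0; rewrite ?coef0 ?evp0. Qed.
Lemma polyVD k l c d : polyV k c -> polyV l d -> polyV (k + l) (c + d).
Proof. by case=> p <- -> [q <- ->]; exists (p + q); rewrite ?coefD ?evpD. Qed.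
Lemma polyVM k l c d : polyV k c -> polyV l d -> polyV (k * l) (c * d).
Proof. by case=> p <- -> [q <- ->]; exists (p * q); rewrite ?coef0M ?evpM. Qed.

Lemma polyV_bar k c : polyV k c -> bar c = c -> c = k%:~R.
Proof.
case=> p <- ->; rewrite (hom_evp _ _ bar_hom) (homV bar_hom) bar_t invrK.
by move/(evp_sym t0 evp_inj) ->; rewrite coefC evpC.
Qed.

Lemma cf_m v x : inW v -> inW x -> polyV (x == v)%:R (cf (- t^-1) (KLe^~ v) v x).
Proof.
move=> vW xW; have [g1 g2 g3 _] := KLe_good vW.
have [r0 _ _ _] := param_mtV.
have [->|xv] := eqVneq x v.
  by exists 1; rewrite ?coef1 // /cf g1 !evp1 divff ?mulr1 // expf_neq0.
have [z|/eqP nz] := eqVneq (KLe x v) 0.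
  by rewrite /cf z evp0 mulr0; exact: polyV0.
have [|q [q0 _ ->]] := @cf_bound (- t^-1) (KLe^~ v) v x r0 nz; first by move=> i; exact: g3.
by have [q' q0' ->] := evp_neg q t^-1; exists q'; rewrite // q0' q0.
Qed.

Lemma cf_p v x : inW v -> inW x -> polyV (x == v)%:R (bar (cf t (KLe^~ v) v x)).
Proof.
move=> vW xW; have [g1 g2 g3 _] := KLe_good vW.
have [->|xv] := eqVneq x v.
  exists 1; rewrite ?coef1 // /cf g1 !evp1 divff ?mulr1 ?(hom1 bar_hom) // expf_neq0 //.
have [z|/eqP nz] := eqVneq (KLe x v) 0.
  by rewrite /cf z evp0 mulr0 (hom0 bar_hom); exact: polyV0.
have [|q [q0 _ ->]] := @cf_bound t (KLe^~ v) v x t0 nz; first by move=> i; exact: g3.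
by exists q; rewrite // (hom_evp _ _ bar_hom) bar_t.
Qed.

Lemma gam_dual w v : inW w -> inW v ->
  qmul (gm w) (gp (mul (inv v) w0)) w0 = (w == v)%:R * tauG w0 w0.
Proof.
move=> wW vW; have zW := inWM (inWV vW) w0W; set z := mul (inv v) w0.
have [r0 _ _ ar] := param_mtV.
pose c x := cf (- t^-1) (KLe^~ w) w x; pose d y := cf t (KLe^~ z) z y.
have cw x : inW x -> forall u, inW u -> act u (c x) = c x.
  by move=> _ u uW; apply: cf_act => //; exact: param_mtV.
pose p := \sum_(x <- W) c x * bar (d (mul (inv x) w0)).
have E : qmul (gm w) (gp z) w0 = p * tauG w0 w0.
  rewrite (qmul_ext (fun u _ => erefl (gm w u)) (bq_gam param_t zW) w0W).
  rewrite qmul_suml // /p mulr_suml; apply: sumW_eq => x xW.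
  rewrite -mulrA; congr (_ * _).
  transitivity (qmul (tauG x) (fun u => \sum_(y <- W) bar (d y) * bq (tauG y) u) w0).
    apply: qmul_ext => // u uW; rewrite /bq /gam (hom_sum _ _ _ bar_hom).
    by apply: eq_bigr => y _; rewrite (homM bar_hom).
  rewrite qmul_sumr //; last by move=> u y uW; rewrite -bar_act // cf_act //; exact: param_t.
  have xzW := inWM (inWV xW) w0W.
  rewrite (sumW_one xzW) => [|y yW ny].
    by rewrite tau_dual // tmulKVg // eqxx mul1r.
  rewrite tau_dual //; have -> : (mul x y == w0) = false; last by rewrite mul0r mulr0.
  by apply: contraNF ny => /eqP <-; rewrite tmulKg.
have [k0 kb] := tau_diag w0W.
have posb : bar p = p.
  apply: (mulIf k0); rewrite -{1}kb -(homM bar_hom) -E -[LHS]/(bq _ w0) bq_qmul //.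
  by apply: (qmul_ext _ _ w0W) => u uW; symmetry;
    [exact: (bq_gam param_mtV wW uW)|exact: (bq_gam param_t zW uW)].
have pV : polyV (w == v)%:R p.
  have -> : (w == v)%:R = \sum_(x <- W) (x == w)%:R * (mul (inv x) w0 == z)%:R :> int.
    rewrite (sumW_one wW) => [|x _ /negPf->]; last by rewrite mul0r.
    rewrite eqxx mul1r; congr ((nat_of_bool _)%:R); apply/eqP/eqP => [->//|e].
    have := congr1 (fun g => mul g (inv w0)) e; rewrite /= !tmulgK // => e'.
    by rewrite -[w]mulg1 -(mulVg vW) -e' tmulKVg.
  rewrite /p; have : {subset W <= W} by [].
  (* The list is generalised only where it is summed over, so membership in the full W remains
     available in the induction. *)
  elim: {1 3 4}W => [|x r IHr] S; first by rewrite !big_nil; exact: polyV0.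
  have xW : inW x by apply/Wmem/S; rewrite mem_head.
  rewrite !big_cons; apply: polyVD; last by apply: IHr => g gr; apply: S; rewrite inE gr orbT.
  by apply: polyVM; [exact: cf_m|apply: cf_p => //; apply: inWM => //; exact: inWV].
by rewrite E (polyV_bar pV posb) natz -pmulrn; case: eqP.
Qed.

(** Bundles the consequences for the abstract group, so that its hypotheses are verified for the
    Weyl group only once. *)
Lemma hecke_main :
  [/\ forall w v, inW w -> inW v ->
        qmul (gm w) (gp (mul (inv v) w0)) w0 = (w == v)%:R * tauG w0 w0,
      forall z a u, inW z -> a \in Pi -> (len (mul (s a) z) < len z)%N -> inW u ->
        gp z (mul (s a) u) = act (s a) (gp z u),
      tauG one one = 1,
      forall w a, inW w -> a \in Pi -> (len (mul w (s a)) < len w)%N = false ->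
        tauG (mul w (s a)) (mul w (s a)) = tauG w w * av (mul w (s a)) a &
      forall x v, inW x -> inW v -> KLe x v <> 0 -> bru x v].
Proof.
split; [exact: gam_dual|exact: gam_inv| |exact: tau_diag_step|].
  by rewrite (tau_one inW1) /dl eqxx.
by move=> x v xW vW; have [_ g2 _ _] := KLe_good vW; exact: g2.
Qed.

End TwistedGroupAlgebra.

(** * Root data *)

Section Pairing.
Variable n : nat.
Implicit Types (l k c d : 'cV[int]_n).

Lemma pairingDl l k c : pairing (l + k) c = pairing l c + pairing k c.
Proof. by rewrite /pairing mulmxDr mxE. Qed.
Lemma pairingZl z l c : pairing (z *: l) c = z * pairing l c.
Proof. by rewrite /pairing -scalemxAr mxE. Qed.
Lemma pairing0l c : pairing 0 c = 0.
Proof. by rewrite /pairing mulmx0 mxE. Qed.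
Lemma pairingC l c : pairing l c = pairing c l.
Proof. by rewrite /pairing -[_ *m _]trmxK trmx_mul trmxK mxE. Qed.
Lemma pairingDr l c d : pairing l (c + d) = pairing l c + pairing l d.
Proof. by rewrite pairingC pairingDl !(pairingC l). Qed.
Lemma pairingZr z l c : pairing l (z *: c) = z * pairing l c.
Proof. by rewrite pairingC pairingZl (pairingC l). Qed.

Lemma pairing_sep l k : (forall c, pairing l c = pairing k c) -> l = k.
Proof.
move=> H; apply/colP => i; have := H (delta_mx i 0).
by rewrite /pairing !trmx_delta -!rowE !mxE.
Qed.

Lemma refl_rootE a c l : refl_root a c *m l = l - pairing l c *: a.
Proof.
rewrite /refl_root mulmxBl mul1mx -mulmxA; congr (_ - _).
by rewrite [c^T *m l]mx11_scalar mul_mx_scalar.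
Qed.

Lemma refl_corootE a c d : refl_coroot a c *m d = d - pairing a d *: c.
Proof. by rewrite pairingC; exact: refl_rootE. Qed.

Lemma pairing_refl a c l d : pairing (refl_root a c *m l) d = pairing l (refl_coroot a c *m d).
Proof.
rewrite refl_rootE refl_corootE pairingDl pairingDr -!scaleNr pairingZl pairingZr.
by rewrite mulrC mulrN mulNr mulrC.
Qed.

Lemma scalez_inj (z : int) l k : z != 0 -> z *: l = z *: k -> l = k.
Proof.
by move=> z0 /colP E; apply/colP => i; have := E i; rewrite !mxE => /(mulfI z0).
Qed.

End Pairing.

Section RootSystem.
Variable n : nat.
Variable R : seq ('cV[int]_n * 'cV[int]_n).
Variable Pi : seq 'cV[int]_n.
Hypothesis HR : is_root_datum R.
Hypothesis HB : is_base R Pi.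
Implicit Types (a b c d l : 'cV[int]_n) (u v w x y z : 'M[int]_n) (ws : seq 'cV[int]_n).

Notation roots := (Defs.roots R).
Notation coroot := (Defs.coroot R).
Notation refl := (Defs.refl R).
Notation corefl a := (refl_coroot a (coroot a)).

Lemma coroot_in a : a \in roots -> (a, coroot a) \in R.
Proof.
move=> aR; have lt : (index a roots < size R)%N by rewrite -(size_map fst) index_mem.
have -> : (a, coroot a) = nth (0, 0) R (index a roots); last exact: mem_nth.
rewrite [RHS]surjective_pairing; congr (_, _).
  by rewrite -(nth_map _ 0) // nth_index.
by rewrite /coroot (nth_map (0, 0)).
Qed.

Lemma coroot_mem a : a \in roots -> coroot a \in unzip2 R.
Proof. by move/coroot_in => H; apply/mapP; exists (a, coroot a). Qed.

Lemma coroot_surj c : c \in unzip2 R -> exists2 a, a \in roots & coroot a = c.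
Proof.
case/mapP => -[a c'] acR /= ->; have aR : a \in roots by apply/mapP; exists (a, c').
exists a => //; have [U1 _] := HR; have H := coroot_in aR.
have i1 := acR; move: (acR) (H); rewrite -!index_mem => l1 l2.
have e1 := nth_index (0, 0) acR; have e2 := nth_index (0, 0) H.
suff E : index (a, c') R = index (a, coroot a) R by move: e1; rewrite E e2 => -[].
have m1 := nth_map (0, 0) 0 fst l1; have m2 := nth_map (0, 0) 0 fst l2.
apply/eqP; rewrite -(nth_uniq 0 _ _ U1) ?size_map //.
by rewrite /unzip1 m1 m2 e1 e2.
Qed.

Lemma pairing2 a : a \in roots -> pairing a (coroot a) = 2.
Proof. by move/coroot_in; have [_ [_ [H _]]] := HR; apply: H. Qed.

Lemma reflE a l : refl a *m l = l - pairing l (coroot a) *: a.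
Proof. exact: refl_rootE. Qed.

Lemma refl_self a : a \in roots -> refl a *m a = - a.
Proof.
by move=> aR; rewrite reflE pairing2 // -{1}[a]scale1r -scalerBl -scaleN1r.
Qed.

Lemma reflK a : a \in roots -> refl a *m refl a = 1%:M.
Proof.
move=> aR; rewrite {1}/refl /refl_root mulmxBl mul1mx.
suff -> : a *m (coroot a)^T *m refl a = - (a *m (coroot a)^T) by rewrite opprK subrK.
rewrite /refl /refl_root mulmxBr mulmx1 -mulmxA [(coroot a)^T *m _]mulmxA.
rewrite [(coroot a)^T *m a]mx11_scalar.
have -> : ((coroot a)^T *m a) 0 0 = 2 by rewrite -[LHS]/(pairing a (coroot a)) pairing2.
by rewrite mul_scalar_mx -scalemxAr -{1}[a *m _]scale1r -scalerBl -scaleN1r.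
Qed.

Lemma mulKr a p (x : 'M[int]_(n, p)) : a \in roots -> refl a *m (refl a *m x) = x.
Proof. by move=> aR; rewrite mulmxA reflK // mul1mx. Qed.
Lemma mulrK_refl a p (x : 'M[int]_(p, n)) : a \in roots -> x *m refl a *m refl a = x.
Proof. by move=> aR; rewrite -mulmxA reflK // mulmx1. Qed.

Lemma refl_root_in a b : a \in roots -> b \in roots -> refl a *m b \in roots.
Proof. by move=> aR bR; have [_ [_ [_ [H _]]]] := HR; apply: H => //; exact: coroot_in. Qed.

Lemma corefl_in a d : a \in roots -> d \in unzip2 R -> corefl a *m d \in unzip2 R.
Proof. by move=> aR dR; have [_ [_ [_ [_ [H _]]]]] := HR; apply: H => //; exact: coroot_in. Qed.

Lemma root_opp a : a \in roots -> - a \in roots.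
Proof. by move=> aR; rewrite -refl_self // refl_root_in. Qed.

Lemma root_oppE a : (- a \in roots) = (a \in roots).
Proof. by apply/idP/idP => /root_opp; rewrite ?opprK. Qed.

Lemma root_neq0 a : a \in roots -> a != 0.
Proof.
by move=> aR; apply/eqP => a0; have := pairing2 aR; rewrite a0 pairing0l.
Qed.

(* This W-invariant form recovers a root from its coroot (cnorm_root), so the bijection between
   roots and coroots commutes with W. *)
Definition cform c d : int := \sum_(b <- roots) pairing b c * pairing b d.
Definition cdual c : 'cV[int]_n := \sum_(b <- roots) pairing b c *: b.

Lemma cform_dual c d : cform c d = pairing (cdual c) d.
Proof.
rewrite /cform /cdual (big_morph (fun l => pairing l d) (fun l k => pairingDl l k d) (pairing0l d)).
by apply: eq_bigr => b _; rewrite pairingZl.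
Qed.

Lemma perm_refl a : a \in roots -> perm_eq [seq refl a *m b | b <- roots] roots.
Proof.
have [U1 _] := HR => aR; apply: uniq_perm => //.
  rewrite map_inj_uniq // => x y E.
  by rewrite -(mulKr x aR) E mulKr.
move=> b; apply/mapP/idP => [[b' b'R ->]|bR]; first exact: refl_root_in.
by exists (refl a *m b); rewrite ?mulKr // refl_root_in.
Qed.

Lemma cdual_corefl a c : a \in roots -> cdual (corefl a *m c) = refl a *m cdual c.
Proof.
move=> aR; rewrite /cdual -(perm_big _ (perm_refl aR)) big_map mulmx_sumr /=.
apply: eq_bigr => b _; rewrite -pairing_refl mulKr //.
by rewrite -scalemxAr.
Qed.

Lemma cform_corefl a c d : a \in roots ->
  cform (corefl a *m c) (corefl a *m d) = cform c d.
Proof. by move=> aR; rewrite !cform_dual cdual_corefl // -pairing_refl mulKr. Qed.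

Lemma cformC c d : cform c d = cform d c.
Proof. by apply: eq_bigr => b _; rewrite mulrC. Qed.
Lemma cformDl c c' d : cform (c + c') d = cform c d + cform c' d.
Proof. by rewrite -big_split; apply: eq_bigr => b _; rewrite pairingDr mulrDl. Qed.
Lemma cformZl (z : int) c d : cform (z *: c) d = z * cform c d.
Proof. by rewrite mulr_sumr; apply: eq_bigr => b _; rewrite pairingZr mulrA. Qed.
Lemma cform_ge0 c : 0 <= cform c c.
Proof. by apply: sumr_ge0 => b _; rewrite -expr2 sqr_ge0. Qed.

Lemma cform_eq0 c b : cform c c = 0 -> b \in roots -> pairing b c = 0.
Proof.
move=> /eqP; rewrite psumr_eq0 => [/allP H bR|b' _]; last by rewrite -expr2 sqr_ge0.
by have := H _ bR; rewrite /= -expr2 sqrf_eq0 => /eqP.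
Qed.

Definition cnorm a := cform (coroot a) (coroot a).

Lemma cnorm_gt0 a : a \in roots -> 0 < cnorm a.
Proof.
move=> aR; rewrite lt0r cform_ge0 andbT; apply/eqP => E.
by have := cform_eq0 E aR; rewrite pairing2.
Qed.

(** Compare the form at (a^v, d) before and after s_a, which negates a^v and subtracts <a,d> a^v
    from d. *)
Lemma cform_coroot a d : a \in roots -> 2 * cform (coroot a) d = cnorm a * pairing a d.
Proof.
move=> aR; have := cform_corefl (coroot a) d aR.
rewrite !refl_corootE pairing2 //.
have -> : coroot a - 2 *: coroot a = - 1 *: coroot a.
  by rewrite -{1}[coroot a]scale1r -scalerBl.
rewrite cformZl -scaleNr cformC cformDl cformZl !(cformC _ (coroot a)) /cnorm; lia.
Qed.

Lemma cnorm_root a : a \in roots -> cnorm a *: a = 2 *: cdual (coroot a).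
Proof.
move=> aR; apply: pairing_sep => d.
by rewrite !pairingZl -cform_dual cform_coroot.
Qed.

Lemma pairing_cnorm a b : a \in roots -> b \in roots ->
  cnorm a * pairing a (coroot b) = cnorm b * pairing b (coroot a).
Proof. by move=> aR bR; rewrite -(cform_coroot _ aR) -(cform_coroot _ bR) cformC. Qed.

(** The root b' whose coroot is s_a(b^v) has the same norm as b, and [cnorm_root] then identifies b'
    with s_a b. *)
Lemma coroot_refl a b : a \in roots -> b \in roots ->
  coroot (refl a *m b) = corefl a *m coroot b.
Proof.
move=> aR bR; have [b' b'R E] := coroot_surj (corefl_in aR (coroot_mem bR)).
have NE : cnorm b' = cnorm b by rewrite /cnorm E cform_corefl.
have := cnorm_root b'R; rewrite E cdual_corefl // scalemxAr -cnorm_root // -scalemxAr NE.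
have Nn : cnorm b != 0 by rewrite gt_eqF // cnorm_gt0.
by move/(scalez_inj Nn) <-; rewrite E.
Qed.

Lemma refl_conj a b : a \in roots -> b \in roots ->
  refl (refl a *m b) = refl a *m refl b *m refl a.
Proof.
move=> aR bR.
have -> : refl (refl a *m b) = refl_root (refl a *m b) (corefl a *m coroot b).
  by rewrite -coroot_refl.
rewrite {1}/refl_root trmx_mul.
have -> : (corefl a)^T = refl a.
  by rewrite /refl_coroot linearB /= trmx1 trmx_mul trmxK.
have -> : refl b = 1%:M - b *m (coroot b)^T by [].
by rewrite (mulmxBr (refl a)) mulmx1 (mulmxBl (refl a) _ (refl a)) reflK // !mulmxA.
Qed.

Lemma refl_opp a : a \in roots -> refl (- a) = refl a.
Proof. by move=> aR; rewrite -(refl_self aR) refl_conj // (reflK aR) mul1mx. Qed.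

Local Opaque Defs.refl Defs.coroot.
Lemma Pi_roots : {subset Pi <= roots}. Proof. by have [_ []] := HB. Qed.
Hint Resolve Pi_roots : core.

(** * Positive and simple roots *)

Definition icomb (c : nat -> int) : 'cV[int]_n := \sum_(i < size Pi) c i *: Pi`_i.

Lemma icombD (c d : nat -> int) : icomb c + icomb d = icomb (fun i => c i + d i).
Proof. by rewrite -big_split; apply: eq_bigr => i _; rewrite scalerDl. Qed.
Lemma icombN (c : nat -> int) : - icomb c = icomb (fun i => - c i).
Proof. by rewrite -sumrN; apply: eq_bigr => i _; rewrite scaleNr. Qed.
Lemma icombZ (z : int) (c : nat -> int) : z *: icomb c = icomb (fun i => z * c i).
Proof. by rewrite scaler_sumr; apply: eq_bigr => i _; rewrite scalerA. Qed.
Lemma icomb_eq0 (c : nat -> int) : icomb c = 0 -> forall i, (i < size Pi)%N -> c i = 0.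
Proof. by have [_ [_ [H _]]] := HB; apply: H. Qed.
Lemma icomb_simple a : a \in Pi -> a = icomb (fun i => (i == index a Pi)%:Z).
Proof.
move=> aP; have lt : (index a Pi < size Pi)%N by rewrite index_mem.
rewrite /icomb (bigD1 (Ordinal lt)) //= eqxx scale1r nth_index // big1 ?addr0 // => i.
by rewrite -val_eqE /= => /negPf ->; rewrite scale0r.
Qed.

Lemma nonneg_opp b : nonneg_comb Pi b -> nonneg_comb Pi (- b) -> b = 0.
Proof.
case=> c [c0 ->] [d [d0 E]].
have /icomb_eq0 H : icomb (fun i => c i + d i) = 0.
  by rewrite -icombD -[icomb d]/(\sum_(i < size Pi) d i *: Pi`_i) -E subrr.
rewrite big1 // => i _; have := H i (ltn_ord i); have := c0 i; have := d0 i => ? ? ?.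
have -> : c i = 0 by lia.
by rewrite scale0r.
Qed.

Lemma pos_rootP b : reflect (b \in roots /\ nonneg_comb Pi b) (pos_root R Pi b).
Proof. exact: pbP. Qed.
Lemma neg_rootP b : reflect (b \in roots /\ nonneg_comb Pi (- b)) (neg_root R Pi b).
Proof. exact: pbP. Qed.

Notation pos := (pos_root R Pi).
Notation neg := (neg_root R Pi).

Lemma pos_in b : pos b -> b \in roots. Proof. by case/pos_rootP. Qed.
Lemma negE b : b \in roots -> neg b = ~~ pos b.
Proof.
move=> bR; apply/neg_rootP/idP => [[_ nb]|nb].
  apply/pos_rootP => -[_ posb]; have := root_neq0 bR; by rewrite (nonneg_opp posb nb) eqxx.
split=> //; have [_ [_ [_ H]]] := HB; case: (H b bR) => // posb.
by case/pos_rootP: nb.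
Qed.

Lemma pos_opp b : pos (- b) = neg b.
Proof. by apply/pos_rootP/neg_rootP; rewrite root_oppE. Qed.
Lemma neg_opp b : neg (- b) = pos b.
Proof. by rewrite -pos_opp opprK. Qed.

Lemma simple_pos a : a \in Pi -> pos a.
Proof.
move=> aP; apply/pos_rootP; split; first exact: Pi_roots.
by exists (fun i => (i == index a Pi)%:Z); split; [move=> i; lia|exact: icomb_simple].
Qed.

(** From k <a, b^v> = <b, b^v> = 2 only k = 1 and k = 2 remain, and reducedness excludes 2. *)
Lemma root_multiple b a (k : int) : b \in roots -> a \in roots -> b = k *: a -> 0 <= k -> b = a.
Proof.
move=> bR aR E k0.
have H : k * pairing a (coroot b) = 2 by rewrite -pairingZl -E pairing2.
have [k1|k2] : k = 1 \/ k = 2.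
  move: H; set z := pairing a _ => H.
  have z0 : 0 < z by rewrite ltNge; apply/negP => z0; have := mulr_ge0_le0 k0 z0; lia.
  have k2 : k <= 2 by rewrite -H ler_peMr //; lia.
  have [k3|k3] : k = 0 \/ 0 < k by lia.
    by move: H; rewrite k3 mul0r.
  lia.
  by rewrite E k1 scale1r.
have [_ [_ [_ [_ [_ H']]]]] := HR; have := H' _ aR.
have -> : 2%:Z *: a = b by rewrite E k2.
by rewrite bR.
Qed.

(** The reflection changes only the coordinate of b at a. If s_a b were negative, all other
    coordinates of b would vanish and b would be a multiple of a. *)
Lemma simple_perm a b : a \in Pi -> pos b -> b != a -> pos (refl a *m b).
Proof.
move=> aP posb ba; have bR := pos_in posb; have aR := Pi_roots aP.
apply/negPn; rewrite -negE ?refl_root_in //; apply/negP => /neg_rootP[_ [d [d0 E]]].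
case/pos_rootP: (posb) => _ [c [c0 Ec]].
set k := pairing b (coroot a) in E; rewrite reflE in E.
have : icomb (fun i => c i + d i + (- k) * (i == index a Pi)%:Z) = 0.
  rewrite -!icombD -icombZ -icomb_simple // -[icomb d]E -[icomb c]Ec scaleNr.
  by rewrite opprB addrCA subrr addr0 subrr.
move/icomb_eq0 => H; case/eqP: ba.
have ia : (index a Pi < size Pi)%N by rewrite index_mem.
apply: (@root_multiple _ _ (c (index a Pi))) => //.
rewrite Ec (bigD1 (Ordinal ia)) //= nth_index // big1 ?addr0 // => i.
rewrite -val_eqE /= => /negPf ni; have := H i (ltn_ord i); rewrite ni mulr0 addr0.
have := c0 i; have := d0 i => ? ? ?; have -> : c i = 0 by lia.
by rewrite scale0r.
Qed.

Lemma icomb_inj (c d : nat -> int) : icomb c = icomb d -> forall i, (i < size Pi)%N -> c i = d i.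
Proof.
move=> E i lt; apply/eqP; rewrite -subr_eq0; apply/eqP.
by apply: (@icomb_eq0 (fun i => c i - d i)) => //; rewrite -icombD -icombN E subrr.
Qed.

Notation word := (word_prod R).

Lemma word_cat ws ws' : word (ws ++ ws') = word ws *m word ws'.
Proof. by elim: ws => [|a ws IH] /=; rewrite ?mul1mx // IH mulmxA. Qed.

Lemma word_rcons ws a : word (rcons ws a) = word ws *m refl a.
Proof. by rewrite -cats1 word_cat /= mulmx1. Qed.

Lemma word_rev ws : {subset ws <= roots} -> word ws *m word (rev ws) = 1%:M.
Proof.
elim: ws => [|a ws IH] S; first by rewrite mul1mx.
rewrite rev_cons word_rcons /= mulmxA -(mulmxA (refl a)) IH ?mulmx1 ?reflK //.
  by apply: S; rewrite mem_head.
by move=> b bw; apply: S; rewrite inE bw orbT.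
Qed.

(** As <b, b^v> = 2 is positive, some simple root a in the support of b has <a, b^v> > 0. Then <b,
    a^v> > 0 by [pairing_cnorm], and s_a lowers the height by this number. *)
Lemma simple_conj_height (h : nat) b (c : nat -> int) :
  pos b -> (forall i, 0 <= c i) -> b = icomb c -> \sum_(i < size Pi) c i <= h%:Z ->
  exists ws a, {subset ws <= Pi} /\ a \in Pi /\ b = word ws *m a.
Proof.
elim: h b c => [|h IH] b c posb c0 E ch.
  have bR := pos_in posb; case/eqP: (root_neq0 bR).
  have := psumr_eq0P (fun i (_ : xpredT i) => c0 (nat_of_ord i)).
  move=> /(_ _)H; rewrite E; apply: big1 => i _; rewrite H ?scale0r //.
  by apply/eqP; rewrite eq_le ch sumr_ge0.
have bR := pos_in posb.
have [i ci] : exists i : 'I_(size Pi), 0 < pairing Pi`_i (coroot b) /\ 0 < c i.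
  apply: NNPP => N.
  have : pairing b (coroot b) <= 0.
    rewrite {1}E /icomb (big_morph (fun l => pairing l (coroot b))
       (fun l k => pairingDl l k _) (pairing0l _)).
    apply: sumr_le0 => i _; rewrite pairingZl.
    have := c0 i; case: (leP (pairing Pi`_i (coroot b)) 0) => [p0 ?|p0 ?].
      exact: mulr_ge0_le0.
    case: (leP (c i) 0) => [c0'|?]; last by case: N; exists i.
    have -> : c i = 0 by lia.
    by rewrite mul0r.
  by rewrite pairing2.
set a := Pi`_i in ci; have aP : a \in Pi by rewrite mem_nth.
have aR := Pi_roots aP.
have [->|ba] := eqVneq b a; first by exists [::], a; rewrite mul1mx.
have pb2 := simple_perm aP posb ba.
have k0 : 0 < pairing b (coroot a).
  have := pairing_cnorm aR bR; have := cnorm_gt0 aR; have := cnorm_gt0 bR => na nb e.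
  rewrite -(pmulr_rgt0 _ na) -e pmulr_rgt0 //; lia.
have [_ [c' [c0' E']]] := pos_rootP _ pb2.
have [ws [a' [wsP [aP' Ea]]]] : exists ws a',
  {subset ws <= Pi} /\ a' \in Pi /\ refl a *m b = word ws *m a'.
  apply: (IH _ c') => //.
  have H j : (j < size Pi)%N -> c' j = c j - pairing b (coroot a) * (j == index a Pi)%:Z.
    apply: (@icomb_inj c' (fun j => c j - pairing b (coroot a) * (j == index a Pi)%:Z)).
    rewrite -icombD -icombN -icombZ -icomb_simple // -[icomb c']E'.
    by rewrite reflE -E.
  have ia : (index a Pi < size Pi)%N by rewrite index_mem.
  have -> : \sum_(i < size Pi) c' i = \sum_(i < size Pi) c i - pairing b (coroot a).
    under eq_bigr => j _ do rewrite H //.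
    rewrite sumrB; congr (_ - _); rewrite (bigD1 (Ordinal ia)) //= eqxx mulr1 big1 ?addr0 // => j.
    by rewrite -val_eqE /= => /negPf ->; rewrite mulr0.
  lia.
exists (a :: ws), a'; split.
  by move=> x; rewrite inE => /orP[/eqP->|/wsP].
by split=> //=; rewrite -mulmxA -Ea mulKr.
Qed.

Lemma simple_conj b : b \in roots ->
  exists ws a, {subset ws <= Pi} /\ a \in Pi /\ (b = word ws *m a \/ - b = word ws *m a).
Proof.
move=> bR; have H b' : pos b' -> exists ws a, {subset ws <= Pi} /\ a \in Pi /\ b' = word ws *m a.
  move=> posb; have [_ [c [c0 E]]] := pos_rootP _ posb.
  apply: (@simple_conj_height (absz (\sum_(i < size Pi) c i)) _ c) => //.
  by rewrite gez0_abs // sumr_ge0.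
case posb: (pos b).
  by have [ws [a [? [? ?]]]] := H _ posb; exists ws, a; do 2?split=> //; left.
have : pos (- b) by rewrite pos_opp negE // posb.
by case/H=> ws [a [? [? ?]]]; exists ws, a; do 2?split=> //; right.
Qed.

(** * Weyl group and length *)

Notation inW := (in_W R).

Lemma inW1 : inW 1%:M. Proof. by exists [::]. Qed.
Lemma inW_refl a : a \in roots -> inW (refl a).
Proof.
move=> aR; exists [:: a]; split; last by rewrite /= mulmx1.
by move=> x; rewrite inE => /eqP->.
Qed.
Lemma inW_mul u v : inW u -> inW v -> inW (u *m v).
Proof.
case=> ws [S ->] [ws' [S' ->]]; exists (ws ++ ws'); rewrite word_cat; split=> //.
by move=> x; rewrite mem_cat => /orP[/S|/S'].
Qed.
Lemma inW_word ws : {subset ws <= roots} -> inW (word ws).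
Proof. by exists ws. Qed.
Lemma inW_wordPi ws : {subset ws <= Pi} -> inW (word ws).
Proof. by move=> S; apply: inW_word => x /S /Pi_roots. Qed.

Lemma inW_invE w : inW w -> exists2 w', inW w' & w *m w' = 1%:M /\ w' *m w = 1%:M.
Proof.
case=> ws [S ->]; have S' : {subset rev ws <= roots} by move=> x; rewrite mem_rev => /S.
exists (word (rev ws)); first exact: inW_word.
by split; [exact: word_rev|rewrite -{2}[ws]revK; exact: word_rev].
Qed.

Lemma inW_unit w : inW w -> w \in unitmx.
Proof. by case/inW_invE => w' _ [/mulmx1_unit[]]. Qed.

Lemma inW_inv w : inW w -> inW (invmx w).
Proof.
move=> wW; have [w' w'W [E _]] := inW_invE wW; have wU := inW_unit wW.
by rewrite -[invmx w]mulmx1 -E mulKmx.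
Qed.

Lemma inW_root w b : inW w -> b \in roots -> w *m b \in roots.
Proof.
case=> ws [S ->] bR; elim: ws S => [|a ws IH] S /=; first by rewrite mul1mx.
rewrite -mulmxA refl_root_in ?IH //; first by apply: S; rewrite mem_head.
by move=> x xs; apply: S; rewrite inE xs orbT.
Qed.

Lemma refl_W w b : inW w -> b \in roots -> refl (w *m b) *m w = w *m refl b.
Proof.
case=> ws [S ->] bR; elim: ws S => [|a ws IH] S /=; first by rewrite !mul1mx mulmx1.
have aR : a \in roots by apply: S; rewrite mem_head.
have S' : {subset ws <= roots} by move=> x xs; apply: S; rewrite inE xs orbT.
rewrite -mulmxA refl_conj //; last by apply: inW_root => //; exists ws.
by rewrite -(mulmxA _ (refl a)) (mulKr _ aR) -mulmxA (IH S') mulmxA.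
Qed.

Lemma inW_simple w : inW w -> exists ws, {subset ws <= Pi} /\ w = word ws.
Proof.
case=> ws [S ->]; elim: ws S => [|b ws IH] S; first by exists [::].
have bR : b \in roots by apply: S; rewrite mem_head.
have [|vs [vP Ev]] := IH; first by move=> x xs; apply: S; rewrite inE xs orbT.
rewrite -[word (b :: ws)]/(refl b *m word ws) Ev.
have [us [a [uP [aP E]]]] := simple_conj bR.
have uW := inW_wordPi uP; have aR := Pi_roots aP.
have Eb : refl b = refl (word us *m a) by case: E => E; [rewrite -E|rewrite -E (refl_opp bR)].
have uR : {subset us <= roots} by move=> x /uP /Pi_roots.
exists (us ++ a :: rev us ++ vs); split.
  move=> x; rewrite mem_cat inE mem_cat mem_rev => /orP[/uP //|/orP[/eqP-> //|/orP[/uP|/vP] //]].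
rewrite Eb word_cat -[word (a :: _)]/(refl a *m word (rev us ++ vs)) word_cat !mulmxA.
by rewrite -(refl_W uW aR) -[_ *m word us *m _]mulmxA (word_rev uR) mulmx1.
Qed.

Notation len := (len R Pi).

Lemma lenP w : inW w -> is_length R Pi w (len w).
Proof.
move=> wW; apply: epsilon_spec.
pose P k := pb (exists ws, {subset ws <= Pi} /\ w = word ws /\ size ws = k).
have exP : exists k, P k.
  by have [ws [S E]] := inW_simple wW; exists (size ws); apply/pbP; exists ws.
case: (ex_minnP exP) => k /pbP Hk mk; exists k; split=> // ws S E.
by apply: mk; apply/pbP; exists ws.
Qed.

Lemma len_word ws : {subset ws <= Pi} -> (len (word ws) <= size ws)%N.
Proof. by move=> S; have [_ H] := lenP (inW_wordPi S); apply: H. Qed.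

Notation red_word := (red_word R Pi).

Lemma red_wordP w : inW w ->
  {subset red_word w <= Pi} /\ w = word (red_word w) /\ size (red_word w) = len w.
Proof.
move=> wW; have [[ws H] _] := lenP wW.
by apply: (epsilon_spec (inhabits [::]) (fun ws =>
  {subset ws <= Pi} /\ w = word ws /\ size ws = len w));
  exists ws.
Qed.

Lemma len1 : len 1%:M = 0%N.
Proof. by apply/eqP; rewrite -leqn0 -[1%:M]/(word [::]) len_word. Qed.

(** Read the word from the right and follow b until it turns negative. By [simple_perm] it is then
    equal to the simple root of the current letter, and multiplying by s_b deletes that letter. *)
Lemma exchange ws b : {subset ws <= Pi} -> pos b -> neg (word ws *m b) ->
  exists vs, {subset vs <= Pi} /\ word ws *m refl b = word vs /\ (size vs < size ws)%N.
Proof.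
move=> S posb; have bR := pos_in posb; elim: ws S => [|a ws IH] S.
  by rewrite mul1mx negE // posb.
have aP : a \in Pi by apply: S; rewrite mem_head.
have S' : {subset ws <= Pi} by move=> x xs; apply: S; rewrite inE xs orbT.
have aR := Pi_roots aP; have wW := inW_wordPi S'.
have wbR := inW_root wW bR.
case nw : (neg (word ws *m b)) => /=.
  move=> _; have [vs [vS [E lt]]] := IH S' nw.
  exists (a :: vs); split; first by move=> x; rewrite inE => /orP[/eqP->|/vS].
  by split=> //=; rewrite -mulmxA E.
have pw : pos (word ws *m b) by move/negbT: nw; rewrite negE // negbK.
rewrite -mulmxA negE ?refl_root_in //.
have [E _|ne] := eqVneq (word ws *m b) a; last by rewrite simple_perm.
exists ws; split=> //; split=> //.
by rewrite -mulmxA -refl_W // E mulKr.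
Qed.

Lemma len_refl_lt u b : inW u -> pos b -> neg (u *m b) -> (len (u *m refl b) < len u)%N.
Proof.
move=> uW posb nb; have [S [E sz]] := red_wordP uW.
rewrite E in nb; have [vs [vS [E' lt]]] := exchange S posb nb.
by rewrite [X in X *m _]E E' -sz (leq_ltn_trans (len_word vS)).
Qed.

Lemma len_refl_gt u b : inW u -> pos b -> pos (u *m b) -> (len u < len (u *m refl b))%N.
Proof.
move=> uW posb nb; have bR := pos_in posb.
rewrite -{1}[u](mulrK_refl _ bR); apply: len_refl_lt => //.
  exact/inW_mul/inW_refl.
by rewrite -mulmxA refl_self // mulmxN neg_opp.
Qed.

Lemma len_refl u b : inW u -> pos b -> (len u < len (u *m refl b))%N = pos (u *m b).
Proof.
move=> uW posb; case p: (pos (u *m b)); first exact: len_refl_gt.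
apply/negbTE; rewrite -leqNgt ltnW // len_refl_lt //.
by rewrite negE ?p // inW_root // pos_in.
Qed.

Lemma len_mulr u a : inW u -> a \in Pi -> (len (u *m refl a) <= (len u).+1)%N.
Proof.
move=> uW aP; have [S [E sz]] := red_wordP uW.
rewrite {1}E -word_rcons -sz -(size_rcons _ a) len_word // => x.
by rewrite mem_rcons inE => /orP[/eqP->|/S].
Qed.

Lemma len_mull u a : inW u -> a \in Pi -> (len (refl a *m u) <= (len u).+1)%N.
Proof.
move=> uW aP; have [S [E sz]] := red_wordP uW.
rewrite {1}E -sz -[_ *m _]/(word (a :: _)) (len_word (ws := a :: _)) // => x.
by rewrite inE => /orP[/eqP->|/S].
Qed.

Lemma len_up u a : inW u -> a \in Pi -> pos (u *m a) -> len (u *m refl a) = (len u).+1.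
Proof.
move=> uW aP p; apply/eqP; rewrite eqn_leq len_mulr //.
by rewrite len_refl_gt // simple_pos.
Qed.

Lemma len_down u a : inW u -> a \in Pi -> neg (u *m a) -> len u = (len (u *m refl a)).+1.
Proof.
move=> uW aP p; have aR := Pi_roots aP.
rewrite -{1}[u](mulrK_refl _ aR) len_up //; first exact/inW_mul/inW_refl.
by rewrite -mulmxA refl_self // mulmxN pos_opp.
Qed.

Lemma refl_left u a : inW u -> a \in roots -> refl a *m u = u *m refl (invmx u *m a).
Proof.
move=> uW aR; have bR := inW_root (inW_inv uW) aR.
by rewrite -(refl_W uW bR) mulmxA (mulmxV (inW_unit uW)) mul1mx.
Qed.

Lemma len_ltl u a : inW u -> a \in Pi -> (len u < len (refl a *m u))%N = pos (invmx u *m a).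
Proof.
move=> uW aP; have aR := Pi_roots aP; have bR := inW_root (inW_inv uW) aR.
rewrite refl_left //; case p: (pos (invmx u *m a)).
  by rewrite len_refl // mulmxA mulmxV ?mul1mx ?simple_pos ?inW_unit.
have p' : pos (- (invmx u *m a)) by rewrite pos_opp negE ?p.
rewrite -refl_opp // len_refl // mulmxN mulmxA mulmxV ?mul1mx ?inW_unit //.
by rewrite pos_opp negE // simple_pos.
Qed.

Lemma inW_reflm a u : a \in Pi -> inW u -> inW (refl a *m u).
Proof. by move=> aP; apply/inW_mul/inW_refl/Pi_roots. Qed.
Lemma inW_mrefl a u : a \in Pi -> inW u -> inW (u *m refl a).
Proof. by move=> aP uW; apply/inW_mul/inW_refl/Pi_roots. Qed.

Lemma len_gtl u a : inW u -> a \in Pi ->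
  (len (refl a *m u) < len u)%N = ~~ (len u < len (refl a *m u))%N.
Proof.
move=> uW aP; have aR := Pi_roots aP; have bR := inW_root (inW_inv uW) aR.
rewrite len_ltl // -{2}[u](mulKr _ aR) len_ltl //; last exact: inW_reflm.
have vU := inW_unit uW.
have -> : invmx (refl a *m u) *m a = - (invmx u *m a).
  have rU : refl a \in unitmx by apply/inW_unit/inW_refl.
  have sU : refl a *m u \in unitmx by rewrite unitmx_mul rU.
  rewrite -mulmxN -[RHS](mulKmx sU); congr (_ *m _).
  by rewrite -mulmxA mulKVmx // -(refl_self aR) mulKr.
by rewrite pos_opp negE.
Qed.

Lemma len_upl u a : inW u -> a \in Pi -> (len u < len (refl a *m u))%N ->
  len (refl a *m u) = (len u).+1.
Proof. by move=> uW aP p; apply/eqP; rewrite eqn_leq p len_mull. Qed.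

Lemma len_downl u a : inW u -> a \in Pi -> (len (refl a *m u) < len u)%N ->
  len u = (len (refl a *m u)).+1.
Proof.
move=> uW aP p; have aR := Pi_roots aP.
by rewrite -{1}[u](mulKr _ aR) len_upl ?mulKr //; exact: inW_reflm.
Qed.

Lemma descent_l w : inW w -> w != 1%:M -> exists2 a, a \in Pi & (len (refl a *m w) < len w)%N.
Proof.
move=> wW w1; have [S [E sz]] := red_wordP wW.
case: (red_word w) S E sz => [|a ws] S E sz; first by rewrite E eqxx in w1.
have aP : a \in Pi by apply: S; rewrite mem_head.
exists a => //; rewrite {1}E /= mulKr ?Pi_roots // -sz ltnS len_word // => x xs.
by apply: S; rewrite inE xs orbT.
Qed.

Lemma descent_r w : inW w -> w != 1%:M -> exists2 a, a \in Pi & neg (w *m a).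
Proof.
move=> wW w1; have [S [E sz]] := red_wordP wW.
case/lastP: (red_word w) S E sz => [|ws a] S E sz; first by rewrite E eqxx in w1.
have aP : a \in Pi by apply: S; rewrite mem_rcons mem_head.
exists a => //; rewrite negE ?inW_root ?Pi_roots // -len_refl ?simple_pos // -leqNgt.
rewrite -sz {1}E word_rcons (mulrK_refl _ (Pi_roots aP)) size_rcons.
apply: leqW; apply: len_word => x xs.
by apply: S; rewrite mem_rcons inE xs orbT.
Qed.

(** * Finiteness of W and the longest element *)

Lemma faithful w : inW w -> (forall b, b \in roots -> w *m b = b) -> w = 1%:M.
Proof.
move=> wW H; apply/eqP; apply: contraT => /(descent_r wW)[a aP].
by rewrite H ?Pi_roots // negE ?Pi_roots // simple_pos.
Qed.

(** By faithfulness an element of W is determined by how it permutes the list of roots, which [code]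
    records in a finite type; [ch] inverts the code by choice. *)
Lemma W_listP : uniq (W_list R) /\ forall w, w \in W_list R <-> inW w.
Proof.
apply: (epsilon_spec (inhabits [::]) (fun s => uniq s /\ forall w, w \in s <-> inW w)).
pose k := size roots.
pose code w : {ffun 'I_k -> 'I_k.+1} := [ffun i : 'I_k => inord (index (w *m roots`_i) roots)].
have codeI u v : inW u -> inW v -> code u = code v -> u = v.
  move=> uW vW E.
  have H b : b \in roots -> u *m b = v *m b.
    move=> bR; have ib : (index b roots < k)%N by rewrite index_mem.
    have /(congr1 val) := congr1 (fun f : {ffun _} => f (Ordinal ib)) E.
    rewrite !ffunE /= nth_index // !inordK ?ltnS ?index_size // => Ei.
    by rewrite -[u *m b](nth_index 0 (inW_root uW bR)) Ei nth_index // inW_root.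
  have vU := inW_unit vW.
  have : invmx v *m u = 1%:M.
    apply: faithful; first exact/inW_mul/uW/inW_inv.
    by move=> b bR; rewrite -mulmxA H // mulKmx.
  by move/(congr1 (mulmx v)); rewrite mulKVmx // mulmx1.
pose ch f := epsilon (inhabits 1%:M) (fun w => inW w /\ code w = f).
have chP w : inW w -> ch (code w) = w.
  move=> wW; have [] := epsilon_spec (inhabits 1%:M) (fun v => inW v /\ code v = code w).
    by exists w.
  by move=> cW E; apply: codeI.
exists (undup [seq w <- [seq ch f | f : {ffun 'I_k -> 'I_k.+1}] | pb (inW w)]).
rewrite undup_uniq; split=> // w; rewrite mem_undup mem_filter.
split=> [/andP[/pbP]//|wW]; apply/andP; split; first exact/pbP.
by apply/mapP; exists (code w); rewrite ?mem_enum // chP.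
Qed.

Lemma mem_W w : (w \in W_list R) <-> inW w. Proof. by have [_ ->] := W_listP. Qed.
Lemma W_uniq : uniq (W_list R). Proof. by have [] := W_listP. Qed.

Notation w0 := (w0 R Pi).

Lemma w0P : inW w0 /\ forall u, inW u -> (len u <= len w0)%N.
Proof.
apply: (epsilon_spec (inhabits 1%:M) (fun w => inW w /\ forall u, inW u -> (len u <= len w)%N)).
pose P k := pb (exists2 w, inW w & len w = k).
have exP : exists k, P k by exists 0%N; apply/pbP; exists 1%:M; rewrite ?len1 //; exact: inW1.
pose N := (\max_(w <- W_list R) len w)%N.
have bP k : P k -> (k <= N)%N.
  by case/pbP=> w wW <-; apply: leq_bigmax_seq => //; apply/mem_W.
case: (ex_maxnP exP bP) => k /pbP[w wW <-] H; exists w; split=> // u uW.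
by apply: H; apply/pbP; exists u.
Qed.

Lemma w0_W : inW w0. Proof. by case: w0P. Qed.
Lemma w0_max u : inW u -> (len u <= len w0)%N. Proof. by case: w0P => _; apply. Qed.

Lemma w0_neg b : pos b -> neg (w0 *m b).
Proof.
move=> posb; rewrite negE ?(inW_root w0_W) ?pos_in //; rewrite -len_refl //; last exact: w0_W.
by rewrite -leqNgt w0_max //; apply: inW_mul; [exact: w0_W|exact/inW_refl/pos_in].
Qed.

Lemma w0_posE b : b \in roots -> pos (w0 *m b) = neg b.
Proof.
move=> bR; apply/idP/idP => [p|n']; last by rewrite -neg_opp -mulmxN w0_neg // pos_opp.
rewrite negE //; apply: contraL p => /w0_neg; by rewrite negE ?(inW_root w0_W).
Qed.

Lemma w0i_posE b : b \in roots -> pos (invmx w0 *m b) = neg b.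
Proof.
move=> bR; have iR := inW_root (inW_inv w0_W) bR.
rewrite -{2}[b](mulKVmx (inW_unit w0_W)) negE; last by rewrite mulKVmx ?inW_unit //; exact: w0_W.
by rewrite w0_posE // negE // negbK.
Qed.

(** * Bruhat order *)

Notation bruhat := (bruhat R Pi).

Lemma bruhat_refl u : bruhat u u. Proof. exact: rt_refl. Qed.
Lemma bruhat_trans u v w : bruhat u v -> bruhat v w -> bruhat u w. Proof. exact: rt_trans. Qed.
Lemma bruhat1 u b : b \in roots -> (len u < len (u *m refl b))%N -> bruhat u (u *m refl b).
Proof. by move=> bR lt; apply: rt_step; exists b. Qed.

Lemma bruhat_len u v : bruhat u v -> u = v \/ (len u < len v)%N.
Proof.
elim=> [x y [a [_ [-> lt]]]|x|x y z _ [-> //|l1] _ [<-|l2]]; [by right|by left|by right|].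
by right; apply: ltn_trans l2.
Qed.

Lemma bruhat_W u v : bruhat u v -> inW v -> inW u.
Proof.
elim=> [x y [a [aR [-> lt]]] yW|//|x y z _ H1 _ H2 /H2 /H1 //].
by rewrite -[x](mulrK_refl _ aR); apply: inW_mul => //; exact: inW_refl.
Qed.

Lemma bruhat_left u a : inW u -> a \in Pi -> (len u < len (refl a *m u))%N ->
  bruhat u (refl a *m u).
Proof.
move=> uW aP; have aR := Pi_roots aP; rewrite refl_left // => lt; apply: bruhat1 => //.
exact/inW_root/aR/inW_inv.
Qed.

(** Along a chain from u to v, left multiplication by s_a keeps each step x < x s_c unless x c = a.
    In that case s_a x is already the upper end of the step, and v < s_a v closes the chain. *)
Lemma bruhat_lift u v a : a \in Pi -> inW v -> bruhat u v ->
  (len v < len (refl a *m v))%N -> bruhat (refl a *m u) (refl a *m v).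
Proof.
move=> aP vW /clos_rt_rt1n_iff H; have aR := Pi_roots aP.
elim: H vW => [x _ _|x y z [b [bR [Ey lt]]] /clos_rt_rt1n_iff yz IH zW ltz];
  first exact: bruhat_refl.
have yW := bruhat_W yz zW.
have xW : inW x by apply: (@bruhat_W x y) => //; rewrite Ey; apply: bruhat1; rewrite -?Ey.
(* A Bruhat step may use any root, while the length criterion needs a positive one; opposite roots
   give the same reflection. *)
have [c pc Ec] : exists2 c, pos c & refl c = refl b.
  case p: (pos b); first by exists b.
  by exists (- b); rewrite ?refl_opp // pos_opp negE // p.
have cR := pos_in pc; rewrite -Ec in Ey.
move: lt; rewrite Ey (len_refl xW pc) => pxc.
have [E|ne] := eqVneq (x *m c) a.
  have -> : refl a *m x = y by rewrite Ey -E refl_W.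
  by apply: bruhat_trans yz _; apply: bruhat_left.
apply: bruhat_trans (IH zW ltz); have rW := inW_reflm aP xW.
rewrite Ey (mulmxA (refl a) x); apply: (bruhat1 cR).
by rewrite (len_refl rW pc) -mulmxA (simple_perm aP pxc ne).
Qed.

Notation W := (W_list R).

(** * Pairs of simple roots and their Cartan integers *)

Lemma pairing_simple a b : a \in Pi -> b \in Pi -> a != b -> pairing b (coroot a) <= 0.
Proof.
move=> aP bP ab; have aR := Pi_roots aP; have bR := Pi_roots bP.
have ba : b != a by rewrite eq_sym.
have [_ [c [c0]]] := pos_rootP _ (simple_perm aP (simple_pos bP) ba).
set k := pairing b (coroot a); rewrite reflE -/k => E.
have H := icomb_inj (c := fun i => (i == index b Pi)%:Z + - (k * (i == index a Pi)%:Z)) (d := c).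
have ia : (index a Pi < size Pi)%N by rewrite index_mem.
have iab : index a Pi == index b Pi = false.
  by apply/negbTE; apply: contra ab => /eqP e; rewrite -(nth_index 0 aP) e nth_index.
have := c0 (index a Pi); rewrite -H //; first by rewrite eqxx iab; lia.
by rewrite -icombD -icombN -icombZ -!icomb_simple // E.
Qed.

Lemma simple_indep a b : a \in Pi -> b \in Pi -> a != b ->
  forall i j : int, i *: a + j *: b = 0 -> i = 0 /\ j = 0.
Proof.
move=> aP bP ab i j E.
have H := icomb_eq0 (c := fun k => i * (k == index a Pi)%:Z + j * (k == index b Pi)%:Z).
have ia : (index a Pi < size Pi)%N by rewrite index_mem.
have ib : (index b Pi < size Pi)%N by rewrite index_mem.
have iab : index a Pi == index b Pi = false.
  by apply/negbTE; apply: contra ab => /eqP e; rewrite -(nth_index 0 aP) e nth_index.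
have {}H : forall k, (k < size Pi)%N -> i * (k == index a Pi)%:Z + j * (k == index b Pi)%:Z = 0.
  by apply: H; rewrite -icombD -!icombZ -!icomb_simple.
have := H _ ia; have := H _ ib; rewrite !eqxx iab [_ == index a Pi]eq_sym iab; lia.
Qed.

(** If pr >= 4, the vector y = r a^v + 2 b^v pairs to 0 with a and to 4 - pr with b, so its norm is
    at most 0. It then lies in the radical of the form, which yields a linear relation between a and
    b. *)
Lemma rank2_cartan_integers a b : a \in Pi -> b \in Pi -> a != b ->
  let p := - pairing b (coroot a) in let r := - pairing a (coroot b) in
  exists2 pr : int * int, (p = pr.1 /\ r = pr.2) &
    pr \in [:: (0, 0); (1, 1); (2, 1); (1, 2); (3, 1); (1, 3)].
Proof.
move=> aP bP ab p r; exists (p, r) => //.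
have aR := Pi_roots aP; have bR := Pi_roots bP.
have p0 : 0 <= p by rewrite /p oppr_ge0 pairing_simple.
have r0 : 0 <= r by rewrite /r oppr_ge0 pairing_simple // eq_sym.
have Na := cnorm_gt0 aR; have Nb := cnorm_gt0 bR.
have E : cnorm a * r = cnorm b * p by have := pairing_cnorm aR bR; rewrite /p /r; lia.
have pr : p * r < 4.
  rewrite ltNge; apply/negP => pr.
  pose y := r *: coroot a + 2 *: coroot b.
  have Ha d : 2 * cform (coroot a) d = cnorm a * pairing a d by apply: cform_coroot.
  have Hb d : 2 * cform (coroot b) d = cnorm b * pairing b d by apply: cform_coroot.
  have ya : pairing a y = 0.
    by rewrite pairingDr !pairingZr pairing2 // -[pairing a _]opprK -/r; lia.
  have yb : pairing b y = 4 - p * r.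
    by rewrite pairingDr !pairingZr pairing2 // -[pairing b (coroot a)]opprK -/p; lia.
  have yy : cform y y = 0.
    apply/eqP; rewrite eq_le cform_ge0 andbT cformDl !cformZl.
    have := Ha y; have := Hb y; rewrite ya yb => e1 e2.
    have e3 : cform (coroot a) y = 0 by lia.
    rewrite e3 mulr0 add0r e1; nia.
  have cyd d : 2 * cform y d = pairing ((r * cnorm a) *: a + (2 * cnorm b) *: b) d.
    rewrite cformDl !cformZl pairingDl !pairingZl; have := Ha d; have := Hb d; nia.
  have cy0 d : cform y d = 0.
    by rewrite /cform big_seq big1 // => c cR; rewrite (cform_eq0 yy cR) mul0r.
  have : (r * cnorm a) *: a + (2 * cnorm b) *: b = 0.
    by apply: pairing_sep => d; rewrite -cyd cy0 pairing0l.
  by case/(simple_indep aP bP ab) => _; lia.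
have pz : p = 0 -> r = 0 by move=> p00; move: E; rewrite p00; nia.
have rz : r = 0 -> p = 0 by move=> p00; move: E; rewrite p00; nia.
have p4 : p < 4 by nia.
have r4 : r < 4 by nia.
clear -p0 r0 pr pz rz p4 r4; clearbody p r.
have [Ep|[Ep|[Ep|Ep]]] : p = 0 \/ p = 1 \/ p = 2 \/ p = 3 by lia.
- by rewrite Ep (pz Ep).
- have [Er|[Er|[Er|Er]]] : r = 0 \/ r = 1 \/ r = 2 \/ r = 3 by lia.
  + by have := rz Er; rewrite Ep.
  + by rewrite Ep Er.
  + by rewrite Ep Er.
  + by rewrite Ep Er.
- have [Er|Er] : r = 0 \/ r = 1 by nia.
  + by have := rz Er; rewrite Ep.
  + by rewrite Ep Er.
- have [Er|Er] : r = 0 \/ r = 1 by nia.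
  + by have := rz Er; rewrite Ep.
  + by rewrite Ep Er.
Qed.

(** * Demazure-Lusztig elements and Matsumoto's theorem *)

Local Notation Q := (Qm n).
Local Notation t := (tt n).

Local Opaque Qm tt ex mulmx Defs.refl Defs.coroot.

Definition av (g : 'cV[int]_n) : Q := (t^-1 - t * ex (- g)) / (1 - ex (- g)).

(* Right multiplication by tau_a; it is linear over Q^m, so no twist by W appears. *)
Definition Rop a (Z : 'M[int]_n -> Q) : 'M[int]_n -> Q :=
  rop t (fun x => x *m refl a) (fun x => av (x *m a)) Z.

Lemma xa_neq0 (g : 'cV[int]_n) : g != 0 -> 1 - ex (- g) != 0.
Proof. by move=> g0; rewrite subr_eq0 eq_sym ex_neq1 // oppr_eq0. Qed.

Lemma av_opp g : g != 0 -> av (- g) = t + t^-1 - av g.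
Proof.
move=> g0; have := @xa_neq0 (- g); rewrite oppr_eq0 opprK => /(_ g0) h.
rewrite /av opprK exN; exact: av_opp_gen (tt_neq0 n) (ex_neq0 g) h.
Qed.

(* The alternating word of length k in a, b whose last letter is a. *)
Fixpoint ealt a b k := if k is k'.+1 then rcons (ealt b a k') a else [::].
Definition RR ws (Z : 'M[int]_n -> Q) := foldl (fun Y a => Rop a Y) Z ws.

Lemma RR_rcons ws a Z : RR (rcons ws a) Z = Rop a (RR ws Z).
Proof. by rewrite /RR foldl_rcons. Qed.

Section Rank2.
Variables a b : 'cV[int]_n.
Hypotheses (aP : a \in Pi) (bP : b \in Pi) (ab : a != b).
Let aR := Pi_roots aP.
Let bR := Pi_roots bP.
Notation s := (refl a).
Notation r := (refl b).

Definition comb (i j : int) : 'cV[int]_n := i *: a + j *: b.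

Lemma comb_a : comb 1 0 = a. Proof. by rewrite /comb scale1r scale0r addr0. Qed.
Lemma comb_b : comb 0 1 = b. Proof. by rewrite /comb scale1r scale0r add0r. Qed.
Lemma combN i j : - comb i j = comb (- i) (- j).
Proof. by rewrite /comb opprD !scaleNr. Qed.

Lemma comb_neq0 (x : 'M[int]_n) i j : x \in unitmx -> (i != 0) || (j != 0) -> x *m comb i j != 0.
Proof.
move=> xU; apply: contraTneq => E; have : comb i j = 0 by rewrite -(mulKmx xU (comb i j)) E mulmx0.
by case/(simple_indep aP bP ab) => -> ->; rewrite eqxx.
Qed.

Lemma refl_comb_a p i j : pairing b (coroot a) = - p -> s *m comb i j = comb (p * j - i) j.
Proof.
move=> pb; rewrite reflE /comb pairingDl !pairingZl pairing2 // pb.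
rewrite [i *: a + _]addrC -addrA -scalerBl [RHS]addrC; congr (_ + _ *: _); lia.
Qed.

Lemma refl_comb_b p i j : pairing a (coroot b) = - p -> r *m comb i j = comb i (p * i - j).
Proof.
move=> pb; rewrite reflE /comb pairingDl !pairingZl pairing2 // pb.
rewrite -addrA -scalerBl; congr (_ + _ *: _); lia.
Qed.

Lemma ex_nat (k : nat) (l : 'cV[int]_n) : ex (k%:Z *: l) = ex l ^+ k.
Proof.
elim: k => [|k IH]; first by rewrite scale0r ex0.
by rewrite exprS -IH -exD -{2}[l]scale1r -scalerDl -[1]/(1%N%:Z) -PoszD add1n.
Qed.

Lemma ex_comb (x : 'M[int]_n) (i j : nat) :
  ex (- (x *m comb i j)) = ex (- (x *m a)) ^+ i * ex (- (x *m b)) ^+ j.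
Proof. by rewrite -!ex_nat -exD !scalerN -opprD /comb mulmxDr !scalemxAr. Qed.

Lemma neg_comb (w : 'M[int]_n) i j : inW w -> neg (w *m a) -> neg (w *m b) ->
  0 <= i -> 0 <= j -> comb i j \in roots -> neg (w *m comb i j).
Proof.
move=> wW /neg_rootP[_ [c [c0 Ec]]] /neg_rootP[_ [d [d0 Ed]]] i0 j0 cR.
apply/neg_rootP; split; first exact: inW_root.
exists (fun k => i * c k + j * d k); split=> [k|].
  by rewrite addr_ge0 // mulr_ge0.
rewrite -[RHS]/(icomb (fun k => i * c k + j * d k)) -icombD -!icombZ.
rewrite -[icomb c]Ec -[icomb d]Ed /comb mulmxDr opprD -!scalemxAr.
by rewrite !scalerN.
Qed.

Lemma RR_ealt c d k Z : RR (ealt c d k) Z = alt (Rop c) (Rop d) k Z.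
Proof. by elim: k c d => [|k IH] c d //=; rewrite RR_rcons IH. Qed.

Lemma altp_word c d k (x : 'M[int]_n) : c \in roots -> d \in roots ->
  altp (fun x => x *m refl c) (fun x => x *m refl d) k x *m word (ealt c d k) = x.
Proof.
move=> cR dR; elim: k c d cR dR x => [|k IH] c d cR dR x /=; first by rewrite mulmx1.
by rewrite word_rcons mulmxA (IH _ _ dR cR) (mulrK_refl x cR).
Qed.

(** The two facts that Matsumoto's argument consumes about a pair of simple roots: the braid
    relation for the operators, and the factorisation of an element that has both as right
    descents. *)
Definition dihedral c d m := [/\ (0 < m)%N,
  (forall Z (x : 'M[int]_n), inW x -> RR (ealt c d m) Z x = RR (ealt d c m) Z x) &
  forall w, inW w -> neg (w *m c) -> neg (w *m d) ->
    exists w', [/\ inW w', w = w' *m word (ealt c d m), w = w' *m word (ealt d c m) &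
      len w = (len w' + m)%N]].

Lemma dihedral_sym c d m : dihedral c d m -> dihedral d c m.
Proof.
case=> m0 H1 H2; split; first exact: m0.
  by move=> Z x xW; rewrite (H1 Z x xW).
move=> w wW wc wd; have [w' [h1 h2 h3 h4]] := H2 w wW wd wc.
by exists w'.
Qed.

Let S := fun x : 'M[int]_n => x *m s.
Let T := fun x : 'M[int]_n => x *m r.
Let SK (x : 'M[int]_n) : S (S x) = x := mulrK_refl x aR.
Let TK (x : 'M[int]_n) : T (T x) = x := mulrK_refl x bR.
Let okS (x : 'M[int]_n) : inW x -> inW (S x) := @inW_mrefl a x aP.
Let okT (x : 'M[int]_n) : inW x -> inW (T x) := @inW_mrefl b x bP.
Let A (x : 'M[int]_n) i j := av (x *m comb i j).
Let AN (x : 'M[int]_n) i j : inW x -> (i != 0) || (j != 0) ->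
  A x i j = t + t^-1 - A x (- i) (- j).
Proof.
move=> xW ij; have c0 := comb_neq0 (inW_unit xW) ij.
by rewrite /A -combN mulmxN (av_opp c0) opprD opprK addrA subrr add0r.
Qed.
Let AX (x : 'M[int]_n) (i j : nat) : inW x -> (i != 0)%N || (j != 0)%N ->
  1 - ex (- (x *m a)) ^+ i * ex (- (x *m b)) ^+ j != 0 /\
  A x i j = (t^-1 - t * (ex (- (x *m a)) ^+ i * ex (- (x *m b)) ^+ j))
     / (1 - ex (- (x *m a)) ^+ i * ex (- (x *m b)) ^+ j).
Proof.
move=> xW ij; rewrite -ex_comb; split; last by [].
exact/xa_neq0/comb_neq0/ij/inW_unit.
Qed.
Let dS (y : 'M[int]_n) : inW y -> neg (y *m comb 1 0) -> len y = (len (S y)).+1.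
Proof. by rewrite comb_a => yW; exact: len_down. Qed.
Let dT (y : 'M[int]_n) : inW y -> neg (y *m comb 0 1) -> len y = (len (T y)).+1.
Proof. by rewrite comb_b => yW; exact: len_down. Qed.

Let EA : Rop a = rop t S (fun x => A x 1 0).
Proof. by rewrite /A comb_a. Qed.
Let EB : Rop b = rop t T (fun x => A x 0 1).
Proof. by rewrite /A comb_b. Qed.

Section Cartan.
Variables p q : int.
Hypothesis pa : pairing b (coroot a) = - p.
Hypothesis pb : pairing a (coroot b) = - q.
Let AS (x : 'M[int]_n) i j : A (S x) i j = A x (p * j - i) j.
Proof. by rewrite /A /S -mulmxA (refl_comb_a i j pa). Qed.
Let AT (x : 'M[int]_n) i j : A (T x) i j = A x i (q * i - j).
Proof. by rewrite /A /T -mulmxA (refl_comb_b i j pb). Qed.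
Let ngS (x : 'M[int]_n) i j : neg (S x *m comb i j) <-> neg (x *m comb (p * j - i) j).
Proof. by rewrite /S -mulmxA (refl_comb_a i j pa). Qed.
Let ngT (x : 'M[int]_n) i j : neg (T x *m comb i j) <-> neg (x *m comb i (q * i - j)).
Proof. by rewrite /T -mulmxA (refl_comb_b i j pb). Qed.

Lemma dihedral_intro m :
  (forall x, altp S T m x = altp T S m x) ->
  (forall x Z, inW x -> alt (Rop a) (Rop b) m Z x = alt (Rop b) (Rop a) m Z x) ->
  (forall w, inW w -> neg (w *m a) -> neg (w *m b) ->
     inW (altp S T m w) /\ len w = (len (altp S T m w) + m)%N) ->
  (0 < m)%N -> dihedral a b m.
Proof.
move=> E H1 H2 m0; split; first exact: m0.
  by move=> Z x xW; rewrite !RR_ealt (H1 x Z xW).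
move=> w wW wa wb; have [h1 h2] := H2 w wW wa wb.
exists (altp S T m w); split; [exact: h1| | |exact: h2].
  by rewrite (altp_word m w aR bR).
by rewrite E (altp_word m w bR aR).
Qed.

Lemma dihedral2 : p = 0 -> q = 0 -> dihedral a b 2.
Proof.
move=> Ep Eq.
have e : s *m r *m s = r by rewrite -(refl_conj aR bR) -comb_b (refl_comb_a _ _ pa) Ep.
have E x : altp S T 2 x = altp T S 2 x by exact: (alt_comm2 (reflK aR) e).
apply: (dihedral_intro E); last by [].
  move=> x Z xW; rewrite EA EB.
  apply: (@braid_point2 Q t 'M[int]_n S T (fun x => A x 1 0) (fun x => A x 0 1)).
  - exact: esym (E x).
  - by rewrite AT Eq.
  - by rewrite AS Ep.
move=> w wW wa wb; apply: (rank2_peel2 (ng := fun x i j =>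
  neg (x *m comb i j)) okS okT ngS Ep Eq wW dS dT).
- by rewrite comb_a.
- by rewrite comb_b.
Qed.

(** Both s_a b and s_b a are a + b, so the two conjugates s r s and r s r are the same
    reflection. *)
Lemma dihedral3 : p = 1 -> q = 1 -> dihedral a b 3.
Proof.
move=> Ep Eq.
have sb : s *m b = comb 1 1 by rewrite -{1}comb_b (refl_comb_a _ _ pa) Ep.
have ra : r *m a = comb 1 1 by rewrite -{1}comb_a (refl_comb_b _ _ pb) Eq.
have e : s *m r *m s = r *m s *m r :=
  etrans (esym (refl_conj aR bR)) (etrans (congr1 refl (etrans sb (esym ra))) (refl_conj bR aR)).
have E x : altp S T 3 x = altp T S 3 x by exact: (alt_comm3 e).
apply: (dihedral_intro E); last by [].
  move=> x Z xW; rewrite EA EB.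
  exact: (rank2_braid3 (tt_neq0 n) SK TK AS AT AN AX Ep Eq E).
move=> w wW wa wb.
have H i j := @neg_comb w i j wW wa wb.
apply: (rank2_peel3 (ng := fun x i j => neg (x *m comb i j)) okS okT ngS ngT Ep Eq wW dS dT).
- by rewrite comb_a.
- by apply: (H 1 1 isT isT); rewrite -sb refl_root_in.
- by rewrite comb_b.
Qed.

(** The conjugate s r s is the reflection in s_a b = 2a + b, a root fixed by s_b; hence it commutes
    with r, which is the braid relation of length 4 in W. *)
Lemma dihedral4 : p = 2 -> q = 1 -> dihedral a b 4.
Proof.
move=> Ep Eq.
have sb : s *m b = comb 2 1 by rewrite -{1}comb_b (refl_comb_a _ _ pa) Ep.
have sbR : s *m b \in roots by exact: refl_root_in.
have cR : comb 2 1 \in roots by rewrite -sb.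
have rc : r *m comb 2 1 = comb 2 1 by rewrite (refl_comb_b _ _ pb) Eq.
have g : refl (comb 2 1) = s *m r *m s := etrans (congr1 refl (esym sb)) (refl_conj aR bR).
have e : r *m (s *m r *m s) *m r = s *m r *m s :=
  etrans (congr1 (fun X => r *m X *m r) (esym g))
    (etrans (esym (refl_conj bR cR)) (etrans (congr1 refl rc) g)).
have E x : altp S T 4 x = altp T S 4 x by exact: (alt_comm4 (reflK bR) e).
apply: (dihedral_intro E); last by [].
  move=> x Z xW; rewrite EA EB.
  exact: (rank2_braid4 (tt_neq0 n) SK TK AS AT AN AX Ep Eq E).
move=> w wW wa wb.
have H i j := @neg_comb w i j wW wa wb.
apply: (rank2_peel4 (ng := fun x i j => neg (x *m comb i j)) okS okT ngS ngT Ep Eq wW dS dT).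
- by rewrite comb_a.
- exact: (H 2 1 isT isT cR).
- apply: (H 1 1 isT isT); have <- : r *m a = comb 1 1 by rewrite -{1}comb_a (refl_comb_b _ _ pb) Eq.
  by rewrite refl_root_in.
- by rewrite comb_b.
Qed.

(** Here the root fixed by s_b is 2a + b = s_a s_b a, and r commutes with its reflection s (r s r)
    s. *)
Lemma dihedral6 : p = 3 -> q = 1 -> dihedral a b 6.
Proof.
move=> Ep Eq.
have ra : r *m a = comb 1 1 by rewrite -{1}comb_a (refl_comb_b _ _ pb) Eq.
have raR : r *m a \in roots by exact: refl_root_in.
have sra : s *m (r *m a) = comb 2 1 by rewrite ra (refl_comb_a _ _ pa) Ep.
have sraR : s *m (r *m a) \in roots by exact: refl_root_in.
have sb : s *m b = comb 3 1 by rewrite -{1}comb_b (refl_comb_a _ _ pa) Ep.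
have sbR : s *m b \in roots by exact: refl_root_in.
have cR : comb 2 1 \in roots by rewrite -sra.
have rc : r *m comb 2 1 = comb 2 1 by rewrite (refl_comb_b _ _ pb) Eq.
have g : refl (comb 2 1) = s *m (r *m s *m r) *m s :=
  etrans (congr1 refl (esym sra)) (etrans (refl_conj aR raR)
    (congr1 (fun X => s *m X *m s) (refl_conj bR aR))).
have e : r *m (s *m (r *m s *m r) *m s) *m r = s *m (r *m s *m r) *m s :=
  etrans (congr1 (fun X => r *m X *m r) (esym g))
    (etrans (esym (refl_conj bR cR)) (etrans (congr1 refl rc) g)).
have E x : altp S T 6 x = altp T S 6 x by exact: (alt_comm6 (reflK bR) e).
apply: (dihedral_intro E); last by [].
  move=> x Z xW; rewrite EA EB.
  exact: (rank2_braid6 (tt_neq0 n) SK TK AS AT AN AX Ep Eq E).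
move=> w wW wa wb.
have H i j := @neg_comb w i j wW wa wb.
apply: (rank2_peel6 (ng := fun x i j => neg (x *m comb i j)) okS okT ngS ngT Ep Eq wW dS dT).
- by rewrite comb_a.
- by apply: (H 3 1 isT isT); rewrite -sb.
- exact: (H 2 1 isT isT cR).
- apply: (H 3 2 isT isT).
  have <- : r *m (s *m b) = comb 3 2 by rewrite sb (refl_comb_b _ _ pb) Eq.
  by rewrite refl_root_in.
- by apply: (H 1 1 isT isT); rewrite -ra.
- by rewrite comb_b.
Qed.

End Cartan.
End Rank2.

Lemma dihedral_exists a b : a \in Pi -> b \in Pi -> a != b -> exists m, dihedral a b m.
Proof.
move=> aP bP ab; have ba : b != a by rewrite eq_sym.
have [[p q] /= [Ep Eq]] := rank2_cartan_integers aP bP ab.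
have pa : pairing b (coroot a) = - p by rewrite -Ep opprK.
have pb : pairing a (coroot b) = - q by rewrite -Eq opprK.
rewrite !inE !xpair_eqE => /orP[|/orP[|/orP[|/orP[|/orP[|]]]]] /andP[/eqP e1 /eqP e2].
- by exists 2%N; apply: (dihedral2 aP bP ab pa pb).
- by exists 3%N; apply: (dihedral3 aP bP ab pa pb).
- by exists 4%N; apply: (dihedral4 aP bP ab pa pb).
- by exists 4%N; apply/dihedral_sym/(dihedral4 bP aP ba pb pa).
- by exists 6%N; apply: (dihedral6 aP bP ab pa pb).
- by exists 6%N; apply/dihedral_sym/(dihedral6 bP aP ba pb pa).
Qed.

(** * Matsumoto's theorem *)

Definition reduced ws := {subset ws <= Pi} /\ len (word ws) = size ws.

Lemma reduced_rcons ws a : reduced (rcons ws a) ->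
  [/\ reduced ws, a \in Pi, inW (word ws) & neg (word (rcons ws a) *m a)].
Proof.
case=> S E; have aP : a \in Pi by apply: S; rewrite mem_rcons mem_head.
have S' : {subset ws <= Pi} by move=> b bws; apply: S; rewrite mem_rcons inE bws orbT.
have wW := inW_wordPi S'; move: E; rewrite word_rcons size_rcons => E.
have lw : len (word ws) = size ws.
  by apply/eqP; rewrite eqn_leq len_word //= -ltnS -E len_mulr.
split=> //; have aR := Pi_roots aP.
rewrite -mulmxA (refl_self aR) mulmxN neg_opp -(len_refl wW (simple_pos aP)).
by rewrite E lw.
Qed.

Lemma Rop_ext a Z Z' : a \in Pi -> (forall x, inW x -> Z x = Z' x) ->
  forall x, inW x -> Rop a Z x = Rop a Z' x.
Proof.
move=> aP E x xW; rewrite /Rop /rop (E x xW); congr (_ + _ * _).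
exact/E/inW_mrefl.
Qed.

Lemma RR_cat ws ws' Z : RR (ws ++ ws') Z = RR ws' (RR ws Z).
Proof. by rewrite /RR foldl_cat. Qed.

Lemma ealt_sub a b k : a \in Pi -> b \in Pi -> {subset ealt a b k <= Pi}.
Proof.
elim: k a b => [|k IH] a b aP bP x //=.
by rewrite mem_rcons inE => /orP[/eqP-> //|]; exact: (IH b a bP aP).
Qed.

Lemma size_ealt a b k : size (ealt a b k) = k.
Proof. by elim: k a b => [|k IH] a b //=; rewrite size_rcons IH. Qed.

(** If the last letters a and b differ, both are right descents, so w is w' times an alternating
    word in a and b. Each given word agrees, by induction after deleting its last letter, with a
    reduced word of w' followed by the alternating word ending in the same letter; the braid
    relation joins the two. *)
Lemma matsumoto ws ws' : reduced ws -> reduced ws' -> word ws = word ws' ->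
  forall Z x, inW x -> RR ws Z x = RR ws' Z x.
Proof.
have [k] := ubnP (size ws); elim: k ws ws' => // k IH ws ws'.
case/lastP: ws => [|ws a]; case/lastP: ws' => [|ws' b]; first by [].
- by move=> _ _ [_]; rewrite size_rcons => E e; move: E; rewrite -e len1.
- by move=> _ [_]; rewrite size_rcons => E _ e; move: E; rewrite e len1.
rewrite size_rcons ltnS => sz rw rw' E Z x xW.
have [ru aP uW na] := reduced_rcons rw; have [ru' bP uW' nb] := reduced_rcons rw'.
have aR := Pi_roots aP; have bR := Pi_roots bP.
rewrite !RR_rcons; have [eab|ab] := eqVneq a b.
  rewrite -eab; apply: Rop_ext => // y yW; apply: IH => //.
  by rewrite -[LHS](mulrK_refl _ aR) -word_rcons E eab word_rcons (mulrK_refl _ bR).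
have wW : inW (word (rcons ws a)) by rewrite word_rcons; exact: inW_mrefl.
have [m [m0 braid peel]] := dihedral_exists aP bP ab.
rewrite -E in nb; have [w' [w'W e1 e2 el]] := peel _ wW na nb.
have [vP [ve vs]] := red_wordP w'W; set vv := red_word w' in vP ve vs.
have key c d us : c \in Pi -> d \in Pi -> reduced us -> (size us < k)%N ->
    word (rcons us c) = word (rcons ws a) -> word (rcons us c) = w' *m word (ealt c d m) ->
    size us = size ws ->
    forall y, inW y -> Rop c (RR us Z) y = RR (ealt c d m) (RR vv Z) y.
  case: m m0 {braid peel e1 e2} el => // m' _ el cP dP rus szu euw e szus y yW.
  rewrite /= RR_rcons -RR_cat; apply: Rop_ext => // {}y {}yW.
  have cR := Pi_roots cP.
  have ew : word us = word (vv ++ ealt d c m').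
    rewrite word_cat -ve -[LHS](mulrK_refl _ cR) -word_rcons e /= word_rcons mulmxA.
    by rewrite (mulrK_refl _ cR).
  apply: IH => //; split.
    by move=> z; rewrite mem_cat => /orP[/vP //|]; apply: ealt_sub.
  have [_ lus] := rus; have [_ lw] := rw.
  rewrite -ew lus size_cat vs size_ealt szus.
  by move: lw; rewrite el size_rcons addnS => -[].
have szz : size ws' = size ws.
  have [_ l1] := rw; have [_ l2] := rw'.
  by move: l1; rewrite E l2 !size_rcons => -[].
rewrite (key a b ws aP bP ru sz erefl e1 erefl x xW).
have sz' : (size ws' < k)%N by rewrite szz.
rewrite (key b a ws' bP aP ru' sz' (esym E) (etrans (esym E) e2) szz x xW).
exact: braid.
Qed.

(** * The abstract results specialised to the Weyl group *)

Definition wmul (u v : 'M[int]_n) := u *m v.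
Definition sav (x : 'M[int]_n) (a : 'cV[int]_n) : Q := av (x *m a).

Notation qm := (qmul wmul W (@act n)).
Notation hts := (ts 1%:M refl sav t).
Notation htau := (tauG wmul 1%:M W (@act n) refl sav t red_word).
Notation hgam := (gam wmul 1%:M W (@act n) refl len sav t red_word).
Notation hKL := (KLe wmul 1%:M W inW Pi refl len bruhat).

Lemma av_bar_gen (F : fieldType) (t' e : F) : t' != 0 -> e != 0 -> 1 - e != 0 ->
  (t'^-1^-1 - t'^-1 * e^-1) / (1 - e^-1) = (t'^-1 - t' * e) / (1 - e).
Proof.
move=> t0 e0 e1; have e1' : e - 1 != 0 by rewrite -oppr_eq0 opprB.
by field; rewrite t0 e0 e1 e1' oner_neq0.
Qed.

Lemma ts_gen (F : fieldType) (t' e : F) : t' != 0 -> e != 0 -> 1 - e != 0 ->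
  (t'^-1 - t' * e) / (1 - e) - t' = (t'^-1 - t') / (1 - e) /\
  (t'^-1 - t' * e^-1) / (1 - e^-1) = (t' - t'^-1 * e) / (1 - e).
Proof.
move=> t0 e0 e1; have e1' : e - 1 != 0 by rewrite -oppr_eq0 opprB.
by split; field; rewrite ?t0 ?e0 ?e1 ?e1'.
Qed.

Lemma tt_inj p : evp p t = 0 -> p = 0.
Proof.
rewrite evp_coef => E.
have : FracField.tofrac (\sum_(i < size p) (p`_i)%:MP * 'X_ord0 ^+ i : {mpoly int[n.+1]}) = 0.
  rewrite -E rmorph_sum; apply: eq_bigr => i _.
  rewrite rmorphM rmorphXn /=; congr (_ * _).
  by rewrite -{1}[p`_i]intz !rmorph_int.
move/eqP; rewrite tofrac_eq0 => /eqP /mpolyP H; apply/polyP => i; rewrite coef0.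
case: (ltnP i (size p)) => [ip|/(nth_default 0) //].
have := H (U_(ord0) *+ i)%MM; rewrite mcoeff0 raddf_sum /= (bigD1 (Ordinal ip)) //= big1 => [|j].
  by rewrite addr0 mcoeffCM mcoeffXn eqxx mulr1.
rewrite -val_eqE /= => ji; rewrite mcoeffCM mcoeffXn.
case: eqP => [/mnmP/(_ ord0)|_]; last by rewrite mulr0.
by rewrite !mulmnE mnm1E eqxx !mul1n => e; rewrite e eqxx in ji.
Qed.

Lemma av_neq0 (g : 'cV[int]_n) : g != 0 -> av g != 0.
Proof.
move=> g0; rewrite mulf_neq0 ?invr_eq0 ?xa_neq0 // subr_eq0; apply/negP => /eqP E.
have := tt2_neq_ex g; rewrite expr2 => /eqP; apply.
have t0 := tt_neq0 n; apply: (mulfI (ex_neq0 (- g))).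
by rewrite -exD addNr ex0 mulrCA mulrA mulrAC -mulrA -E divff.
Qed.

Lemma av_act (x : 'M[int]_n) (g : 'cV[int]_n) : x \in unitmx -> act x (av g) = av (x *m g).
Proof.
move=> xU; have h := act_hom xU.
by rewrite /av (homM h) (homV h) !(homB h) (homM h) (homV h) (hom1 h) act_tt // act_ex // mulmxN.
Qed.

Lemma av_bar (g : 'cV[int]_n) : g != 0 -> bar (av g) = av g.
Proof.
move=> g0; have h := bar_hom n.
rewrite /av (homM h) (homV h) !(homB h) (homM h) (homV h) (hom1 h) bar_tt bar_ex opprK.
have -> : ex g = (ex (- g))^-1 by rewrite exN invrK.
exact: av_bar_gen (tt_neq0 n) (ex_neq0 _) (xa_neq0 g0).
Qed.

Lemma mulroot_neq0 (x : 'M[int]_n) a : inW x -> a \in Pi -> x *m a != 0.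
Proof. by move=> xW aP; apply/root_neq0/inW_root/Pi_roots. Qed.

Lemma tau_ts a : a \in Pi -> tau_s R a = hts a.
Proof.
move=> aP; apply: functional_extensionality => u.
have a0 := root_neq0 (Pi_roots aP); have [e1 e2] := ts_gen (tt_neq0 n) (ex_neq0 (- a)) (xa_neq0 a0).
rewrite /tau_s /ts /sav /xa mul1mx (refl_self (Pi_roots aP)); congr (_ * _ + _ * _).
  by rewrite -e1.
by rewrite -e2 /av opprK exN invrK.
Qed.

Lemma tauE w : inW w -> Defs.tau R Pi w = htau w.
Proof.
move=> wW; have [S _] := red_wordP wW.
rewrite /Defs.tau /tauG /tw; congr (foldr _ _ _).
by apply/eq_in_map => a /S; exact: tau_ts.
Qed.

(** Holds by conversion: the abstract recursion has the same shape as the defining one, so both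
    sides are the same choice by [epsilon]. *)
Lemma KLE : KL R Pi = hKL. Proof. by []. Qed.

(** * The pairing *)

Lemma hecke_W :
  [/\ forall w v, inW w -> inW v ->
        qm (hgam (- t^-1) (hKL^~ w) w) (hgam t (hKL^~ (wmul (invmx v) w0)) (wmul (invmx v) w0)) w0
          = (w == v)%:R * htau w0 w0,
      forall z a u, inW z -> a \in Pi -> (len (wmul (refl a) z) < len z)%N -> inW u ->
        hgam t (hKL^~ z) z (wmul (refl a) u) = act (refl a) (hgam t (hKL^~ z) z u),
      htau 1%:M 1%:M = 1,
      forall w a, inW w -> a \in Pi -> (len (wmul w (refl a)) < len w)%N = false ->
        htau (wmul w (refl a)) (wmul w (refl a)) = htau w w * sav (wmul w (refl a)) a &
      forall x v, inW x -> inW v -> hKL x v <> 0 -> bruhat x v].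
Proof.
apply: hecke_main.
- exact: W_uniq.
- exact: mem_W.
- exact: mulmxA.
- exact: mul1mx.
- exact: mulmx1.
- exact: inW1.
- exact: inW_mul.
- exact: inW_inv.
- by move=> u /inW_unit uU; exact: mulVmx.
- by move=> u /inW_unit uU; exact: mulmxV.
- by move=> w /inW_unit; exact: act_hom.
- by move=> w v x /inW_unit wU /inW_unit vU; exact: act_mul.
- exact: act_id.
- exact: (bar_hom n).
- by move=> w x /inW_unit; exact: bar_act.
- exact: tt_neq0.
- by move=> w /inW_unit; exact: act_tt.
- exact: bar_tt.
- exact: tt_inj.
- by move=> a /Pi_roots; exact: inW_refl.
- by move=> a /Pi_roots; exact: reflK.
- by move=> x y a /inW_unit xU yW aP; rewrite /sav av_act // mulmxA.
- move=> x a xW aP; rewrite /sav /wmul -mulmxA (refl_self (Pi_roots aP)) mulmxN.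
  exact/av_opp/mulroot_neq0.
- by move=> x a xW aP; exact/av_bar/mulroot_neq0.
- by move=> x a xW aP; exact/av_neq0/mulroot_neq0.
- move=> w wW; have [S [E sz]] := red_wordP wW; split; last exact: esym E.
  by split; [exact: S|rewrite sz; congr len; exact: esym E].
- exact: matsumoto.
- exact: len1.
- move=> w a wW aP; case p: (pos (w *m a)); first by left; exact: len_up.
  by right; apply: len_down => //; rewrite negE ?p // inW_root // Pi_roots.
- move=> w a wW aP; case p: (len w < len (refl a *m w))%N; first by left; exact: len_upl.
  by right; apply: len_downl => //; rewrite len_gtl // p.
- by move=> w wW; exact: descent_l.
- move=> w wW /(descent_r wW)[a aP na]; exists a => //.
  by rewrite [X in (_ < X)%N](len_down wW aP na).
- exact: bruhat_refl.
- exact: bruhat_trans.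
- exact: bruhat_len.
- by move=> u a uW aP; exact: bruhat_left.
- by move=> u v a aP vW; exact: bruhat_lift.
- exact: w0_W.
- exact: w0_max.
(* If y < s_a y, then y^-1 a is positive, so x a = w0 y^-1 a is negative and s_a is a right descent
   of x. *)
move=> x y a xW yW aP E lt; have aR := Pi_roots aP.
have p : pos (invmx y *m a) by rewrite -len_ltl.
have Ex : x = w0 *m invmx y by rewrite -E /wmul mulmxK // inW_unit.
have na : neg (x *m a) by rewrite Ex -mulmxA w0_neg.
by rewrite [X in (_ < X)%N](len_down xW aP na).
Qed.

(** [gam] sums over all of W; the terms outside the Bruhat interval vanish because the polynomials
    do. *)
Lemma gamma_pE v : inW v -> eqW inW (gamma_p R Pi v) (hgam t (hKL^~ v) v).
Proof.
have [_ _ _ _ sup] := hecke_W => vW u uW.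
rewrite /gamma_p /gam big_mkcond big_seq [RHS]big_seq; apply: eq_bigr => w /mem_W wW.
rewrite tauE // KLE /cf; case: pbP => [//|nb].
have [->|/eqP nz] := eqVneq (hKL w v) 0; first by rewrite evp0 mulr0 mul0r.
by case: nb; exact: sup.
Qed.

(** Absorbs the signs of gamma^- into powers of -t^-1. *)
Lemma sign_gen (F : fieldType) (t' : F) (a b : nat) : t' != 0 ->
  (-1) ^+ a * (-1) ^+ b / t' ^+ b * t' ^+ a = (- t'^-1) ^+ b / (- t'^-1) ^+ a /\
  t' ^+ 2 = (- t'^-1) ^- 2.
Proof.
move=> t0; split; last by rewrite sqrrN exprVn invrK.
rewrite !(exprNn t'^-1) !exprVn invfM invrK invr_sign.
by rewrite [in RHS]mulrACA -!mulrA mulrCA.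
Qed.

Lemma gamma_mE v : inW v -> eqW inW (gamma_m R Pi v) (hgam (- t^-1) (hKL^~ v) v).
Proof.
have [_ _ _ _ sup] := hecke_W => vW u uW.
rewrite /gamma_m /gam big_mkcond big_seq [RHS]big_seq; apply: eq_bigr => w /mem_W wW.
rewrite tauE // KLE /cf; case: pbP => [|nb]; last first.
  have [->|/eqP nz] := eqVneq (hKL w v) 0; first by rewrite evp0 mulr0 mul0r.
  by case: nb; exact: sup.
move=> _; congr (_ * _); have [-> ->] := sign_gen (len w) (len v) (tt_neq0 n).
by [].
Qed.

(** * Diagonal coefficients as products over inversions *)

Lemma prod_roots_W w (P : pred 'cV[int]_n) (f : 'cV[int]_n -> Q) : inW w ->
  \prod_(b <- roots | P b) f (w *m b) = \prod_(b <- roots | P (invmx w *m b)) f b.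
Proof.
move=> wW; have wU := inW_unit wW; have [U1 _] := HR.
have pe : perm_eq [seq w *m b | b <- roots] roots.
  apply: uniq_perm => //.
    by rewrite map_inj_uniq // => x y E; rewrite -[x](mulKmx wU) E mulKmx.
  move=> b; apply/mapP/idP => [[b' b'R ->]|bR]; first exact: inW_root.
  by exists (invmx w *m b); rewrite ?mulKVmx // (inW_root (inW_inv wW) bR).
rewrite -[RHS](perm_big _ pe) [RHS]big_map; apply: eq_big => [b|b _]; last by [].
by rewrite mulKmx.
Qed.

Lemma neg_reflE a b : a \in Pi -> b \in roots -> b != a -> b != - a ->
  neg (refl a *m b) = neg b.
Proof.
move=> aP bR ba bna; have rR := refl_root_in (Pi_roots aP) bR.
case p: (pos b); first by rewrite !negE // p simple_perm.
have nb : neg b by rewrite negE // p.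
have p' : pos (- b) by rewrite pos_opp.
have : pos (refl a *m - b) by apply: simple_perm => //; rewrite eqr_oppLR.
by rewrite mulmxN pos_opp nb.
Qed.

(** Passing from w' to a longer w = w' s_a adds the single factor for the positive root w' a, and
    the diagonal coefficient gains the value at w a = - w' a. *)
Lemma tau_diag_prod w : inW w ->
  htau w w = \prod_(b <- roots | pos b && neg (invmx w *m b)) av (- b).
Proof.
have [_ _ t1 step _] := hecke_W; have [U1 _] := HR.
have [k] := ubnP (len w); elim: k w => // k IH w; rewrite ltnS => lk wW.
have [->|w1] := eqVneq w 1%:M.
  rewrite t1 big1_seq // => b /andP[/andP[posb nb] bR].
  by move: nb; rewrite invmx1 mul1mx negE // posb.
have [a aP na] := descent_r wW w1; have aR := Pi_roots aP.
have ld := len_down wW aP na; set w' := w *m refl a in ld.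
have w'W : inW w' by exact: inW_mrefl.
have Ew : w = w' *m refl a by rewrite /w' (mulrK_refl _ aR).
have up : (len (wmul w' (refl a)) < len w')%N = false.
  by rewrite /wmul -Ew ld ltnNge leqnSn.
have := step w' a w'W aP up; rewrite /wmul -Ew => ->.
rewrite IH //; last by rewrite -ld in lk *; apply: leq_trans lk; rewrite ld.
have bR : w' *m a \in roots by exact: inW_root.
have w'a : w *m a = - (w' *m a) by rewrite Ew -mulmxA (refl_self aR) mulmxN.
have posb : pos (w' *m a) by move: na; rewrite w'a neg_opp.
have w'U := inW_unit w'W; have sU := inW_unit (inW_refl aR).
have iw b : invmx w *m b = refl a *m (invmx w' *m b).
  apply: (can_inj (mulKmx (inW_unit wW))).
  rewrite /= mulKVmx ?inW_unit // {1}Ew -mulmxA (mulmxA (refl a)) (reflK aR) mul1mx.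
  by rewrite mulKVmx.
rewrite [RHS]big_mkcond (bigD1_seq _ bR U1) /= -big_mkcondr /=.
rewrite posb iw mulKmx // refl_self // neg_opp simple_pos //.
rewrite mulrC /sav w'a; congr (_ * _).
rewrite big_seq_cond [RHS]big_seq_cond; apply: eq_bigl => b.
case cR: (b \in roots) => //=; case pb: (pos b) => /=; last by rewrite andbF.
have [->|ne] := eqVneq b (w' *m a).
  by rewrite mulKmx // negE // simple_pos.
rewrite iw neg_reflE //; first exact/inW_root/cR/inW_inv.
  by apply: contra ne => /eqP <-; rewrite mulKVmx.
apply/eqP => e; have : b = - (w' *m a) by rewrite -mulmxN -e mulKVmx.
by move=> e2; move: pb; rewrite e2 pos_opp negE // posb.
Qed.

Lemma act_prod w (I : Type) (r : seq I) (P : pred I) (f : I -> Q) : w \in unitmx ->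
  act w (\prod_(i <- r | P i) f i) = \prod_(i <- r | P i) act w (f i).
Proof. by move=> wU; have [g ->] := act_rmorph wU; rewrite rmorph_prod. Qed.

Lemma act_xa w b : w \in unitmx -> act w (xa b) = xa (w *m b).
Proof.
move=> wU; have h := act_hom wU.
by rewrite /xa (homB h) (hom1 h) act_ex // mulmxN.
Qed.

Lemma xPi_neq0 : xPi R Pi != 0.
Proof.
rewrite prodf_seq_neq0; apply/allP => b bR; apply/implyP => _.
exact/xa_neq0/root_neq0.
Qed.

(** For w0 every positive root b contributes a factor (t - t^-1 e^-b)/(1 - e^-b), and w0(x_Pi) is
    exactly the product of these denominators. *)
Lemma act_w0_xPi : act w0 (xPi R Pi) * htau w0 w0 = prod_pos R Pi.
Proof.
have w0U := inW_unit w0_W.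
rewrite (tau_diag_prod w0_W) /xPi act_prod //.
under eq_bigr => b _ do rewrite act_xa //.
rewrite (prod_roots_W _ _ w0_W).
have -> : \prod_(b <- roots | neg (invmx w0 *m b)) xa b = \prod_(b <- roots | pos b) xa b.
  rewrite big_seq_cond [RHS]big_seq_cond; apply: eq_bigl => b.
  case bR: (b \in roots) => //=; rewrite negE ?(inW_root (inW_inv w0_W) bR) //.
  by rewrite w0i_posE // negE // negbK.
have -> : \prod_(b <- roots | pos b && neg (invmx w0 *m b)) av (- b) = \prod_(b <- roots | pos
  b) av (- b).
  rewrite big_seq_cond [RHS]big_seq_cond; apply: eq_bigl => b.
  case bR: (b \in roots) => //=; rewrite negE ?(inW_root (inW_inv w0_W) bR) //.
  by rewrite w0i_posE // negE // negbK andbb.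
rewrite -big_split /prod_pos big_seq_cond [RHS]big_seq_cond; apply: eq_bigr => b /andP[bR _].
have b0 := root_neq0 bR; have [_ e2] := ts_gen (tt_neq0 n) (ex_neq0 (- b)) (xa_neq0 b0).
rewrite /= /av opprK -[ex b]invrK -exN e2 /xa mulrCA divff ?mulr1 //.
exact: xa_neq0.
Qed.

Lemma cancel_gen (F : fieldType) (a b c d : F) : b != 0 ->
  a * b * (c * d) * b^-1 = c * (a * d).
Proof. by move=> b0; field. Qed.

Lemma assoc_gen (F : fieldType) (a b c d : F) : a * b * (c * d) = a * c * (b * d).
Proof. by ring. Qed.

Lemma sumW_W (V : nmodType) g (F : 'M[int]_n -> V) : inW g ->
  (forall w, inW w -> w != g -> F w = 0) -> \sum_(w <- W) F w = F g.
Proof. exact: (sumW_one W_uniq mem_W). Qed.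

Lemma sumW_shift g (F : 'M[int]_n -> Q) : inW g ->
  \sum_(w <- W) F w = \sum_(w <- W) F (g *m w).
Proof.
move=> gW; have gU := inW_unit gW.
have pe : perm_eq [seq g *m w | w <- W] W.
  apply: uniq_perm; last 1 first.
  - move=> w; apply/mapP/idP => [[v /mem_W vW ->]|/mem_W wW]; first exact/mem_W/inW_mul.
    exists (invmx g *m w); last by rewrite mulKVmx.
    exact/mem_W/inW_mul/wW/inW_inv.
  - rewrite map_inj_uniq ?W_uniq // => x y E.
    by rewrite -[x](mulKmx gU) E mulKmx.
  - exact: W_uniq.
by rewrite -(perm_big _ pe) big_map.
Qed.

(** * The two actions in coordinates *)

Lemma bulletE (x f : 'M[int]_n -> Q) u : inW u ->
  bullet R x f u = \sum_(w <- W) f (u *m w) * act u (x w).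
Proof.
move=> uW; rewrite /bullet big_seq [RHS]big_seq; apply: eq_bigr => w /mem_W wW.
have uwW := inW_mul uW wW.
rewrite big_mkcond (sumW_W uwW) => [|v _ /negPf nv]; first by rewrite eqxx.
by rewrite eq_sym nv.
Qed.

Lemma QW_dlt_scal w (c : Q) u : inW w -> inW u ->
  QWmul R (dlt w) (scal c) u = (u == w)%:R * act w c.
Proof.
move=> wW uW; have h := act_hom (inW_unit wW).
rewrite /QWmul (sumW_W wW) => [|v _ /negPf nv]; last first.
  by rewrite big1 // => v' _; rewrite /dlt nv mul0r.
rewrite big_mkcond (sumW_W inW1) => [|v vW /negPf nv]; last first.
  by case: ifP => // _; rewrite /scal /dlt nv mulr0 (hom0 h) mulr0.
rewrite mulmx1 /scal /dlt !eqxx mulr1 mul1r eq_sym; case: eqP => _; by rewrite ?mul1r ?mul0r.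
Qed.

Lemma bullet_sum (A : seq 'M[int]_n) (P : pred 'M[int]_n) (c : Q) (f : 'M[int]_n -> Q) u :
  uniq A -> (forall w, w \in A -> inW w) -> inW u ->
  bullet R (fun v => \sum_(w <- A | P w) QWmul R (dlt w) (scal c) v) f u
    = \sum_(w <- A | P w) f (u *m w) * act (u *m w) c.
Proof.
move=> uA AW uW; rewrite bulletE //; have h := act_hom (inW_unit uW).
transitivity (\sum_(v <- W) \sum_(w <- A | P w) (v == w)%:R * (f (u *m w) * act (u *m w) c)).
  rewrite big_seq [RHS]big_seq; apply: eq_bigr => v /mem_W vW.
  rewrite (hom_sum _ _ _ h) mulr_sumr big_seq_cond [RHS]big_seq_cond.
  apply: eq_bigr => w /andP[/AW wW _].
  rewrite QW_dlt_scal // (homM h) (homn h) -act_mul ?inW_unit // mulrCA.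
  by case: eqP => [->//|_]; rewrite !mul0r.
rewrite exchange_big /= big_seq_cond [RHS]big_seq_cond; apply: eq_bigr => w /andP[/AW wW _].
rewrite (sumW_W wW) => [|v _ /negPf nv]; first by rewrite eqxx mul1r.
by rewrite nv mul0r.
Qed.

Lemma odot_pt_e (x : 'M[int]_n -> Q) u : inW u -> odot R x (pt_e R Pi) u = x u * act u (xPi R Pi).
Proof.
move=> uW; rewrite /odot (sumW_W uW) => [|w wW nw].
  rewrite big_mkcond (sumW_W inW1) => [|v _ /negPf nv].
    by rewrite mulmx1 eqxx /pt_e /dlt eqxx mulr1.
  case: ifP => // _; have h := act_hom (inW_unit uW).
  by rewrite /pt_e /dlt nv mulr0 (hom0 h) mulr0.
have h := act_hom (inW_unit wW).
rewrite big1 // => v /eqP E; rewrite /pt_e /dlt; case: eqP => [v1|_].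
  by move: nw; rewrite -E v1 mulmx1 eqxx.
by rewrite mulr0 (hom0 h) mulr0.
Qed.

Lemma bullet_pt (x : 'M[int]_n -> Q) w u : inW w -> inW u ->
  bullet R x (pt R Pi w) u = act w (xPi R Pi) * act u (x (invmx u *m w)).
Proof.
move=> wW uW; have uU := inW_unit uW; have iW := inW_mul (inW_inv uW) wW.
rewrite bulletE // (sumW_W iW) => [|v _ nv].
  by rewrite mulKVmx // /pt /dlt eqxx mulr1.
rewrite /pt /dlt; case: eqP => [E|_]; last by rewrite mulr0 mul0r.
by move: nv; rewrite -E mulKmx // eqxx.
Qed.

Notation GM w := (odot R (gamma_m R Pi w) (pt_e R Pi)).
Notation GP v := (bullet R (gamma_p R Pi (invmx v *m w0)) (pt R Pi w0)).

Lemma qm_E (x y : 'M[int]_n -> Q) u : inW u ->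
  qm x y u = \sum_(w <- W) x w * act w (y (invmx w *m u)).
Proof.
apply: (@qmulE _ wmul 1%:M (@invmx _ n) W inW W_uniq mem_W).
- exact: mulmxA.
- exact: mul1mx.
- exact: inW_mul.
- exact: inW_inv.
- by move=> v /inW_unit vU; exact: mulVmx.
- by move=> v /inW_unit vU; exact: mulmxV.
Qed.

Lemma pairing_sum w v : inW w -> inW v ->
  \sum_(u <- W) GM w u * GP v u * act u (xPi R Pi)^-1 = (w == v)%:R * prod_pos R Pi.
Proof.
move=> wW vW; have [dual _ _ _ _] := hecke_W; have zW := inW_mul (inW_inv vW) w0_W.
rewrite -act_w0_xPi mulrCA -(dual w v wW vW) (qm_E _ _ w0_W) mulr_sumr.
rewrite big_seq [RHS]big_seq; apply: eq_bigr => u /mem_W uW.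
have h := act_hom (inW_unit uW); have uzW := inW_mul (inW_inv uW) w0_W.
rewrite odot_pt_e // bullet_pt //; last exact: w0_W.
rewrite (gamma_mE wW uW) (gamma_pE zW uzW) (homV h).
have n0 : act u (xPi R Pi) != 0 by rewrite (homeq0 h) xPi_neq0.
by rewrite cancel_gen.
Qed.

(** The value at u is a sum over the translate u W = W, so every coefficient equals the one sum
    already computed. *)
Lemma pairing_full w v u : inW w -> inW v -> inW u ->
  bullet R (YPi R Pi) (dmul (GM w) (GP v)) u = (w == v)%:R * prod_pos R Pi * one_dual u.
Proof.
move=> wW vW uW; rewrite /one_dual mulr1 -(pairing_sum wW vW) (sumW_shift _ uW).
by rewrite /YPi bullet_sum ?W_uniq // => x /mem_W.
Qed.

(** * Parabolic subgroups and the relative pairing *)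

Section Parabolic.
Variable J : seq 'cV[int]_n.
Hypothesis JP : {subset J <= Pi}.
Notation WJ := (in_WJ R J).

Lemma WJ_W x : WJ x -> inW x.
Proof. by case=> ws [S ->]; apply: inW_wordPi => a /S /JP. Qed.

Lemma WJ_mul x y : WJ x -> WJ y -> WJ (x *m y).
Proof.
case=> ws [S ->] [ws' [S' ->]]; exists (ws ++ ws'); rewrite word_cat; split=> //.
by move=> a; rewrite mem_cat => /orP[/S|/S'].
Qed.

Lemma WJ_inv x : WJ x -> WJ (invmx x).
Proof.
move=> xJ; have xU := inW_unit (WJ_W xJ); case: xJ => ws [S E].
exists (rev ws); split; first by move=> a; rewrite mem_rev => /S.
have SR : {subset ws <= roots} by move=> a /S /JP /Pi_roots.
by rewrite -[invmx x]mulmx1 -(word_rev SR) -E mulKmx.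
Qed.

Lemma span_refl a b : a \in J -> in_span J (refl a *m b) = in_span J b.
Proof.
move=> aJ.
have sub c (k : int) : int_comb J c -> int_comb J (c - k *: a).
  case=> f ->; have ia : (index a J < size J)%N by rewrite index_mem.
  exists (fun i => f i - k * (i == index a J)%:Z).
  under [RHS]eq_bigr => i _ do rewrite scalerBl.
  rewrite sumrB; congr (_ - _); rewrite (bigD1 (Ordinal ia)) //= eqxx mulr1 nth_index //.
  by rewrite big1 ?addr0 // => i; rewrite -val_eqE /= => /negPf ->; rewrite mulr0 scale0r.
apply/pbP/pbP => H.
  have := sub _ (- pairing b (coroot a)) H.
  by rewrite reflE scaleNr opprK subrK.
by rewrite reflE; apply: sub.
Qed.

Lemma span_simple a : a \in J -> in_span J a.
Proof.
move=> aJ; have ia : (index a J < size J)%N by rewrite index_mem.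
apply/pbP; exists (fun i => (i == index a J)%:Z).
rewrite (bigD1 (Ordinal ia)) //= eqxx scale1r nth_index // big1 ?addr0 // => i.
by rewrite -val_eqE /= => /negPf ->; rewrite scale0r.
Qed.

Lemma xJ_neq0 : xJ R Pi J != 0.
Proof.
rewrite prodf_seq_neq0; apply/allP => b bR; apply/implyP => _.
exact/xa_neq0/root_neq0.
Qed.

Lemma xPiJE : xPiJ R Pi J = \prod_(b <- roots | neg b && ~~ in_span J b) xa b.
Proof. by rewrite /xPiJ {1}/xPi (bigID (in_span J)) /= -/(xJ R Pi J) mulrC mulKf // xJ_neq0. Qed.

(** For a in J, s_a preserves the span of J, and a and -a, the only roots whose sign it changes, lie
    in that span; so it permutes the negative roots outside the span. *)
Lemma act_xPiJ x : WJ x -> act x (xPiJ R Pi J) = xPiJ R Pi J.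
Proof.
case=> ws [S ->]; elim: ws S => [|a ws IH] S; first exact: act_id.
have aJ : a \in J by apply: S; rewrite mem_head.
have S' : {subset ws <= J} by move=> b bw; apply: S; rewrite inE bw orbT.
have aP := JP aJ; have aR := Pi_roots aP; have sW := inW_refl aR.
have wsW : inW (word ws) by apply: WJ_W; exists ws.
have sU := inW_unit sW; have wU := inW_unit wsW.
rewrite -[word (a :: ws)]/(refl a *m word ws) act_mul // IH // xPiJE act_prod //.
under eq_bigr => b _ do rewrite act_xa //.
rewrite (prod_roots_W _ _ sW) big_seq_cond [RHS]big_seq_cond; apply: eq_bigl => b.
case bR: (b \in roots) => //=.
have -> : invmx (refl a) = refl a by rewrite -[LHS]mulmx1 -(reflK aR) mulKmx.
rewrite span_refl //; case sp: (in_span J b) => //=; first by rewrite !andbF.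
rewrite !andbT; apply: neg_reflE => //.
  by apply/eqP => e; move: sp; rewrite e span_simple.
by apply/eqP => e; move: sp; rewrite e -(refl_self aR) span_refl // span_simple.
Qed.

(** Minimality of v gives v a > 0 for a in J, hence (v^-1 w0)^-1 a = w0^-1 v a < 0. The twist by s_a
    in the invariance of gamma^+ is undone by the action of u s_a. *)
Lemma GP_inv v u x : in_WJmin R Pi J v -> inW u -> WJ x -> GP v (u *m x) = GP v u.
Proof.
case=> vW vmin uW [ws [S ->]]; have [_ inv _ _ _] := hecke_W.
elim: ws u uW S => [|a ws IH] u uW S; first by rewrite mulmx1.
have aJ : a \in J by apply: S; rewrite mem_head.
have S' : {subset ws <= J} by move=> b bw; apply: S; rewrite inE bw orbT.
have aP := JP aJ; have aR := Pi_roots aP; have sW := inW_refl aR.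
have usW := inW_mul uW sW.
rewrite -[word (a :: ws)]/(refl a *m word ws) mulmxA (IH _ usW S').
have zW := inW_mul (inW_inv vW) w0_W; set z := invmx v *m w0 in zW *.
have lt : (len (wmul (refl a) z) < len z)%N.
  rewrite len_gtl // len_ltl // /z.
  have -> : invmx (invmx v *m w0) *m a = invmx w0 *m (v *m a).
    apply: (can_inj (mulKmx (inW_unit zW))).
    have vU := inW_unit vW; have w0U := inW_unit w0_W; have zU := inW_unit zW.
    by rewrite (mulKVmx zU) /z -!mulmxA (mulKVmx w0U) (mulKmx vU).
  have vaR := inW_root vW aR; rewrite w0i_posE // negE // negbK -len_refl ?simple_pos //.
  have sJ : WJ (refl a).
    by exists [:: a]; split; [move=> b; rewrite inE => /eqP ->|rewrite /= mulmx1].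
  (* Minimality gives only a weak inequality; equality is excluded because a simple reflection
     changes the length by exactly one. *)
  have := vmin _ sJ; rewrite leq_eqVlt => /orP[/eqP e|//].
  case p: (pos (v *m a)); first by rewrite (len_up vW aP p) ltnSn.
  have nva : neg (v *m a) by rewrite negE // p.
  by have := len_down vW aP nva; rewrite -e => /eqP; rewrite eqn_leq ltnn andbF.
rewrite (bullet_pt _ w0_W usW) (bullet_pt _ w0_W uW).
have uzW := inW_mul (inW_inv uW) w0_W.
have E : invmx (u *m refl a) *m w0 = wmul (refl a) (invmx u *m w0).
  have sK := reflK aR; apply: (can_inj (mulKmx (inW_unit usW))).
  by rewrite mulKVmx ?inW_unit // /wmul -mulmxA (mulKr _ aR) mulKVmx // inW_unit.
congr (_ * _); rewrite E (gamma_pE zW); last exact: inW_mul.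
rewrite (gamma_pE zW uzW) (inv z a _ zW aP lt uzW) -act_mul ?inW_unit //.
by rewrite (mulrK_refl _ aR).
Qed.

(** The second factor and x_{Pi/J} are constant along the cosets of W_J, so they move inside the sum
    over W_J. The double sum over A and W_J is then the sum over W that computes the first
    pairing. *)
Lemma pairing_parabolic (A : seq 'M[int]_n) : is_coset_reps R J A ->
  forall w v u, in_WJmin R Pi J w -> in_WJmin R Pi J v -> inW u ->
  bullet R (YPiJ R Pi J A) (dmul (bullet R (YJ R Pi J) (GM w)) (GP v)) u
    = (w == v)%:R * prod_pos R Pi * one_dual u.
Proof.
case=> uA [AW [Aex Auniq]] w v u [wW _] vJ uW; have [vW _] := vJ.
rewrite /one_dual mulr1 -(pairing_sum wW vW) (sumW_shift _ uW).
rewrite (bullet_sum xpredT _ _ uA AW uW).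
pose L y := GM w (u *m y) * GP v (u *m y) * act (u *m y) (xPi R Pi)^-1.
transitivity (\sum_(a <- A) \sum_(x <- [seq x <- W | pb (WJ x)]) L (a *m x)).
  rewrite big_seq [RHS]big_seq; apply: eq_bigr => a aA; have aW := AW a aA.
  have uaW := inW_mul uW aW.
  rewrite /dmul (bullet_sum (fun x => pb (WJ x)) _ _ W_uniq) //; last by move=> x /mem_W.
  rewrite big_filter -mulrA mulr_suml; apply: eq_bigr => x /pbP xWJ.
  have xW := WJ_W xWJ; have xU := inW_unit xW; have uaU := inW_unit uaW.
  have uaxW := inW_mul uaW xW; have h := act_hom (inW_unit uaxW).
  rewrite /L mulmxA (GP_inv vJ uaW xWJ).
  have -> : act (u *m a) (xPiJ R Pi J)^-1 = act (u *m a *m x) (xPiJ R Pi J)^-1.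
    have hx := act_hom xU; have ha := act_hom uaU.
    by rewrite (act_mul _ uaU xU) (homV hx) act_xPiJ.
  have -> : (xPi R Pi)^-1 = (xJ R Pi J)^-1 * (xPiJ R Pi J)^-1.
    by rewrite /xPiJ invfM invrK mulrCA mulVf ?mulr1 // xJ_neq0.
  rewrite (homM h); exact: assoc_gen.
pose AJ := [seq u *m v | u <- A, v <- [seq x <- W | pb (WJ x)]].
have pe : perm_eq AJ W.
  apply: uniq_perm; last 1 first.
  - move=> y; apply/allpairsP/idP => [[[a x] /= [aA]]|/mem_W yW].
      by rewrite mem_filter => /andP[_ /mem_W xW] ->; apply/mem_W/inW_mul/xW/AW.
    have [a [aA [x [xWJ E]]]] := Aex y yW; exists (a, x); split=> //.
    rewrite mem_filter; apply/andP; split; first exact/pbP.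
    exact/mem_W/WJ_W.
  - apply: allpairs_uniq => //; first exact/filter_uniq/W_uniq.
    move=> [a x] [a' x'] /allpairsP[[b y] /= [bA yF [-> ->]]] /allpairsP[[b' y'] /= [bA' yF' [->
      ->]]] E.
    move: yF yF'; rewrite !mem_filter => /andP[/pbP yJ _] /andP[/pbP yJ' _].
    have yU := inW_unit (WJ_W yJ); have yU' := inW_unit (WJ_W yJ').
    have e : b = b'.
      apply: Auniq => //; exists (y *m invmx y'); split; first exact/WJ_mul/WJ_inv.
      by rewrite mulmxA E mulmxK.
    have bU := inW_unit (AW b bA); rewrite -e in E *.
    by rewrite -[y](mulKmx bU) E mulKmx.
  - exact: W_uniq.
by rewrite -[RHS](perm_big _ pe) /AJ big_allpairs_dep.
Qed.

End Parabolic.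

End RootSystem.

Theorem theorem2p4 (n : nat) (R : seq ('cV[int]_n * 'cV[int]_n)) (Pi : seq 'cV[int]_n) :
  is_root_datum R -> is_base R Pi ->
  (forall w v, in_W R w -> in_W R v ->
     forall u, in_W R u ->
       bullet R (YPi R Pi)
         (dmul (odot R (gamma_m R Pi w) (pt_e R Pi))
               (bullet R (gamma_p R Pi (invmx v *m w0 R Pi)) (pt R Pi (w0 R Pi)))) u
       = (w == v)%:R * prod_pos R Pi * one_dual u)
  /\
  (forall J : seq 'cV[int]_n, {subset J <= Pi} ->
   forall A : seq 'M[int]_n, is_coset_reps R J A ->
   forall w v, in_WJmin R Pi J w -> in_WJmin R Pi J v ->
     forall u, in_W R u ->
       bullet R (YPiJ R Pi J A)
         (dmul (bullet R (YJ R Pi J) (odot R (gamma_m R Pi w) (pt_e R Pi)))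
               (bullet R (gamma_p R Pi (invmx v *m w0 R Pi)) (pt R Pi (w0 R Pi)))) u
       = (w == v)%:R * prod_pos R Pi * one_dual u).
Proof.
move=> HR HB; split.
  by move=> w v wW vW u uW; exact: pairing_full.
by move=> J JP A HA w v wJ vJ u uW; exact: pairing_parabolic.
Qed.
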